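(* Let $M^n\to\mathbb CP^n(4)$ be a Lagrangian immersion of a Riemannian manifold of dimension $n\ge 3$, with second fundamental form $h$. Assume that there are a real constant $d\neq 0,\tfrac12$, a local orthonormal frame $\{e_1,\dots,e_n\}$ on $M^n$, a function $\lambda\neq 0$ (nowhere zero) and functions $h_{\alpha\beta}^\gamma$ such that for all $\alpha,\beta\in\{2,\dots,n\}$ $$h(e_1,e_1)=\lambda Je_1,\qquad h(e_1,e_\alpha)=d\lambda Je_\alpha,\qquad h(e_\alpha,e_\beta)=\delta_{\alpha\beta}\,d\lambda Je_1+\sum_{\gamma=2}^n h_{\alpha\beta}^\gamma Je_\gamma,$$ with $\sum_{\alpha=2}^n h_{\alpha\alpha}^\gamma=0$ for every $\gamma=2,\dots,n$. Put $\mu=\frac{d}{(1-2d)\lambda}e_1(\lambda)$. Then, up to isometries of $\mathbb CP^n(4)$, the horizontal lift of the immersion to $S^{2n+1}(1)\subseteq\mathbb C^{n+1}=\mathbb C^n\times\mathbb C$ is given, in suitable local coordinates $(t,u_2,\dots,u_n)$ on $M^n$ with $\frac{\partial}{\partial t}=e_1$, by $$L(t,u_2,\dots,u_n)=\left(\frac{e^{id\theta}\,\phi(u_2,\dots,u_n)}{\sqrt{1+\mu^2+d^2\lambda^2}},\ \frac{e^{i(1-d)\theta}(id\lambda-\mu)}{\sqrt{1+\mu^2+d^2\lambda^2}}\right),$$ where $\lambda$, $\mu$ and $\theta$ are functions of $t$ only satisfying $$\lambda'=\frac{1-2d}{d}\lambda\mu,\qquad \mu'=-1-\mu^2-d(1-d)\lambda^2,\qquad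 \theta'=\lambda,$$ and $\phi$ is a minimal Legendrian immersion (of an $(n-1)$-dimensional manifold with local coordinates $u_2,\dots,u_n$) into the unit sphere $S^{2n-1}(1)\subseteq\mathbb C^n$.
   Context: $\mathbb CP^n(4)$ is complex projective space of complex dimension $n$ with the Kähler metric of constant holomorphic sectional curvature $4$ and complex structure $J$. An isometric immersion of a real $n$-dimensional Riemannian manifold into a Kähler manifold of complex dimension $n$ is Lagrangian if $J$ is an isomorphism between the tangent space and the normal space of the submanifold at each of its points. For each $m$, the unit sphere $S^{2m+1}(1)\subseteq\mathbb C^{m+1}$ carries the contact form $\eta$ dual to the vector field $\xi(z)=iz$; an immersion of an $m$-dimensional manifold into $S^{2m+1}(1)$ is Legendrian if $\eta(X)=0$ for all tangent vectors $X$; minimal means minimal in the sphere. Let $\pi:S^{2n+1}(1)\to\mathbb CP^n(4)$ be the Hopf fibration, whose fibers are the integral curves of $\xi$. Every Lagrangian immersion $f:M^n\to\mathbb CP^n(4)$ can locally be lifted to a Legendrian immersion $L$ into $S^{2n+1}(1)$ with $\pi\circ L=f$; such an $L$ is called a horizontal lift. The description of the immersion is local. A prime denotes the derivative with respect to $t$. *)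

(* Defs.v *)
From HB Require Import structures.
From mathcomp Require Import all_boot all_order all_algebra.
From mathcomp Require Import spectral complex.
From mathcomp Require Import boolp classical_sets functions reals topology.
From mathcomp Require Import normedtype derive realfun trigo.

Set Implicit Arguments.
Unset Strict Implicit.
Unset Printing Implicit Defensive.

Import Order.TTheory GRing.Theory Num.Theory.
Import numFieldNormedType.Exports.
Local Open Scope classical_set_scope.
Local Open Scope sesquilinear_scope.
Local Open Scope ring_scope.
Local Open Scope complex_scope.

(* Smooth maps on open subsets of 'rV[R]_k *)

Fixpoint Ck_on (R : realType) (k : nat) (V : normedModType R) (r : nat)
    (U : set 'rV[R]_k) (f : 'rV[R]_k -> V) : Prop :=
  match r with
  | 0%N => forall x, U x -> {for x, continuous f}
  | r'.+1 => (forall x, U x -> differentiable f x) /\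
             forall v : 'rV[R]_k, Ck_on r' U (fun x => 'D_v f x)
  end.

Definition smooth_on (R : realType) (k : nat) (V : normedModType R)
    (U : set 'rV[R]_k) (f : 'rV[R]_k -> V) : Prop :=
  forall r, Ck_on r U f.

(* A complex matrix space is a real vector space through the real and
   imaginary parts of the entries; smoothness and directional derivatives of
   maps into it are taken entrywise. *)
Definition csmooth_on (R : realType) (k p q : nat)
    (U : set 'rV[R]_k) (F : 'rV[R]_k -> 'M[R[i]]_(p, q)) : Prop :=
  forall i j, smooth_on U (fun x => complex.Re (F x i j)) /\
              smooth_on U (fun x => complex.Im (F x i j)).

Definition cderive (R : realType) (k p q : nat)
    (F : 'rV[R]_k -> 'M[R[i]]_(p, q)) (x v : 'rV[R]_k) : 'M[R[i]]_(p, q) :=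
  \matrix_(i, j) ('D_v (fun y => complex.Re (F y i j)) x +i*
                  'D_v (fun y => complex.Im (F y i j)) x).

(* Euclidean geometry of complex matrices *)

Definition redot (R : realType) (p q : nat) (A B : 'M[R[i]]_(p, q)) : R :=
  complex.Re (\tr (A *m B^t*)).

Definition gram (R : realType) (p q k : nat) (v : 'I_k -> 'M[R[i]]_(p, q)) :
    'M[R]_k :=
  \matrix_(a, b) redot (v a) (v b).

(* The component of A orthogonal to the real span of the (independent)
   family v. *)
Definition normal_part (R : realType) (p q k : nat)
    (v : 'I_k -> 'M[R[i]]_(p, q)) (A : 'M[R[i]]_(p, q)) : 'M[R[i]]_(p, q) :=
  A - \sum_a \sum_b (redot A (v b) * invmx (gram v) b a)%:C *: v a.

(* Smooth manifolds *)

Record chart (R : realType) (k : nat) (M : topologicalType) := Chart {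
  chart_dom : set M;
  chart_cod : set 'rV[R]_k;
  chart_to : M -> 'rV[R]_k;
  chart_from : 'rV[R]_k -> M;
  chart_dom_open : open chart_dom;
  chart_cod_open : open chart_cod;
  chart_toP : forall p, chart_dom p ->
    chart_cod (chart_to p) /\ chart_from (chart_to p) = p;
  chart_fromP : forall x, chart_cod x ->
    chart_dom (chart_from x) /\ chart_to (chart_from x) = x;
  chart_to_continuous : forall p, chart_dom p -> {for p, continuous chart_to};
  chart_from_continuous : forall x, chart_cod x ->
    {for x, continuous chart_from} }.

Definition smooth_transition (R : realType) (k : nat) (M : topologicalType)
    (c c' : chart R k M) : Prop :=
  smooth_on [set x | chart_cod c x /\ chart_dom c' (chart_from c x)]
    (chart_to c' \o chart_from c).

(* As each point carries a preferred chart of the atlas, a tangent vector at p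
   is encoded by its coordinates in the chart preferred at p. *)
Record manifold (R : realType) (k : nat) := Manifold {
  carrier :> topologicalType;
  atlas : set (chart R k carrier);
  chart_at : carrier -> chart R k carrier;
  manifold_hausdorff : hausdorff_space carrier;
  manifold_second_countable : @second_countable carrier;
  atlas_chart_at : forall p, atlas (chart_at p);
  dom_chart_at : forall p, chart_dom (chart_at p) p;
  atlas_smooth : forall c c', atlas c -> atlas c' -> smooth_transition c c' }.

Definition smooth_chart (R : realType) (k : nat) (M : manifold R k)
    (c : chart R k M) : Prop :=
  forall c', atlas c' -> smooth_transition c c' /\ smooth_transition c' c.

Definition msmooth (R : realType) (k : nat) (M : manifold R k)
    (V : normedModType R) (W : set M) (F : M -> V) : Prop :=
  forall c, atlas c ->
    smooth_on [set x | chart_cod c x /\ W (chart_from c x)]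
      (F \o chart_from c).

Definition mcsmooth (R : realType) (k p q : nat) (M : manifold R k)
    (W : set M) (F : M -> 'M[R[i]]_(p, q)) : Prop :=
  forall c, atlas c ->
    csmooth_on [set x | chart_cod c x /\ W (chart_from c x)]
      (F \o chart_from c).

(* dF_p(v), for F with values in a normed space, resp. in complex matrices *)
Definition mderive (R : realType) (k : nat) (M : manifold R k)
    (V : normedModType R) (F : M -> V) (p : M) (v : 'rV[R]_k) : V :=
  'D_v (F \o chart_from (chart_at p)) (chart_to (chart_at p) p).

Definition mcderive (R : realType) (k p q : nat) (M : manifold R k)
    (F : M -> 'M[R[i]]_(p, q)) (x : M) (v : 'rV[R]_k) : 'M[R[i]]_(p, q) :=
  cderive (F \o chart_from (chart_at x)) (chart_to (chart_at x) x) v.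

Definition smooth_vector_field (R : realType) (k : nat) (M : manifold R k)
    (W : set M) (X : M -> 'rV[R]_k) : Prop :=
  forall (V : set M) (F : M -> R), open V -> V `<=` W ->
    msmooth V F -> msmooth V (fun p => mderive F p (X p)).

Definition inner (R : realType) (k : nat) (G : 'M[R]_k) (v w : 'rV[R]_k) : R :=
  (v *m G *m w^T) 0 0.

Record riemannian_manifold (R : realType) (k : nat) := RiemannianManifold {
  underlying :> manifold R k;
  metric : underlying -> 'M[R]_k;
  metric_sym : forall p, (metric p)^T = metric p;
  metric_pos : forall p v, v != 0 -> 0 < inner (metric p) v v;
  metric_smooth : forall (V : set underlying) X Y, open V ->
    smooth_vector_field V X -> smooth_vector_field V Y ->
    msmooth V (fun p => inner (metric p) (X p) (Y p)) }.

(* CP^m(4): the point [z], |z| = 1, is represented by the orthogonal projector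
   z^t* *m z onto the line spanned by the row vector z.  For w horizontal,
   i.e. w *m z^t* = 0, the Hopf fibration maps the tangent vector w at z to
   w^t* *m z + z^t* *m w, so that the metric making it a Riemannian
   submersion is half the trace form, and the complex structure induced by
   w |-> i w is A |-> i (P A - A P); see hopf_metric and hopf_J below. *)

Definition CP (R : realType) (m : nat) : set 'M[R[i]]_m.+1 :=
  [set P | [/\ P^t* = P, P *m P = P & \tr P = 1]].

Arguments CP : clear implicits.

Definition CP_tangent (R : realType) (m : nat) (P : 'M[R[i]]_m.+1) :
    set 'M[R[i]]_m.+1 :=
  [set A | A^t* = A /\ A *m P + P *m A = A].

Definition CP_metric (R : realType) (m : nat) (A B : 'M[R[i]]_m.+1) : R :=
  redot A B / 2.

Definition CP_J (R : realType) (m : nat) (P A : 'M[R[i]]_m.+1) :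
    'M[R[i]]_m.+1 :=
  (0 +i* 1) *: (P *m A - A *m P).

(* The orthogonal projection of the Hermitian matrices onto the tangent space
   at P (CP_proj_tangent, CP_proj_orthogonal below); the Levi-Civita connection
   of CP^m(4) is the tangential part of the Euclidean derivative. *)
Definition CP_proj (R : realType) (m : nat) (P A : 'M[R[i]]_m.+1) :
    'M[R[i]]_m.+1 :=
  P *m A *m (1%:M - P) + (1%:M - P) *m A *m P.

Definition hopf (R : realType) (m : nat) (z : 'rV[R[i]]_m.+1) :
    'M[R[i]]_m.+1 :=
  z^t* *m z.

Section HopfFibration.
Context (R : realType) (m : nat).
Implicit Types (z w : 'rV[R[i]]_m.+1) (A B P : 'M[R[i]]_m.+1).

Local Lemma adjM p q r (A : 'M[R[i]]_(p, q)) (B : 'M[R[i]]_(q, r)) :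
  (A *m B)^t* = B^t* *m A^t*.
Proof. by rewrite trmx_mul map_mxM. Qed.

Local Lemma adjD p q (A B : 'M[R[i]]_(p, q)) : (A + B)^t* = A^t* + B^t*.
Proof. by rewrite linearD map_mxD. Qed.

Local Lemma adjB p q (A B : 'M[R[i]]_(p, q)) : (A - B)^t* = A^t* - B^t*.
Proof. by rewrite linearB map_mxB. Qed.

Local Lemma adjK p q (A : 'M[R[i]]_(p, q)) : A^t*^t* = A.
Proof. by apply/matrixP=> a b; rewrite !mxE conjCK. Qed.

Local Lemma adj1 p : (1%:M : 'M[R[i]]_p)^t* = 1%:M.
Proof. by rewrite trmx1 map_mx1. Qed.

Local Lemma redot_sym p q (A B : 'M[R[i]]_(p, q)) : redot A B = redot B A.
Proof.
rewrite /redot -[A in LHS]adjK -adjM /mxtrace !raddf_sum.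
by apply: eq_bigr => a _; rewrite !mxE; case: (\sum__ _).
Qed.

Lemma hopf_CP z : z *m z^t* = 1%:M -> CP R m (hopf z).
Proof.
move=> z1; split; first by rewrite /hopf adjM adjK.
  by rewrite /hopf mulmxA -[X in X *m z]mulmxA z1 mulmx1.
by rewrite /hopf mxtrace_mulC z1 mxtrace1.
Qed.

Lemma hopf_metric z w w' : z *m z^t* = 1%:M ->
  w *m z^t* = 0 -> w' *m z^t* = 0 ->
  CP_metric (w^t* *m z + z^t* *m w) (w'^t* *m z + z^t* *m w') = redot w w'.
Proof.
move=> z1 wz w'z; have zw' : z *m w'^t* = 0.
  by rewrite -[z]adjK -adjM w'z trmx0 map_mx0.
rewrite /CP_metric {1}/redot adjD !adjM !adjK mulmxDl !mulmxDr !mulmxA.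
rewrite -[_ *m z *m z^t*]mulmxA z1 mulmx1.
rewrite -[w^t* *m z *m _]mulmxA zw' mulmx0 mul0mx.
rewrite -[z^t* *m w *m z^t*]mulmxA wz mulmx0 mul0mx addr0 add0r.
rewrite !raddfD /= [\tr (w^t* *m w')]mxtrace_mulC -!mulmxA.
rewrite [\tr (z^t* *m _)]mxtrace_mulC -!mulmxA z1 mulmx1.
rewrite -/(redot _ _) -/(redot _ _) [redot w' w]redot_sym.
have two : (2%R : R) != 0 by rewrite pnatr_eq0.
by apply: (mulIf two); rewrite mulfVK // mulr_natr mulr2n.
Qed.

Lemma hopf_J z w : z *m z^t* = 1%:M -> w *m z^t* = 0 ->
  CP_J (hopf z) (w^t* *m z + z^t* *m w) =
  ((0 +i* 1) *: w)^t* *m z + z^t* *m ((0 +i* 1) *: w).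
Proof.
move=> z1 wz; have zw : z *m w^t* = 0.
  by rewrite -[z]adjK -adjM wz trmx0 map_mx0.
rewrite /CP_J /hopf mulmxDl !mulmxDr !mulmxA.
rewrite -[_ *m z *m w^t*]mulmxA zw mulmx0 mul0mx add0r.
rewrite -![_ *m z *m z^t*]mulmxA z1 !mulmx1.
rewrite -[_ *m w *m z^t*]mulmxA wz mulmx0 mul0mx addr0.
rewrite linearZ /= map_mxZ -scalemxAl -scalemxAr.
have conji : Num.conj (0 +i* 1 : R[i]) = - (0 +i* 1).
  by apply/eqP; rewrite eq_complex /= oppr0 !eqxx.
by rewrite [X in _ = X *: _ + _]conji scaleNr scalerBr addrC.
Qed.

Lemma CP_proj_tangent P A : CP R m P -> A^t* = A ->
  CP_tangent P (CP_proj P A).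
Proof.
case=> Pa PP _ Aa; rewrite /CP_proj; set Q := 1%:M - P.
have QP : Q *m P = 0 by rewrite mulmxBl mul1mx PP subrr.
have PQ : P *m Q = 0 by rewrite mulmxBr mulmx1 PP subrr.
have Qa : Q^t* = Q by rewrite adjB adj1 Pa.
split; first by rewrite adjD !adjM Pa Aa Qa !mulmxA addrC.
rewrite mulmxDl mulmxDr !mulmxA PQ PP !mul0mx addr0.
by rewrite -!mulmxA QP PP !mulmx0 add0r addrC.
Qed.

Lemma CP_proj_orthogonal P A B : CP R m P -> CP_tangent P B ->
  redot (A - CP_proj P A) B = 0.
Proof.
case=> Pa PP _ [Ba BP].
have PBP : P *m B *m P = 0.
  apply: (addrI (P *m B)); rewrite addr0 -{3}BP mulmxDr !mulmxA PP.
  by rewrite addrC.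
have QBQ : (1%:M - P) *m B *m (1%:M - P) = 0.
  rewrite mulmxBr mulmx1 !mulmxBl mul1mx PBP subr0 -[X in X - _ - _]BP.
  by rewrite addrK subrr.
set Q := 1%:M - P in QBQ *.
have PQ : A = P *m A *m P + P *m A *m Q + (Q *m A *m P + Q *m A *m Q).
  have PQ1 : P + Q = 1%:M by rewrite addrC subrK.
  by rewrite -!mulmxDr PQ1 !mulmx1 -mulmxDl PQ1 mul1mx.
have -> : A - CP_proj P A = P *m A *m P + Q *m A *m Q.
  rewrite {1}PQ /CP_proj -/Q [Q *m A *m P + _]addrC addrACA.
  by rewrite addrK.
have trPAP (S : 'M[R[i]]_m.+1) : S *m B *m S = 0 -> \tr (S *m A *m S *m B) = 0.
  move=> SBS; rewrite mxtrace_mulC !mulmxA mxtrace_mulC !mulmxA SBS.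
  by rewrite mul0mx mxtrace0.
by rewrite /redot Ba mulmxDl raddfD /= !trPAP // addr0.
Qed.

End HopfFibration.

(* Smoothness of psi and psi^* g = g are tested on the smooth maps from open
   subsets of the spaces R^k into CP^m, in particular on its local
   parametrizations. *)
Definition CP_isometry (R : realType) (m : nat)
    (psi : 'M[R[i]]_m.+1 -> 'M[R[i]]_m.+1) : Prop :=
  set_bij (CP R m) (CP R m) psi /\
  forall (k : nat) (U : set 'rV[R]_k) (c : 'rV[R]_k -> 'M[R[i]]_m.+1),
    open U -> csmooth_on U c -> (forall x, U x -> CP R m (c x)) ->
    csmooth_on U (psi \o c) /\
    forall x v w, U x ->
      CP_metric (cderive (psi \o c) x v) (cderive (psi \o c) x w) =
      CP_metric (cderive c x v) (cderive c x w).

(* Lagrangian immersions into CP^m(4) *)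

(* The differential is automatically injective. *)
Definition isometric_immersion (R : realType) (m : nat)
    (M : riemannian_manifold R m) (f : M -> 'M[R[i]]_m.+1) : Prop :=
  [/\ mcsmooth setT f,
      forall p, CP R m (f p) &
      forall p v w,
        CP_metric (mcderive f p v) (mcderive f p w) = inner (metric p) v w].

(* J maps the tangent space of M onto its normal space in the tangent space
   of CP^m. *)
Definition lagrangian (R : realType) (m : nat) (M : riemannian_manifold R m)
    (f : M -> 'M[R[i]]_m.+1) : Prop :=
  isometric_immersion f /\
  forall p, [set CP_J (f p) (mcderive f p v) | v in setT] =
    [set A | CP_tangent (f p) A /\
             forall v, CP_metric A (mcderive f p v) = 0].

(* h(X, Y) at p: the component normal to M of the CP^m-covariant derivative of
   df(Y) in the direction X. *)
Definition second_fundamental_form (R : realType) (m : nat)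
    (M : riemannian_manifold R m) (f : M -> 'M[R[i]]_m.+1)
    (X Y : M -> 'rV[R]_m) (p : M) : 'M[R[i]]_m.+1 :=
  normal_part (fun a : 'I_m => mcderive f p (delta_mx 0 a))
    (CP_proj (f p) (mcderive (fun q => mcderive f q (Y q)) p (X p))).

Definition orthonormal_frame (R : realType) (m : nat)
    (M : riemannian_manifold R m) (W : set M)
    (e : 'I_m -> M -> 'rV[R]_m) : Prop :=
  [/\ open W,
      forall a, smooth_vector_field W (e a) &
      forall p, W p ->
        forall a b, inner (metric p) (e a p) (e b p) = (a == b)%:R].

(* Legendrian immersions of open subsets of R^k into S^(2k+1)(1); the contact
   form at z is X |-> <X, i z>. *)
Definition legendrian_immersion (R : realType) (k : nat) (U : set 'rV[R]_k)
    (F : 'rV[R]_k -> 'rV[R[i]]_k.+1) : Prop :=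
  [/\ csmooth_on U F,
      forall x, U x -> redot (F x) (F x) = 1,
      forall x v, U x -> cderive F x v = 0 -> v = 0 &
      forall x v, U x -> redot (cderive F x v) ((0 +i* 1) *: F x) = 0].

(* Trace, with respect to the induced metric, of the second fundamental form
   of an immersion F into the unit sphere. *)
Definition sphere_mean_curvature (R : realType) (k m : nat)
    (F : 'rV[R]_k -> 'rV[R[i]]_m) (x : 'rV[R]_k) : 'rV[R[i]]_m :=
  let dF (a : 'I_k) y := cderive F y (delta_mx 0 a) in
  let sphere_tangent_part A := A - (redot A (F x))%:C *: F x in
  \sum_a \sum_b (invmx (gram (fun c => dF c x)) a b)%:C *:
    normal_part (fun c => dF c x)
      (sphere_tangent_part (cderive (dF b) x (delta_mx 0 a))).

Definition minimal_legendrian (R : realType) (k : nat) (U : set 'rV[R]_k)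
    (F : 'rV[R]_k -> 'rV[R[i]]_k.+1) : Prop :=
  legendrian_immersion U F /\
  forall x, U x -> sphere_mean_curvature F x = 0.

Definition expi (R : realType) (a : R) : R[i] := cos a +i* sin a.

(* The point (v, c) of C^k * C = C^(k+1). *)
Definition row_rcons (T : Type) (k : nat) (v : 'rV[T]_k) (c : T) : 'rV[T]_k.+1 :=
  \row_j (if unlift ord_max j is Some a then v 0 a else c).

(* Main.v *)
Require Import Defs.
From HB Require Import structures.
From mathcomp Require Import all_boot all_order all_algebra.
From mathcomp Require Import spectral complex.
From mathcomp Require Import boolp classical_sets functions reals topology.
From mathcomp Require Import normedtype derive realfun trigo.
From mathcomp Require Import landau ereal measure lebesgue_measure lebesgue_integral ftc.
From mathcomp Require Import ring lra.

(* Locally f = hopf o z for a horizontal map z into the unit sphere, and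
   z, w_a = dz(e_a) form a unitary frame whose connection form has the
   components Gamma_ijk + i C_ijk, with Gamma the Levi-Civita connection and C
   the cubic form of the second fundamental form.  The Codazzi equation and
   tr h^gamma = 0 force Gamma_00a = 0, e_a(lambda) = 0 and
   Gamma_a0b = mu delta_ab; the Gauss equation then gives mu'.  Put
   kappa = mu + i d lambda and let theta be a primitive of lambda dt, where
   dt is the coframe form dual to e_1 (both forms are closed).  Then
     xi  = - exp(- i (1-d) theta) (kappa z - w_0) / sqrt(1 + |kappa|^2)
   is constant, and
     phi = exp(- i d theta) (z + conj(kappa) w_0) / sqrt(1 + |kappa|^2)
   does not depend on t and is orthogonal to xi, which splits z into the two
   components of L.  The second derivatives of phi are, modulo phi and real
   combinations of the first ones, i times C_abc, whose trace vanishes; so phi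
   is minimal. *)

Set Implicit Arguments.
Unset Strict Implicit.
Unset Printing Implicit Defensive.

Import Order.TTheory GRing.Theory Num.Theory.
Import numFieldNormedType.Exports.
Local Open Scope classical_set_scope.
Local Open Scope sesquilinear_scope.
Local Open Scope ring_scope.
Local Open Scope complex_scope.

(** * Smooth maps on open subsets of R^k *)

(** The vectors behind [xi] and [phi] come from the moving frame. Along e_a the derivatives of z and
    w_0 are w_a and kappa w_a, so kappa z - w_0 does not move in these directions. Along e_1 the
    plane spanned by z and w_0 is preserved and kappa satisfies the Riccati equation kappa' = -1 -
    kappa^2 + i lambda kappa, which combines the two real equations for lambda and mu. It makes the
    derivative of kappa z - w_0 a multiple of the vector itself, so that a modulus and a phase
    suffice to make it constant; z + conj(kappa) w_0 spans its orthogonal complement in the plane.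
    The frame fields need not commute, so their flows do not give coordinates. Instead t is a
    primitive of the closed form dt, and the u_a are real components of phi itself: dphi kills e_1
    and is injective on the span of the other frame vectors, so the inverse function theorem yields
    a chart with d/dt = e_1. All existence statements thus reduce to two tools: the inverse function
    theorem, and the Poincare lemma on balls, which also supplies theta and the phase that makes a
    lift horizontal. *)

Section Differentiability.
Context {R : realType}.

Lemma differentiable_near_eps (V W : normedModType R) (f : V -> W) x e :
  differentiable f x -> 0 < e ->
  \forall h \near (0 : V), `|f (h + x) - f x - 'd f x h| <= e * `|h|.
Proof.
move=> /diff_locally /eqaddoP fE e0; have := fE _ e0; apply: filterS => h /=.
by rewrite /shift /= !fctE opprD addrA.
Qed.

(** The little-o condition with its quantifiers unfolded. Continuity of [l] is assumed because a
    linear map between general normed spaces need not be continuous; uniqueness of the differential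
    then identifies it with [l]. *)
Lemma differentiable_eps (V W : normedModType R) (f : V -> W)
    (l : {linear V -> W}) x : continuous l ->
  (forall e, 0 < e -> \forall h \near (0 : V),
     `|f (h + x) - f x - l h| <= e * `|h|) ->
  differentiable f x /\ 'd f x = l :> (V -> W).
Proof.
move=> lc fl.
have fE : f \o shift x = cst (f x) + l +o_ (0 : V) id.
  apply/eqaddoP => e e0; have := fl _ e0; apply: filterS => h /=.
  by rewrite /shift /= !fctE opprD addrA.
have dE := diff_unique lc fE.
by split=> //; apply/diff_locallyP; rewrite dE.
Qed.

Lemma near_differentiable (V W : normedModType R) (f g : V -> W) x :
  (\near x, f x = g x) -> differentiable f x -> differentiable g x.
Proof.
move=> fg df; have fgx := nbhs_singleton fg.
apply: (@differentiable_eps _ _ g ('d f x) x _ _).1.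
  exact: diff_continuous.
move=> e e0; have := differentiable_near_eps df e0.
have : \forall h \near (0 : V), f (h + x) = g (h + x).
  by move: fg; rewrite (near_shift 0 x) subr0.
by apply: filterS2 => h ->; rewrite fgx.
Qed.

Lemma continuous_linear_row (k : nat) (W : normedModType R)
  (l : {linear 'rV[R]_k -> W}) : continuous l.
Proof.
have -> : (l : 'rV[R]_k -> W) = fun v => \sum_(j < k) v 0 j *: l (delta_mx 0 j).
  apply/funext => v; rewrite {1}(row_sum_delta v) linear_sum.
  by apply: eq_bigr => j _; rewrite linearZ.
apply: continuous_big => [|j _ x]; first exact: add_continuous.
by apply: continuousZr_tmp; exact: coord_continuous.
Qed.

Lemma derive_row_sum (k : nat) (W : normedModType R) (f : 'rV[R]_k -> W) x v :
  differentiable f x ->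
  'D_v f x = \sum_(j < k) v 0 j *: 'D_(delta_mx 0 j) f x.
Proof.
move=> df; rewrite deriveE // {1}(row_sum_delta v) linear_sum.
by apply: eq_bigr => j _; rewrite linearZ deriveE.
Qed.

Lemma derive_coord_sum (k : nat) (f : 'rV[R]_k -> R) x v :
  differentiable f x ->
  'D_v f x = (\sum_(j < k) v 0 j * 'D_(delta_mx 0 j) f x)%R.
Proof. exact: derive_row_sum. Qed.

Lemma derive_comp_row (k l : nat) (W : normedModType R)
    (f : 'rV[R]_l -> W) (g : 'rV[R]_k -> 'rV[R]_l) x v :
  differentiable g x -> differentiable f (g x) ->
  'D_v (f \o g) x = 'D_('D_v g x) f (g x).
Proof.
move=> dg df; rewrite deriveE; last exact: differentiable_comp.
by rewrite diff_comp //= !deriveE.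
Qed.

Lemma differentiable_rowP (k l : nat) (f : 'rV[R]_k -> 'rV[R]_l) x :
  differentiable f x <-> forall j, differentiable (fun y => f y 0 j) x.
Proof.
split=> [df j|df].
  exact: (differentiable_comp df (differentiable_coord _ _ _)).
have -> : f = fun y => \sum_(j < l) f y 0 j *: (delta_mx 0 j : 'rV[R]_l).
  by apply/funext => y; exact: row_sum_delta.
have -> : (fun y => \sum_(j < l) f y 0 j *: (delta_mx 0 j : 'rV[R]_l)) =
    \sum_(j < l) (fun y => f y 0 j *: (delta_mx 0 j : 'rV[R]_l)).
  by apply/funext => y; rewrite fct_sumE.
by apply: differentiable_sum => j; apply: differentiableZl.
Qed.

Lemma derive_row_coord (k l : nat) (f : 'rV[R]_k -> 'rV[R]_l) x v j :
  differentiable f x -> 'D_v f x 0 j = 'D_v (fun y => f y 0 j) x.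
Proof. by move=> df; rewrite derive_mx ?mxE //; exact: diff_derivable. Qed.

End Differentiability.

Section Ck.
Context {R : realType} (k : nat).
Implicit Types (U : set 'rV[R]_k).

Lemma Ck_sub (V : normedModType R) r U U' (f : 'rV[R]_k -> V) :
  U' `<=` U -> Ck_on r U f -> Ck_on r U' f.
Proof.
move=> UU'; elim: r f => [|r IH] f /=; first by move=> cf x /UU'; exact: cf.
by case=> df Df; split=> [x /UU'|v]; [exact: df|exact/IH/Df].
Qed.

(** On an open set a directional derivative depends only on the germ of the map, so the agreement
    passes through the induction. Later proofs use this to replace a derivative by a formula for
    it. *)
Lemma Ck_ext (V : normedModType R) r U (f g : 'rV[R]_k -> V) :
  open U -> (forall x, U x -> f x = g x) -> Ck_on r U f -> Ck_on r U g.
Proof.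
move=> oU; elim: r f g => [|r IH] f g fg.
  move=> cf x Ux; change (g @ x --> g x); rewrite -(fg _ Ux).
  apply: cvg_trans (cf x Ux); apply: (@near_eq_cvg _ _ (nbhs x)).
  by have := open_nbhs_nbhs (conj oU Ux); apply: filterS => y; exact: fg.
have nfg x : U x -> \near x, f x = g x.
  by move=> Ux; have := open_nbhs_nbhs (conj oU Ux); apply: filterS => y; exact: fg.
case=> df Df; split=> [x Ux|v]; first exact: near_differentiable (nfg x Ux) (df x Ux).
by apply: IH (Df v) => x Ux; exact: near_eq_derive (nfg x Ux).
Qed.

Lemma Ck_le (V : normedModType R) r U (f : 'rV[R]_k -> V) :
  Ck_on r.+1 U f -> Ck_on r U f.
Proof.
elim: r f => [|r IH] f [df Df]; first by move=> x /df; exact: differentiable_continuous.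
by split=> // v; exact/IH/Df.
Qed.

Lemma Ck_cst (V : normedModType R) r U (a : V) : Ck_on r U (fun=> a).
Proof.
elim: r a => [|r IH] a /=; first by move=> x _; exact: cst_continuous.
split=> [x _|v]; first exact: differentiable_cst.
rewrite [X in Ck_on _ _ X](_ : _ = fun=> 0) //; apply/funext => x; exact: derive_cst.
Qed.

Lemma CkD (V : normedModType R) r U (f g : 'rV[R]_k -> V) : open U ->
  Ck_on r U f -> Ck_on r U g -> Ck_on r U (fun x => f x + g x).
Proof.
move=> oU; elim: r f g => [|r IH] f g /=.
  by move=> cf cg x Ux; apply: continuousD; [exact: cf|exact: cg].
move=> [df Df] [dg Dg]; split=> [x Ux|v].
  by apply: differentiableD; [exact: df|exact: dg].
apply: Ck_ext (IH _ _ (Df v) (Dg v)) => // x Ux.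
by rewrite -[RHS]/('D_v (f + g) x) deriveD //; apply: diff_derivable; [exact: df|exact: dg].
Qed.

Lemma Ck_sum (V : normedModType R) (I : Type) (s : seq I) (P : pred I) r U
    (f : I -> 'rV[R]_k -> V) : open U ->
  (forall i, Ck_on r U (f i)) -> Ck_on r U (fun x => \sum_(i <- s | P i) f i x).
Proof.
move=> oU Hf; elim: s => [|a s IH].
  by apply: Ck_ext (Ck_cst r U 0) => // x _; rewrite big_nil.
have [Pa|Pa] := boolP (P a).
  apply: Ck_ext (CkD oU (Hf a) IH) => // x _; by rewrite big_cons Pa.
by apply: Ck_ext IH => // x _; rewrite big_cons (negbTE Pa).
Qed.

Lemma CkM r U (f g : 'rV[R]_k -> R) : open U ->
  Ck_on r U f -> Ck_on r U g -> Ck_on r U (fun x => f x * g x).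
Proof.
move=> oU; elim: r f g => [|r IH] f g.
  by move=> cf cg x Ux; apply: continuousM; [exact: cf|exact: cg].
move=> Cf Cg; have [df Df] := Cf; have [dg Dg] := Cg; split=> [x Ux|v].
  by apply: differentiableM; [exact: df|exact: dg].
have := CkD oU (IH _ _ (Ck_le Cf) (Dg v)) (IH _ _ (Ck_le Cg) (Df v)).
apply: Ck_ext => // x Ux.
rewrite -[RHS]/('D_v (f * g) x) deriveM //; apply: diff_derivable; [exact: df|exact: dg].
Qed.

Lemma CkZl (V : normedModType R) r U (f : 'rV[R]_k -> R) (a : V) : open U ->
  Ck_on r U f -> Ck_on r U (fun x => f x *: a).
Proof.
move=> oU; elim: r f => [|r IH] f.
  by move=> cf x Ux; apply: continuousZr_tmp; exact: cf.
move=> [df Df]; split=> [x Ux|v]; first by apply: differentiableZl; exact: df.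
apply: Ck_ext (IH _ (Df v)) => // x Ux.
have dfx := df _ Ux; rewrite !deriveE //; last exact: differentiableZl.
by rewrite diffZl.
Qed.

Lemma Ck_rowP l r U (f : 'rV[R]_k -> 'rV[R]_l) : open U ->
  Ck_on r U f <-> forall j, Ck_on r U (fun x => f x 0 j).
Proof.
move=> oU; split=> [|Cf].
  elim: r f => [|r IH] f /=.
    move=> cf j x Ux; apply: (@continuous_comp _ _ _ f (fun N : 'rV[R]_l => N 0 j)); first exact: cf.
    exact: coord_continuous.
  move=> [df Df] j; split=> [x Ux|v]; first exact: (differentiable_rowP _ _).1 (df _ Ux) j.
  apply: Ck_ext (IH _ (Df v) j) => // x Ux; exact: derive_row_coord (df _ Ux).
have := Ck_sum (index_enum _) predT oU (fun j => CkZl (delta_mx 0 j : 'rV[R]_l) oU (Cf j)).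
by apply: Ck_ext => // x _; rewrite -row_sum_delta.
Qed.

Lemma Ck_coord r U j : open U -> Ck_on r U (fun x : 'rV[R]_k => x 0 j).
Proof.
move=> oU; case: r => [|r].
  by move=> x _; exact: coord_continuous.
split=> [x _|v]; first exact: differentiable_coord.
apply: Ck_ext (Ck_cst r U (v 0 j)) => // x _.
by rewrite -derive_row_coord ?derive_id //; exact: differentiable_id.
Qed.

Lemma Ck_id r U : open U -> Ck_on r U id.
Proof. by move=> oU; apply/Ck_rowP => // j; exact: Ck_coord. Qed.

End Ck.

(** For real-valued [f] the chain rule writes the derivative as a sum of products of coordinates of
    the derivative of [g] with partial derivatives of [f] composed with [g]; both factors have one
    order less, so the induction closes. *)
Lemma Ck_comp {R : realType} (k l : nat) r (U : set 'rV[R]_k) (U' : set 'rV[R]_l)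
    (f : 'rV[R]_l -> R) (g : 'rV[R]_k -> 'rV[R]_l) :
  open U -> (forall x, U x -> U' (g x)) ->
  Ck_on r U g -> Ck_on r U' f -> Ck_on r U (f \o g).
Proof.
move=> oU UU'; elim: r f => [|r IH] f.
  by move=> cg cf x Ux; apply: continuous_comp; [exact: cg|exact/cf/UU'].
move=> Cg [df Df]; have [dg Dg] := Cg; split=> [x Ux|v].
  by apply: differentiable_comp; [exact: dg|exact/df/UU'].
have gj j : Ck_on r U (fun x => 'D_v g x 0 j * ('D_(delta_mx 0 j) f \o g) x).
  by apply: CkM => //; [exact: (Ck_rowP r _ oU).1 (Dg v) j|apply: IH (Ck_le Cg) (Df _)].
apply: Ck_ext (Ck_sum (index_enum _) predT oU gj) => // x Ux.
have dgx := dg _ Ux; have dfx := df _ (UU' _ Ux).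
by rewrite (derive_comp_row v dgx dfx) (derive_row_sum _ dfx).
Qed.

Section Lines.
Context {R : realType} (V : normedModType R).
Implicit Types (f : V -> R) (x v w : V).

Lemma is_derive_line f x v (s : R) : differentiable f (x + s *: v) ->
  is_derive s 1 (fun s => f (x + s *: v)) ('D_v f (x + s *: v)).
Proof.
move=> df.
have dl : is_diff s (fun s : R => x + s *: v) ( *:%R^~ v).
  have : is_diff s (cst x + ( *:%R^~ v : R -> V)) (0 + *:%R^~ v) by exact: is_diffD.
  by rewrite add0r.
have dc : differentiable (f \o (fun s => x + s *: v)) s.
  apply: differentiable_comp => //.
apply: DeriveDef; first exact/derivable1_diffP.
rewrite [LHS]deriveE // [RHS]deriveE // diff_comp //=.
by rewrite (@diff_val _ _ _ _ _ _ _ dl) scale1r.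
Qed.

Lemma MVT_line f x v :
  (forall s : R, 0 <= s <= 1 -> differentiable f (x + s *: v)) ->
  exists2 s : R, 0 < s < 1 & f (x + v) - f x = 'D_v f (x + s *: v).
Proof.
move=> df; pose g (s : R) := f (x + s *: v).
have dg (s : R) : 0 <= s <= 1 -> is_derive s 1 g ('D_v f (x + s *: v)).
  by move=> /df; exact: is_derive_line.
have [|||s /[!in_itv]/= s01 sE] := @MVT R g (fun s => 'D_v f (x + s *: v)) 0 1.
- exact: ltr01.
- by move=> s /[!in_itv]/= /andP[/ltW s0 /ltW s1]; apply: dg; rewrite s0.
- apply: derivable_within_continuous => s /[!in_itv]/= s01.
  by have := dg s s01; case.
by exists s => //; move: sE; rewrite /g scale1r scale0r addr0 subr0 mulr1.
Qed.

End Lines.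

Lemma derive_shiftE {R : realType} (V W : normedModType R) (f : V -> W) x z v :
  'D_v (fun y => f (y + z)) x = 'D_v f (x + z).
Proof.
rewrite /derive.
suff -> : (fun h : R => h^-1 *: (f (h *: v + x + z) - f (x + z))) =
          (fun h : R => h^-1 *: (f (h *: v + (x + z)) - f (x + z))) by [].
by apply/funext => h; rewrite addrA.
Qed.

Section Schwarz.
Context {R : realType} (k : nat) (U : set 'rV[R]_k) (f : 'rV[R]_k -> R).
Hypotheses (oU : open U) (Cf : Ck_on 2 U f).

(** The mean value theorem is used twice: along [v] for the increment [g] of [f] in the direction
    [w], then along [w] for the derivative of [f] in the direction [v]. The second difference on the
    left is symmetric in [v] and [w], so exchanging them reaches the other mixed derivative at a
    nearby point. *)
Local Lemma second_difference x d v w (t : R) : 0 < t ->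
  ball x d `<=` U -> t * (`|v| + `|w|) < d ->
  exists2 y, ball x d y &
    f (x + t *: v + t *: w) - f (x + t *: v) - (f (x + t *: w) - f x) =
    t ^+ 2 * 'D_w ('D_v f) y.
Proof.
move=> t0 bU td.
have bxy (s s' : R) : 0 <= s <= 1 -> 0 <= s' <= 1 ->
    ball x d (x + s *: (t *: v) + s' *: (t *: w)).
  move=> /andP[s0 s1] /andP[s'0 s'1].
  rewrite -ball_normE /= opprD opprD !addrA subrr sub0r -opprD normrN.
  apply: le_lt_trans (ler_normD _ _) _; rewrite !normrZ.
  apply: le_lt_trans td; rewrite (ger0_norm s0) (ger0_norm s'0) (gtr0_norm t0) mulrDr.
  by apply: lerD; apply: ler_piMl => //; rewrite mulr_ge0 // ltW.
have [df Df] := Cf.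
have b0 (s : R) : 0 <= s <= 1 -> ball x d (x + s *: (t *: v)).
  by move=> s01; have := bxy s 0 s01; rewrite scale0r addr0; apply; rewrite lexx ler01.
have b1 (s : R) : 0 <= s <= 1 -> ball x d (x + s *: (t *: v) + t *: w).
  by move=> s01; have := bxy s 1 s01; rewrite scale1r; apply; rewrite lexx ler01.
pose g y := f (y + t *: w) - f y.
have dsh y z : differentiable f (y + z) -> differentiable (fun y => f (y + z)) y.
  move=> dfy; apply: (differentiable_comp (f := fun y => y + z)) => //.
have dg (s : R) : 0 <= s <= 1 -> differentiable g (x + s *: (t *: v)).
  move=> s01; apply: differentiableB; last exact/df/bU/b0.
  by apply: dsh; exact/df/bU/b1.
have [s s01 gE] := MVT_line dg.
have s01' : 0 <= s <= 1 by case/andP: s01 => /ltW-> /ltW->.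
have [s' s'01] : exists2 s' : R, 0 < s' < 1 &
    'D_v f (x + s *: (t *: v) + t *: w) - 'D_v f (x + s *: (t *: v)) =
    'D_(t *: w) ('D_v f) (x + s *: (t *: v) + s' *: (t *: w)).
  apply: (@MVT_line _ _ ('D_v f)) => s' s'01.
  exact/(Df v).1/bU/bxy.
have s'01' : 0 <= s' <= 1 by case/andP: s'01 => /ltW-> /ltW->.
have DZ (h : 'rV[R]_k -> R) y u : differentiable h y -> 'D_(t *: u) h y = t * 'D_u h y.
  by move=> dh; rewrite !deriveE // linearZ.
rewrite DZ; last exact/(Df v).1/bU/bxy.
move=> E; exists (x + s *: (t *: v) + s' *: (t *: w)); first exact: bxy.
rewrite expr2 -mulrA -E -[LHS]/(g (x + t *: v) - g x) gE DZ; last exact: dg.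
rewrite /g deriveB /=; last 2 first.
- by apply/diff_derivable/dsh/df/bU/b1.
- exact/diff_derivable/df/bU/b0.
by rewrite derive_shiftE.
Qed.

Theorem schwarz x v w : U x -> 'D_v ('D_w f) x = 'D_w ('D_v f) x.
Proof.
move=> Ux; have [_ Df] := Cf.
apply/eqP; rewrite -subr_eq0 -normr_le0; apply/ler_addgt0Pl => e e0; rewrite addr0.
have cvw : {for x, continuous ('D_w ('D_v f))} by apply: ((Df v).2 w).
have cwv : {for x, continuous ('D_v ('D_w f))} by apply: ((Df w).2 v).
have e2 : 0 < e / 2 by rewrite divr_gt0.
have N1 : \forall y \near x, `|'D_w ('D_v f) x - 'D_w ('D_v f) y| < e / 2.
  by move/cvgrPdist_lt: cvw => /(_ _ e2).
have N2 : \forall y \near x, `|'D_v ('D_w f) x - 'D_v ('D_w f) y| < e / 2.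
  by move/cvgrPdist_lt: cwv => /(_ _ e2).
have N0 : \forall y \near x, U y by have := open_nbhs_nbhs (conj oU Ux); apply: filterS.
have N : \forall y \near x, [/\ U y, `|'D_w ('D_v f) x - 'D_w ('D_v f) y| < e / 2 &
    `|'D_v ('D_w f) x - 'D_v ('D_w f) y| < e / 2].
  by move: N0 N1 N2; apply: filterS3 => y; split.
have [d /= d0 xd] := (nbhs_ballP _ _).1 N.
have bU : ball x d `<=` U by move=> y /xd[].
(* The summand 1 keeps [c] positive when both directions vanish. *)
pose c := `|v| + `|w| + 1.
have c0 : 0 < c by rewrite ltr_wpDl // addr_ge0.
pose t := d / c.
have t0 : 0 < t by rewrite divr_gt0.
have td : t * (`|v| + `|w|) < d.
  by rewrite -ltr_pdivlMl // invf_div divfK ?gt_eqF // ltrDl.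
have [y yd Ey] := second_difference t0 bU td.
have [z zd Ez] := second_difference t0 bU (v := w) (w := v) ltac:(by rewrite addrC).
have E : 'D_w ('D_v f) y = 'D_v ('D_w f) z.
  apply: (@mulfI _ (t ^+ 2)); first by rewrite expf_neq0 // gt_eqF.
  apply: etrans (esym Ey) _; apply: etrans _ Ez.
  have -> : x + t *: w + t *: v = x + t *: v + t *: w by rewrite addrAC.
  by move: (f _) (f _) (f _) (f _) => a b c' d'; ring.
have [_ yw _] := xd y yd; have [_ _ zv] := xd z zd.
have -> : 'D_v ('D_w f) x - 'D_w ('D_v f) x =
  ('D_v ('D_w f) x - 'D_v ('D_w f) z) + ('D_w ('D_v f) y - 'D_w ('D_v f) x).
  by rewrite E subrKA.
apply: le_trans (ler_normD _ _) _; rewrite [leRHS](splitr e).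
by apply: lerD; apply: ltW; [exact: zv|rewrite distrC; exact: yw].
Qed.

End Schwarz.

Section CkReal.
Context {R : realType} (k : nat).
Implicit Types (U : set 'rV[R]_k) (f : 'rV[R]_k -> R).

Lemma chain1 (h : R -> R) (dh : R) f x v :
  is_derive (f x) 1 h dh -> differentiable f x ->
  differentiable (h \o f) x /\ 'D_v (h \o f) x = dh * 'D_v f x.
Proof.
move=> [hd hE] df; have dhx : differentiable h (f x) by exact/derivable1_diffP.
have dc : differentiable (h \o f) x by exact: differentiable_comp.
split=> //; rewrite deriveE // diff_comp //= deriveE //.
by rewrite diff1E // derive1E hE mulrC.
Qed.

Lemma CkN r U f : open U -> Ck_on r U f -> Ck_on r U (fun x => - f x).
Proof.
move=> oU Cf; apply: Ck_ext (CkM oU (Ck_cst r U (-1 : R)) Cf) => // x _.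
by rewrite mulN1r.
Qed.

Lemma CkB r U f g : open U -> Ck_on r U f -> Ck_on r U g -> Ck_on r U (fun x => f x - g x).
Proof. by move=> oU Cf Cg; apply: CkD => //; exact: CkN. Qed.

Lemma Ck_prod (I : Type) (s : seq I) (P : pred I) r U (f : I -> 'rV[R]_k -> R) :
  open U -> (forall i, Ck_on r U (f i)) -> Ck_on r U (fun x => \prod_(i <- s | P i) f i x).
Proof.
move=> oU Hf; elim: s => [|a s IH].
  by apply: Ck_ext (Ck_cst r U (1 : R)) => // x _; rewrite big_nil.
have [Pa|Pa] := boolP (P a).
  by apply: Ck_ext (CkM oU (Hf a) IH) => // x _; rewrite big_cons Pa.
by apply: Ck_ext IH => // x _; rewrite big_cons (negbTE Pa).
Qed.

(** Both functions are treated together because each is, up to sign, the derivative of the other. *)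
Lemma Ck_trig r U f : open U -> Ck_on r U f ->
  Ck_on r U (fun x => cos (f x)) /\ Ck_on r U (fun x => sin (f x)).
Proof.
move=> oU; elim: r f => [|r IH] f.
  move=> cf; split=> x Ux; apply: continuous_comp (cf x Ux) _.
    exact: continuous_cos.
  exact: continuous_sin.
move=> Cf; have [df Df] := Cf; have [Cc Cs] := IH _ (Ck_le Cf).
split; split=> [x Ux|v].
- exact: (chain1 0 (is_derive_cos _) (df _ Ux)).1.
- apply: Ck_ext (CkM oU (CkN oU Cs) (Df v)) => // x Ux.
  by rewrite -(chain1 v (is_derive_cos _) (df _ Ux)).2.
- exact: (chain1 0 (is_derive_sin _) (df _ Ux)).1.
- apply: Ck_ext (CkM oU Cc (Df v)) => // x Ux.
  by rewrite -(chain1 v (is_derive_sin _) (df _ Ux)).2.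
Qed.

Lemma Ck_inv r U f : open U -> (forall x, U x -> f x != 0) -> Ck_on r U f ->
  Ck_on r U (fun x => (f x)^-1).
Proof.
move=> oU f0; elim: r => [|r IH].
  by move=> cf x Ux; apply: continuousV; [exact: f0|exact: cf].
move=> Cf; have [df Df] := Cf; have Ci := IH (Ck_le Cf).
split=> [x Ux|v]; first by apply: differentiableV; [exact: df|exact: f0].
apply: Ck_ext (CkM oU (CkN oU (CkM oU Ci Ci)) (Df v)) => // x Ux.
have dv : derivable f x v by exact/diff_derivable/df.
have /= -> := deriveV (f0 _ Ux) dv.
by rewrite expr2 invfM.
Qed.

Lemma Ck_sqrt r U f : open U -> (forall x, U x -> 0 < f x) -> Ck_on r U f ->
  Ck_on r U (fun x => Num.sqrt (f x)).
Proof.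
move=> oU f0; elim: r => [|r IH].
  by move=> cf x Ux; apply: continuous_comp (cf x Ux) _; exact: sqrt_continuous.
move=> Cf; have [df Df] := Cf; have Ci := IH (Ck_le Cf).
split=> [x Ux|v]; first exact: (chain1 0 (is_derive1_sqrt (f0 _ Ux)) (df _ Ux)).1.
have s0 x : U x -> 2 * Num.sqrt (f x) != 0.
  by move=> Ux; rewrite mulf_neq0 ?pnatr_eq0 // gt_eqF // sqrtr_gt0 f0.
apply: Ck_ext (CkM oU (Ck_inv oU s0 (CkM oU (Ck_cst r U (2 : R)) Ci)) (Df v)) => // x Ux.
by rewrite -(chain1 v (is_derive1_sqrt (f0 _ Ux)) (df _ Ux)).2.
Qed.

End CkReal.

(** * The inverse function theorem *)

Section MatrixInverse.
Context {R : realType} (k m : nat) (r : nat) (U : set 'rV[R]_k).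
Hypothesis oU : open U.

Lemma Ck_det p (M : 'rV[R]_k -> 'M[R]_p) :
  (forall i j, Ck_on r U (fun x => M x i j)) -> Ck_on r U (fun x => \det (M x)).
Proof.
move=> CM; apply: Ck_sum => // s; apply: CkM => //; first exact: Ck_cst.
by apply: Ck_prod => // i.
Qed.

(** Cramer's rule: the entries are cofactors divided by the determinant. *)
Lemma Ck_invmx p (M : 'rV[R]_k -> 'M[R]_p) i j :
  (forall i j, Ck_on r U (fun x => M x i j)) ->
  (forall x, U x -> M x \in unitmx) -> Ck_on r U (fun x => invmx (M x) i j).
Proof.
move=> CM uM; have C1 : Ck_on r U (fun x => (\det (M x))^-1).
  by apply: Ck_inv => //; [move=> x /uM; rewrite unitmxE unitfE|exact: Ck_det].
have C2 : Ck_on r U (fun x => (-1) ^+ (j + i) * \det (row' j (col' i (M x)))).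
  apply: CkM => //; first exact: Ck_cst.
  by apply: Ck_det => i' j'; apply: Ck_ext (CM (lift j i') (lift i j')) => // x _; rewrite !mxE.
apply: Ck_ext (CkM oU C1 C2) => // x Ux.
by rewrite /invmx uM // !mxE.
Qed.

End MatrixInverse.

Section RowNorm.
Context {R : realType} (k : nat).

Lemma row_norm_coord (v : 'rV[R]_k) j : `|v 0 j| <= `|v|.
Proof. by rewrite [leRHS]/Num.Def.normr/= mx_normrE; apply: (le_bigmax _ _ (0, j)). Qed.

Lemma row_norm_le (v : 'rV[R]_k) e : 0 <= e -> (forall j, `|v 0 j| <= e) -> `|v| <= e.
Proof.
move=> e0 ve; rewrite [leLHS]/Num.Def.normr/= mx_normrE bigmax_le // => -[i j] _.
by rewrite ord1.
Qed.

Lemma mulmx_bound l (M : 'M[R]_(k, l)) :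
  exists2 c, 0 < c & forall v : 'rV[R]_k, `|v *m M| <= c * `|v|.
Proof. exact: (linear_lipschitz (f := mulmxr M) (@continuous_linear_row _ _ _ _)). Qed.

End RowNorm.

Lemma compact_closed_ball_row {R : realType} (k : nat) (x0 : 'rV[R]_k) (d : R) :
  compact (closed_ball_ Num.norm x0 d).
Proof.
apply: bounded_closed_compact; last exact: closed_closed_ball_.
exists (`|x0| + d); split; first exact: num_real.
move=> M ltM x Bx; apply: le_trans (ltW ltM).
have -> : x = x0 - (x0 - x) by rewrite subKr.
by apply: le_trans (ler_normB _ _) _; rewrite lerD2l.
Qed.

(** Compactness replaces iteration: the displacement |T x - x| attains its minimum on the closed
    ball, and at the point T x it is at most half as large as at x; hence the minimum is 0. *)
Lemma half_contraction_fixpoint {R : realType} (k : nat) (T : 'rV[R]_k -> 'rV[R]_k)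
    (x0 : 'rV[R]_k) (d : R) : 0 <= d ->
  (forall x : 'rV[R]_k, `|x0 - x| <= d -> {for x, continuous T}) ->
  (forall x : 'rV[R]_k, `|x0 - x| <= d -> `|x0 - T x| <= d) ->
  (forall x y : 'rV[R]_k, `|x0 - x| <= d -> `|x0 - y| <= d -> `|T x - T y| <= 2^-1 * `|x - y|) ->
  exists2 x : 'rV[R]_k, `|x0 - x| <= d & T x = x.
Proof.
move=> d0 cT Td lT; pose B : set 'rV[R]_k := closed_ball_ Num.norm x0 d.
have Bx0 : B x0 by rewrite /B /closed_ball_ /= subrr normr0.
have cB : compact B by exact: compact_closed_ball_row.
have cf : {within B, continuous (fun x => `|T x - x|)}.
  apply: continuous_in_subspaceT => x /[!inE] Bx.
  apply: (@continuous_comp _ _ _ (fun x => T x - x) Num.norm); last exact: norm_continuous.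
  by apply: continuousB; [exact: cT|exact: cvg_id].
have [x /[!inE] Bx xmin] := EVT_min_rV (ex_intro _ x0 Bx0) cB cf.
exists x => //; apply/eqP; rewrite -subr_eq0 -normr_le0.
have /xmin := mem_set (Td x Bx : B (T x)).
move=> /le_trans/(_ (lT _ _ (Td x Bx) Bx)).
by move: (`|_|) => z; lra.
Qed.

Lemma derive_mulmxr {R : realType} (k l m : nat) (G : 'rV[R]_k -> 'rV[R]_l)
    (A : 'M[R]_(l, m)) x v : differentiable G x ->
  differentiable (fun y => G y *m A) x /\ 'D_v (fun y => G y *m A) x = 'D_v G x *m A.
Proof.
have cA := @continuous_linear_row R l _ (mulmxr A).
move=> dG; have dA : differentiable (mulmxr A : 'rV[R]_l -> 'rV[R]_m) (G x).
  exact: linear_differentiable.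
have /= dGA := differentiable_comp dG dA.
split=> //; have /= := @derive_comp_row R k l _ (mulmxr A) G x v dG dA.
rewrite /comp => ->; rewrite deriveE //.
by rewrite diff_lin.
Qed.

Lemma near_forall {R : realType} (k : nat) (I : finType) (P : I -> 'rV[R]_k -> Prop)
    (x : 'rV[R]_k) :
  (forall i, \forall y \near x, P i y) -> \forall y \near x, forall i, P i y.
Proof. by move=> NP; exact: (filter_forall (F := nbhs x)). Qed.

Lemma near_preimage {T T' : topologicalType} (f : T -> T') (B : set T') (x : T) :
  {for x, continuous f} -> open B -> B (f x) -> \forall z \near x, B (f z).
Proof. by move=> cf oB Bfx; apply: cf; exact: open_nbhs_nbhs. Qed.

Section InverseFunction.
Context {R : realType} (k : nat) (U : set 'rV[R]_k) (G : 'rV[R]_k -> 'rV[R]_k).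
Variable x0 : 'rV[R]_k.
Hypotheses (oU : open U) (Ux0 : U x0) (CG : smooth_on U G).
Hypothesis inj0 : forall v : 'rV[R]_k, 'D_v G x0 = 0 -> v = 0.

Let dG x : U x -> differentiable G x. Proof. exact: (CG 1).1. Qed.
Let J (x : 'rV[R]_k) := jacobian G x.
Let DJ x v : U x -> 'D_v G x = v *m J x.
Proof. by move=> Ux; rewrite deriveEjacobian //; exact: dG. Qed.

Let unit_of_inj x : U x -> (forall v : 'rV[R]_k, 'D_v G x = 0 -> v = 0) -> J x \in unitmx.
Proof.
move=> Ux inj; rewrite -row_free_unit -kermx_eq0; apply/eqP/row_matrixP => i.
rewrite row0; apply: inj; rewrite DJ //.
by rewrite -row_mul mulmx_ker row0.
Qed.

Let A := invmx (J x0).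
Let JA : J x0 *m A = 1%:M. Proof. by rewrite mulmxV // unit_of_inj. Qed.
Let AJ : A *m J x0 = 1%:M. Proof. by rewrite mulVmx // unit_of_inj. Qed.

(** Solving [G x = y] means finding a fixed point of the map sending [x] to [h x + y *m A]. As [A]
    inverts the Jacobian at [x0], the differential of [h] vanishes there, so these maps contract
    near [x0]. *)
Let h (x : 'rV[R]_k) := x - G x *m A.

Let Ch r : Ck_on r U h.
Proof.
apply/Ck_rowP => // j.
have CGA : Ck_on r U (fun x => \sum_i G x 0 i * A i j).
  by apply: Ck_sum => // i; apply: CkM => //; [exact: (Ck_rowP _ _ oU).1 (CG r) i|exact: Ck_cst].
apply: Ck_ext (CkB oU (Ck_coord r j oU) CGA) => // x _; by rewrite !mxE.
Qed.

Let Dh x v : U x -> 'D_v h x = v - 'D_v G x *m A.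
Proof.
move=> Ux; have [dGA DGA] := derive_mulmxr A v (dG Ux).
rewrite -DGA [LHS]deriveB; [|exact: derivable_id|exact: diff_derivable].
by rewrite derive_id.
Qed.

Let Dh0 v : 'D_v h x0 = 0.
Proof. by rewrite Dh // DJ // -mulmxA JA mulmx1 subrr. Qed.

Let small : exists2 d : R, 0 < d & ball x0 d `<=` U /\
  forall x v : 'rV[R]_k, ball x0 d x -> forall i, `|'D_v h x 0 i| <= 2^-1 * `|v|.
Proof.
(* The [k] partial derivatives, each below [c], add up to at most one half; [k.+1] avoids a division
   by zero for [k = 0]. *)
pose c : R := (2 * k.+1%:R)^-1.
have c0 : 0 < c by rewrite invr_gt0 mulr_gt0.
have N : \forall x \near x0, U x /\ forall i j, `|'D_(delta_mx 0 j) h x 0 i| < c.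
  have N0 : \forall x \near x0, U x by have := open_nbhs_nbhs (conj oU Ux0); apply: filterS.
  have N1 : \forall x \near x0, forall i j, `|'D_(delta_mx 0 j) h x 0 i| < c.
    apply: (near_forall (P := fun i x => forall j, `|'D_(delta_mx 0 j) h x 0 i| < c)) => i.
    apply: (near_forall (P := fun j x => `|'D_(delta_mx 0 j) h x 0 i| < c)) => j.
    have Cj := (Ck_rowP 0 _ oU).1 ((Ch 1).2 (delta_mx 0 j)) i.
    move: (Cj x0 Ux0) => /cvgrPdist_lt/(_ _ c0).
    by apply: filterS => x; rewrite Dh0 mxE sub0r normrN.
  by move: N0 N1; apply: filterS2.
have [d /= d0 xd] := (nbhs_ballP _ _).1 N.
exists d => //; split=> [x /xd[]//|x v xdx i]; have [Ux Dx] := xd _ xdx.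
have dh : differentiable h x by exact: (Ch 1).1.
rewrite derive_row_sum // summxE.
apply: le_trans (ler_norm_sum _ _ _) _.
apply: (@le_trans _ _ (\sum_(j < k) c * `|v|)).
  apply: ler_sum => j _; rewrite mxE normrM mulrC.
  by apply: ler_pM => //; [exact/ltW/Dx|exact: row_norm_coord].
rewrite sumr_const card_ord -[_ *+ k]mulr_natl mulrA ler_wpM2r // /c invfM mulrCA.
rewrite ler_piMr ?invr_ge0 // ler_pdivrMr ?ltr0n // mul1r ler_nat; exact: leqnSn.
Qed.

Theorem inverse_function : exists (V B : set 'rV[R]_k) (K : 'rV[R]_k -> 'rV[R]_k),
  [/\ open V /\ open B, V x0, V `<=` U /\ smooth_on B K,
      forall x, V x -> [/\ B (G x), K (G x) = x & forall v : 'rV[R]_k, 'D_v G x = 0 -> v = 0] &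
      forall y, B y -> V (K y) /\ G (K y) = y].
Proof.
have [d d0 [dU hd]] := small.
have d2 : 0 < d / 2 by rewrite divr_gt0.
have d4 : 0 < d / 4 by rewrite divr_gt0.
have inB (x : 'rV[R]_k) : `|x0 - x| <= d / 2 -> ball x0 d x.
  by move=> xd; rewrite -ball_normE /=; apply: le_lt_trans xd _; lra.
have lip (x y : 'rV[R]_k) : ball x0 d x -> ball x0 d y -> `|h x - h y| <= 2^-1 * `|x - y|.
  move=> xd yd; apply: row_norm_le => [|i]; first by rewrite mulr_ge0 ?invr_ge0.
  have seg (s : R) : 0 <= s <= 1 -> ball x0 d (y + s *: (x - y)).
    move=> /andP[s0 s1]; move: xd yd; rewrite -ball_normE /= => xd yd.
    have -> : x0 - (y + s *: (x - y)) = s *: (x0 - x) + (1 - s) *: (x0 - y).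
      by rewrite !scalerBr !scalerBl !scale1r; apply/rowP => j; rewrite !mxE; ring.
    apply: le_lt_trans (ler_normD _ _) _; rewrite !normrZ !ger0_norm ?subr_ge0 //.
    have [->|sn0] := eqVneq s 0; first by rewrite mul0r add0r subr0 mul1r.
    have s0' : 0 < s by rewrite lt_def sn0.
    have h1 : s * `|x0 - x| < s * d by rewrite ltr_pM2l.
    have h2 : (1 - s) * `|x0 - y| <= (1 - s) * d by apply: ler_wpM2l (ltW yd); rewrite subr_ge0.
    by move: (_ * `|_|) (_ * `|_|) h1 h2 => a b; lra.
  have dhi (z : 'rV[R]_k) : ball x0 d z -> differentiable (fun z => h z 0 i) z.
    by move=> zd; apply: (differentiable_rowP _ _).1 ((Ch 1).1 _ (dU _ zd)) i.
  have [s s01 hE] := @MVT_line _ _ (fun z => h z 0 i) y (x - y) (fun s s01 => dhi _ (seg s s01)).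
  have s01' : 0 <= s <= 1 by case/andP: s01 => /ltW-> /ltW->.
  have yx : y + (x - y) = x by rewrite addrC subrK.
  rewrite yx -derive_row_coord in hE; last exact: ((Ch 1).1 _ (dU _ (seg _ s01'))).
  have -> : (h x - h y) 0 i = h x 0 i - h y 0 i by rewrite !mxE.
  rewrite hE.
  exact/hd/seg.
(* The norm is the displacement of [x0] under the fixed-point map for [y]. Below d/4 it keeps the
   closed ball of radius d/2 stable, since the contraction contributes at most another d/4;
   strictness puts the fixed point in the open ball. *)
pose B := [set y : 'rV[R]_k | `|(y - G x0) *m A| < d / 4].
have cA : continuous (fun y : 'rV[R]_k => (y - G x0) *m A).
  move=> y; apply: differentiable_continuous.
  have dy : differentiable (fun y : 'rV[R]_k => y - G x0) y by apply: differentiableB.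
  exact: (derive_mulmxr A 0 dy).1.
have oB : open B.
  rewrite (_ : B = (fun y : 'rV[R]_k => `|(y - G x0) *m A|) @^-1` [set r | r < d / 4]) //.
  apply: open_comp; last exact: open_lt.
  move=> y _; apply: (@continuous_comp _ _ _ (fun y : 'rV[R]_k => (y - G x0) *m A) Num.norm).
    exact: cA.
  exact: norm_continuous.
have fixE x y : h x + y *m A = x <-> G x = y.
  rewrite /h; split=> [E|->]; last by rewrite subrK.
  have yA : y *m A = G x *m A by apply: (addrI (x - G x *m A)); rewrite E subrK.
  by rewrite -[y]mulmx1 -AJ mulmxA yA -mulmxA AJ mulmx1.
have K_ex y : exists x, B y -> `|x0 - x| < d / 2 /\ G x = y.
  have [By|nBy] := pselect (B y); last by exists x0.
  have Tle (x : 'rV[R]_k) : `|x0 - x| <= d / 2 ->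
      `|x0 - (h x + y *m A)| <= 2^-1 * `|x0 - x| + `|(y - G x0) *m A|.
    move=> xd; have -> : x0 - (h x + y *m A) = (h x0 - h x) - (y - G x0) *m A.
      by rewrite /h mulmxBl; apply/rowP => j; rewrite !mxE; ring.
    apply: le_trans (ler_normB _ _) _; rewrite lerD2r.
    by apply: lip; [exact: ballxx|exact: inB].
  move: (By) => /=; rewrite /B /= => By'.
  have [||||x xd Tx] := @half_contraction_fixpoint R k (fun x => h x + y *m A) x0 (d / 2).
  - exact: ltW.
  - move=> x xd; apply: continuousD; last exact: cst_continuous.
    exact: (Ch 0) (dU _ (inB _ xd)).
  - move=> x xd; apply: le_trans (Tle _ xd) _.
    by move: (`|x0 - x|) xd (`|_ *m A|) By' => a ? b ?; lra.
  - move=> x x' xd x'd; rewrite opprD addrACA subrr addr0.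
    by apply: lip; exact: inB.
  exists x => _; split; last exact/fixE.
  have := Tle _ xd; rewrite Tx.
  by move: (`|x0 - x|) xd (`|_ *m A|) By' => a ? b ?; lra.
have [K KP] := choice K_ex.
have uniqK (x x' : 'rV[R]_k) : `|x0 - x| < d / 2 -> `|x0 - x'| < d / 2 ->
    `|x - x'| <= 2 * `|(G x - G x') *m A|.
  move=> xd x'd; have := lip _ _ (inB _ (ltW xd)) (inB _ (ltW x'd)).
  have E : x - x' = (h x - h x') + (G x - G x') *m A.
    by rewrite /h mulmxBl; apply/rowP => j; rewrite !mxE; ring.
  have := ler_normD (h x - h x') ((G x - G x') *m A); rewrite -E.
  by move: (`|_|) (`|_|) (`|_|) => a b c; lra.
pose V := [set x : 'rV[R]_k | `|x0 - x| < d / 2 /\ B (G x)].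
have VU : V `<=` U by move=> x [xd _]; apply/dU/inB/ltW.
have oV : open V.
  rewrite openE => x [xd BGx]; rewrite /interior.
  have N1 : \forall z \near x, ball x0 (d / 2) z.
    have xd' : ball x0 (d / 2) x by rewrite -ball_normE.
    by have := open_nbhs_nbhs (conj (ball_open x0 (d / 2)) xd'); apply: filterS.
  have N2 : \forall z \near x, B (G z).
    have cGx : {for x, continuous G} by apply: (CG 0); exact: (VU _ (conj xd BGx)).
    have := near_preimage cGx oB BGx.
    by apply: filterS.
  by move: N1 N2; apply: filterS2 => z; rewrite -ball_normE.
have BG0 : B (G x0) by rewrite /B /= subrr mul0mx normr0.
have KV y : B y -> V (K y) /\ G (K y) = y.
  by move=> By; have [xd GK] := KP _ By; rewrite /V /= GK.
have VK x : V x -> K (G x) = x.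
  move=> [xd BGx]; have [Kd GK] := KP _ BGx.
  have := uniqK _ _ Kd xd; rewrite GK subrr mul0mx normr0 mulr0 normr_le0 subr_eq0.
  by move/eqP.
(* If ['D_v G x = 0] then the differential of [h] maps [v] to itself, although it halves norms. *)
have injV x v : V x -> 'D_v G x = 0 -> v = 0.
  move=> Vx Dv; apply/eqP; rewrite -normr_le0.
  have xd : ball x0 d x by case: Vx => /ltW/inB.
  have : `|v| <= 2^-1 * `|v|.
    apply: row_norm_le => [|i]; first by rewrite mulr_ge0 ?invr_ge0.
    by have := hd _ v xd i; rewrite Dh ?Dv ?mul0mx ?subr0 //; exact: VU.
  by move: (`|v|) => a; lra.
have uJ x : V x -> J x \in unitmx.
  by move=> Vx; apply: unit_of_inj (VU _ Vx) _ => v; exact: injV.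
have [c2 c20 c2P] := mulmx_bound A.
have Klip y y' : B y -> B y' -> `|K y - K y'| <= 2 * c2 * `|y - y'|.
  move=> By By'; have [yd yE] := KP _ By; have [yd' yE'] := KP _ By'.
  have := uniqK _ _ yd yd'; rewrite yE yE' => /le_trans; apply.
  by rewrite -mulrA ler_pM2l // c2P.
have nB y : B y -> \forall u \near (0 : 'rV[R]_k), B (u + y).
  move=> By; have : \forall z \near y, B z by exact: open_nbhs_nbhs (conj oB By).
  by rewrite (near_shift 0 y) subr0.
have dK y : B y -> differentiable K y /\ 'd K y = mulmxr (invmx (J (K y))) :> (_ -> _).
  move=> By; have [VKy GKy] := KV _ By.
  apply: differentiable_eps; first exact: continuous_linear_row.
  move=> e e0; have [c1 c10 c1P] := mulmx_bound (invmx (J (K y))).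
  (* [2 * c2] is the Lipschitz constant of [K] and [c1] bounds the inverse Jacobian at [K y], which
     turns the linearization error of [G] at [K y] into that of [K] at [y]. *)
  pose e' := e / (2 * c1 * c2).
  have e'0 : 0 < e' by rewrite divr_gt0 // !mulr_gt0.
  have := differentiable_near_eps (dG (VU _ VKy)) e'0.
  move=> /nbhs_ballP[r /= r0 rP].
  have N1 : \forall u \near (0 : 'rV[R]_k), `|u| < r / (2 * c2).
    apply/nbhs_ballP; exists (r / (2 * c2)); first by rewrite /= divr_gt0 // mulr_gt0.
    by move=> u; rewrite -ball_normE /= sub0r normrN.
  move: (nB _ By) N1; apply: filterS2 => u Bu ur.
  have Kl := Klip _ _ Bu By; rewrite addrK in Kl.
  pose w := K (u + y) - K y.
  have wr : ball 0 r w.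
    rewrite -ball_normE /= sub0r normrN; apply: le_lt_trans Kl _.
    by rewrite mulrC -ltr_pdivlMr // mulr_gt0.
  have := rP _ wr; rewrite /w subrK (KV _ Bu).2 GKy addrK => Gw.
  rewrite /=; have -> : w - u *m invmx (J (K y)) = - ((u - 'd G (K y) w) *m invmx (J (K y))).
    rewrite mulmxBl opprB; congr (_ - _).
    by rewrite -[X in X *m _](mul_rV_lin1 ('d G (K y))) -mulmxA mulmxV ?mulmx1 // uJ.
  rewrite normrN; apply: le_trans (c1P _) _.
  apply: (@le_trans _ _ (c1 * (e' * (2 * c2 * `|u|)))).
    by rewrite ler_pM2l //; apply: le_trans Gw _; rewrite ler_pM2l.
  rewrite le_eqVlt; apply/orP; left; apply/eqP; rewrite /e'; field.
  by rewrite !gt_eqF.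
(* Bootstrap: the differential of [K] is the inverse Jacobian of [G] composed with [K], which is as
   regular as [K] itself, so each round gains one order. *)
have CK r : Ck_on r B K.
  elim: r => [|r IH]; first by move=> y By; apply: differentiable_continuous; exact: (dK _ By).1.
  split=> [y By|u]; first exact: (dK _ By).1.
  apply/Ck_rowP => // j.
  have CM i j' : Ck_on r B (fun y => J (K y) i j').
    have Cj := (Ck_rowP r _ oU).1 ((CG r.+1).2 (delta_mx 0 i)) j'.
    have := Ck_comp oB (fun y By => VU _ (KV _ By).1) IH Cj.
    apply: Ck_ext => // y By /=; rewrite DJ; last exact: VU (KV _ By).1.
    by rewrite -rowE mxE.
  have Ci i : Ck_on r B (fun y => u 0 i * invmx (J (K y)) i j).
    apply: CkM => //; first exact: Ck_cst.
    by apply: Ck_invmx => // y By; exact/uJ/(KV _ By).1.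
  apply: Ck_ext (Ck_sum (index_enum _) predT oB Ci) => // y By.
  by rewrite deriveE ?(dK _ By).2 /= ?mxE //; exact: (dK _ By).1.
exists V, B, K; split=> //.
- by split=> //; rewrite subrr normr0.
- by move=> x Vx; split; [case: Vx|exact: VK|move=> v; exact: injV].
Qed.

End InverseFunction.

(** * The Poincare lemma on balls *)

Section LeibnizRule.
Context {R : realType}.
Local Notation mu := (@lebesgue_measure R).

(** Differentiation under the integral sign, dominated by the constant [M], followed by the
    fundamental theorem of calculus: [f'] is at once the [t]-derivative of the integrand at [t = 0]
    and the derivative of [Phi]. This is the shape in which the Poincare lemma meets it. *)
Lemma leibniz_rule (f : R -> R -> R) (f' Phi : R -> R) (c M : R) : 0 < c ->
  (forall t s : R, `|t| < c -> 0 <= s <= 1 ->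
     derivable (f ^~ s) t 1 /\ `|'D_1 (f ^~ s) t| <= M) ->
  (forall t : R, `|t| < c -> {within `[0, 1], continuous (f t)}) ->
  (forall s : R, 0 <= s <= 1 -> 'D_1 (f ^~ s) 0 = f' s) ->
  (forall s : R, 0 <= s <= 1 -> is_derive s 1 Phi (f' s)) ->
  {within `[0, 1], continuous f'} ->
  is_derive (0 : R) 1 (fun t => (\int[mu]_(s in `[0%R, 1%R]) f t s)%R) (Phi 1 - Phi 0).
Proof.
move=> c0 df cf df0 dPhi cD.
have mB : measurable (`[0, 1]%classic : set (measurableTypeR R)) by exact: measurable_itv.
have I0 : `](- c), c[%classic 0 by rewrite /= in_itv /= oppr_lt0 c0.
have Ic t : `](- c), c[%classic t -> `|t| < c by rewrite /= in_itv /= ltr_norml.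
have i01 s : `[0:R, 1:R]%classic s -> 0 <= s <= 1 by rewrite /= in_itv.
have intf t : `](- c), c[%classic t -> mu.-integrable `[0, 1] (EFin \o f t).
  move=> /Ic tc; apply: continuous_compact_integrable; first exact: segment_compact.
  exact: cf.
have derf t s : `](- c), c[%classic t -> `[0:R, 1:R]%classic s -> derivable (f ^~ s) t 1.
  by move=> /Ic tc /i01 s01; exact: (df t s tc s01).1.
have M0 : 0 <= M.
  apply: le_trans (normr_ge0 _) (df 0 0 _ _).2; first by rewrite normr0.
  by rewrite lexx ler01.
have intM : mu.-integrable `[0, 1] (EFin \o (fun=> M)).
  apply: continuous_compact_integrable; first exact: segment_compact.
  by apply: continuous_subspaceT => x; exact: cst_continuous.
have ubM t s : `](- c), c[%classic t -> `[0:R, 1:R]%classic s -> `|partial1of2 f t s| <= M.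
  by move=> /Ic tc /i01 s01; rewrite partial1of2E; exact: (df t s tc s01).2.
have D1 := derivable_under_integral mB I0 intf derf (fun=> M0) intM ubM.
have D2 := differentiation_under_integral mB I0 intf derf (fun=> M0) intM ubM.
apply: DeriveDef => //; rewrite -derive1E D2.
have -> : (\int[mu]_(s in `[0%R, 1%R]) partial1of2 f 0 s)%R = (\int[mu]_(s in `[0%R, 1%R]) f' s)%R.
  by apply: eq_Rintegral => s /[!inE] /i01 s01; rewrite partial1of2E df0.
rewrite /Rintegral (continuous_FTC2 (F := Phi) ltr01 cD) //.
- split.
  + move=> s /[!in_itv]/= /andP[/ltW s0 /ltW s1].
    by case: (dPhi s); rewrite ?s0.
  + apply: cvg_at_right_filter; apply: differentiable_continuous.
    by apply/derivable1_diffP; case: (dPhi 0) => //; rewrite lexx ler01.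
  + apply: cvg_at_left_filter; apply: differentiable_continuous.
    by apply/derivable1_diffP; case: (dPhi 1) => //; rewrite lexx ler01.
- move=> s /[!in_itv]/= /andP[/ltW s0 /ltW s1].
  by rewrite derive1E; case: (dPhi s); rewrite ?s0.
Qed.

End LeibnizRule.

Lemma is_derive_along {R : realType} (V W : normedModType R) (f : V -> W) x v (s : R) df :
  is_derive (x + s *: v) v f df -> is_derive s 1 (fun s => f (x + s *: v)) df.
Proof.
have E : (fun h : R => h^-1 *: (f (x + (h *: 1 + s) *: v) - f (x + s *: v))) =
    (fun h : R => h^-1 *: (f (h *: v + (x + s *: v)) - f (x + s *: v))).
  by apply/funext => h; rewrite scalerDl addrCA -[h *: 1]/(h * 1) mulr1.
by move=> [D1 D2]; split; [rewrite /derivable /= E|rewrite /derive /= E].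
Qed.

Lemma is_derive_of_line {R : realType} (V W : normedModType R) (f : V -> W) x v df :
  is_derive (0 : R) 1 (fun t => f (x + t *: v)) df -> is_derive x v f df.
Proof.
have E : (fun h : R => h^-1 *: (f (x + (h *: 1 + 0) *: v) - f (x + 0 *: v))) =
    (fun h : R => h^-1 *: (f (h *: v + x) - f x)).
  by apply/funext => h; rewrite scale0r !addr0 [x + _]addrC -[h *: 1]/(h * 1) mulr1.
by move=> [D1 D2]; split; [rewrite /derivable /= -E|rewrite /derive /= -E].
Qed.

Lemma is_derive_big_sum {R : realType} (V W : normedModType R) k
    (h : 'I_k -> V -> W) x v (dh : 'I_k -> W) :
  (forall i, is_derive x v (h i) (dh i)) ->
  is_derive x v (fun y => \sum_i h i y) (\sum_i dh i).
Proof.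
move=> dhi; have -> : (fun y => \sum_i h i y) = \sum_i h i.
  by apply/funext => y; rewrite fct_sumE.
exact: is_derive_sum.
Qed.

Lemma continuous_bounded_ball {R : realType} (k : nat) (x0 : 'rV[R]_k) (r : R)
    (h : 'rV[R]_k -> R) : 0 <= r ->
  (forall y, `|x0 - y| <= r -> {for y, continuous h}) ->
  exists B : R, forall y, `|x0 - y| <= r -> `|h y| <= B.
Proof.
move=> r0 ch; pose A : set 'rV[R]_k := closed_ball_ Num.norm x0 r.
have Ax0 : A x0 by rewrite /A /closed_ball_ /= subrr normr0.
have cf : {within A, continuous (fun x => `|h x|)}.
  apply: continuous_in_subspaceT => x /[!inE] Ax.
  by apply: (@continuous_comp _ _ _ h Num.norm); [exact: ch|exact: norm_continuous].
have [z _ zP] := EVT_max_rV (ex_intro _ x0 Ax0) (@compact_closed_ball_row _ _ _ _) cf.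
by exists `|h z| => y yr; apply: zP; rewrite inE.
Qed.

Section Poincare.
Context {R : realType} (k : nat).

(* The mean value theorem on segments makes the remainder a difference of
   values of the continuous candidate differential. *)
Lemma differentiable_of_directional (U : set 'rV[R]_k) (f : 'rV[R]_k -> R)
    (w : 'rV[R]_k -> 'rV[R]_k) (x : 'rV[R]_k) (d : R) : 0 < d -> ball x d `<=` U ->
  (forall y v, U y -> is_derive y v f (\sum_i v 0 i * w y 0 i)) ->
  {for x, continuous w} -> differentiable f x.
Proof.
move=> d0 dU df cw.
pose l0 (v : 'rV[R]_k) := \sum_i v 0 i * w x 0 i.
have l_lin : linear l0.
  move=> a u v; rewrite /l0 scaler_sumr -big_split /=; apply: eq_bigr => i _.
  by rewrite !mxE mulrDl -mulrA.
pose lM := GRing.isLinear.Build _ _ _ _ _ l_lin.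
pose l : {linear 'rV[R]_k -> R} := HB.pack l0 lM.
apply: (@differentiable_eps _ _ _ f l x _ _).1; first exact: continuous_linear_row.
move=> e e0; pose e' := e / k.+1%:R.
have e'0 : 0 < e' by rewrite divr_gt0.
have N1 : \forall y \near x, `|w x - w y| < e' by move/cvgrPdist_lt: cw => /(_ _ e'0).
have [r /= r0 rP] := (nbhs_ballP _ _).1 N1.
have N : \forall h \near (0 : 'rV[R]_k), `|h| < Num.min d r.
  apply/nbhs_ballP; exists (Num.min d r); first by rewrite /= lt_min d0.
  by move=> h; rewrite -ball_normE /= sub0r normrN.
apply: filterS N => h; rewrite lt_min => /andP[hd hr].
have inb (s z : R) : 0 <= s <= 1 -> `|h| < z -> ball x z (x + s *: h).
  move=> /andP[s0 s1] hz; rewrite -ball_normE /= opprD addrA subrr sub0r normrN normrZ ger0_norm //.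
  by apply: le_lt_trans hz; rewrite ler_piMl.
have dfl (s : R) : 0 <= s <= 1 ->
    is_derive s 1 (fun s => f (x + s *: h)) (\sum_i h 0 i * w (x + s *: h) 0 i).
  by move=> s01; apply: is_derive_along; apply/df/dU/inb.
have [|||s /[!in_itv]/= /andP[/ltW s0 /ltW s1] sE] :=
    @MVT R (fun s => f (x + s *: h)) (fun s => \sum_i h 0 i * w (x + s *: h) 0 i) 0 1.
- exact: ltr01.
- by move=> s /[!in_itv]/= /andP[/ltW s0 /ltW s1]; apply: dfl; rewrite s0.
- apply: derivable_within_continuous => s /[!in_itv]/= s01.
  by have := dfl s s01; case.
have s01 : 0 <= s <= 1 by rewrite s0.
move: sE; rewrite scale1r scale0r addr0 subr0 mulr1 [x + h]addrC => ->.
rewrite /= /l0 -sumrB; apply: le_trans (ler_norm_sum _ _ _) _.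
apply: (@le_trans _ _ (\sum_(i < k) e' * `|h|)).
  apply: ler_sum => i _; rewrite -mulrBr normrM mulrC; apply: ler_pM => //; last exact: row_norm_coord.
  have := ltW (rP _ (inb s r s01 hr)); rewrite distrC; apply: le_trans.
  by have := row_norm_coord (w (x + s *: h) - w x) i; rewrite !mxE.
rewrite sumr_const card_ord -[_ *+ k]mulr_natl mulrA ler_wpM2r // /e' mulrCA.
rewrite ler_piMr ?(ltW e0) // ler_pdivrMr ?ltr0n // mul1r ler_nat; exact: leqnSn.
Qed.

(** The primitive at [x] is the integral of the form along the segment from [x0] to [x].
    Differentiating it along [v] under the integral gives, for a closed form, the total derivative
    in [s] of [s] times the form at [x0 + s (x - x0)] applied to [v]; this integrates to the value
    of the form at [x]. *)
Lemma poincare (x0 : 'rV[R]_k) (d : R) (w : 'I_k -> 'rV[R]_k -> R) : 0 < d ->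
  (forall i, smooth_on (ball x0 d) (w i)) ->
  (forall x, ball x0 d x -> forall i j,
     'D_(delta_mx 0 j) (w i) x = 'D_(delta_mx 0 i) (w j) x) ->
  exists g : 'rV[R]_k -> R, smooth_on (ball x0 d) g /\
    forall x v, ball x0 d x -> 'D_v g x = \sum_i v 0 i * w i x.
Proof.
move=> d0 Cw dw; set U := ball x0 d in Cw dw *.
have oU : open U by exact: ball_open.
have Dw i x : U x -> differentiable (w i) x by move=> Ux; exact: (Cw i 1).1.
have DDw i x v : U x -> differentiable ('D_v (w i)) x.
  by move=> Ux; exact: ((Cw i 2).2 v).1.
pose f (x : 'rV[R]_k) (s : R) := \sum_i (x - x0) 0 i * w i (x0 + s *: (x - x0)).
pose g (x : 'rV[R]_k) := (\int[@lebesgue_measure R]_(s in `[0%R, 1%R]) f x s)%R.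
have seg (x : 'rV[R]_k) (s r : R) : `|x0 - x| <= r -> 0 <= s <= 1 ->
    `|x0 - (x0 + s *: (x - x0))| <= r.
  move=> xr /andP[s0 s1]; rewrite opprD addrA subrr sub0r normrN normrZ ger0_norm // distrC.
  by apply: le_trans xr; rewrite ler_piMl.
have segU (x : 'rV[R]_k) (s : R) : U x -> 0 <= s <= 1 -> U (x0 + s *: (x - x0)).
  move=> Ux s01; move: (Ux); rewrite /U -ball_normE /= => Ux'.
  by apply: le_lt_trans Ux'; exact: seg.
have dws i (x : 'rV[R]_k) (s : R) : U x -> 0 <= s <= 1 ->
    is_derive s 1 (fun s => w i (x0 + s *: (x - x0))) ('D_(x - x0) (w i) (x0 + s *: (x - x0))).
  by move=> Ux s01; apply: is_derive_along; apply/derivableP/diff_derivable/Dw/segU.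
have dwt i (x v : 'rV[R]_k) (s t : R) : U (x + t *: v) -> 0 <= s <= 1 ->
    is_derive t 1 (fun t => w i (x0 + s *: (x + t *: v - x0)))
      (s * 'D_v (w i) (x0 + s *: (x + t *: v - x0))).
  move=> Ux s01.
  have E (t' : R) : x0 + s *: (x + t' *: v - x0) = (x0 + s *: (x - x0)) + t' *: (s *: v).
    by apply/rowP => j; rewrite !mxE; ring.
  have -> : (fun t => w i (x0 + s *: (x + t *: v - x0))) =
            (fun t => w i ((x0 + s *: (x - x0)) + t *: (s *: v))).
    by apply/funext => t'; rewrite E.
  apply: is_derive_along; rewrite -E; apply: DeriveDef; first exact/diff_derivable/Dw/segU.
  by rewrite !deriveE ?linearZ //; exact/Dw/segU.
have dxt (x v : 'rV[R]_k) i (t : R) : is_derive t 1 (fun t => (x + t *: v - x0) 0 i) (v 0 i).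
  have -> : (fun t => (x + t *: v - x0) 0 i) = cst ((x - x0) 0 i) + (v 0 i \*: (@id R)).
    by apply/funext => t'; rewrite fctE !mxE /= -[_ *: _]/(_ * _); ring.
  have := is_deriveD (is_derive_cst ((x - x0) 0 i) t 1) (is_deriveZ (v 0 i) (is_derive_id t 1)).
  by rewrite add0r -[_ *: 1]/(_ * 1) mulr1.
have dg (x v : 'rV[R]_k) : U x -> is_derive x v g (\sum_i v 0 i * w i x).
  move=> Ux.
  have xd : `|x0 - x| < d by move: Ux; rewrite /U -ball_normE.
  (* [r] lies strictly between |x0 - x| and [d], and [c] is chosen so that [x + t v] stays in the
     closed ball of radius [r] for |t| < c. On this compact ball the [w i] and their derivatives are
     bounded, as the domination requires. *)
  pose r := (`|x0 - x| + d) / 2.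
  have rd : r < d by rewrite /r; move: (`|_|) xd => a; lra.
  have r0 : 0 <= r by rewrite divr_ge0 // addr_ge0 // ltW.
  pose c := (d - `|x0 - x|) / (2 * (`|v| + 1)).
  have v1 : 0 < `|v| + 1 by rewrite ltr_wpDl.
  have c0 : 0 < c by rewrite divr_gt0 ?subr_gt0 // mulr_gt0.
  have xtr (t : R) : `|t| < c -> `|x0 - (x + t *: v)| <= r.
    move=> tc; rewrite opprD addrA; apply: le_trans (ler_normB _ _) _; rewrite normrZ.
    have h1 : `|t| * `|v| <= c * (`|v| + 1).
      by apply: ler_pM => //; [exact: ltW|rewrite lerDl].
    have h2 : c * (`|v| + 1) = (d - `|x0 - x|) / 2 by rewrite /c; field; rewrite gt_eqF.
    move: h1; rewrite h2 /r; move: (`|x0 - x|) (_ * _) => a b; lra.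
  have Ur y : `|x0 - y| <= r -> U y.
    by move=> yr; rewrite /U -ball_normE /=; exact: le_lt_trans yr rd.
  have B0E i : exists B : R, forall y : 'rV[R]_k, `|x0 - y| <= r -> `|w i y| <= B.
    by apply: continuous_bounded_ball => // y yr; exact/differentiable_continuous/Dw/Ur.
  have B1E i : exists B : R, forall y : 'rV[R]_k, `|x0 - y| <= r -> `|'D_v (w i) y| <= B.
    by apply: continuous_bounded_ball => // y yr; exact/differentiable_continuous/DDw/Ur.
  have [B0 B0P] := choice B0E; have [B1 B1P] := choice B1E.
  have dft (t s : R) : `|t| < c -> 0 <= s <= 1 ->
      is_derive t 1 (fun t => f (x + t *: v) s)
       (\sum_i ((x + t *: v - x0) 0 i * (s * 'D_v (w i) (x0 + s *: (x + t *: v - x0))) +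
                w i (x0 + s *: (x + t *: v - x0)) * v 0 i)).
    move=> tc s01; apply: is_derive_big_sum => i.
    exact: is_deriveM (dxt x v i t) (dwt i x v s t (Ur _ (xtr _ tc)) s01).
  pose f' (s : R) := \sum_i ((x - x0) 0 i * (s * 'D_v (w i) (x0 + s *: (x - x0))) +
                w i (x0 + s *: (x - x0)) * v 0 i).
  pose Phi (s : R) := s * \sum_i w i (x0 + s *: (x - x0)) * v 0 i.
  have c00 : `|0 : R| < c by rewrite normr0.
  apply: is_derive_of_line.
  have -> : \sum_i v 0 i * w i x = Phi 1 - Phi 0.
    rewrite /Phi mul1r mul0r subr0; apply: eq_bigr => i _.
    by rewrite scale1r addrC subrK mulrC.
  apply: (@leibniz_rule _ (fun t s => f (x + t *: v) s) f' Phi c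
    (\sum_i (r * B1 i + B0 i * `|v|))) => //.
  - move=> t s tc s01; have [D1 D2] := dft t s tc s01; split=> //; rewrite D2.
    apply: le_trans (ler_norm_sum _ _ _) _; apply: ler_sum => i _.
    have yr : `|x0 - (x0 + s *: (x + t *: v - x0))| <= r by apply: seg => //; exact: xtr.
    apply: le_trans (ler_normD _ _) _; apply: lerD; rewrite normrM.
      apply: ler_pM => //.
        by apply: le_trans (row_norm_coord _ _) _; rewrite distrC; exact: xtr.
      rewrite normrM; case/andP: s01 => s0 s1; rewrite ger0_norm //.
      by apply: le_trans (B1P i _ yr); rewrite ler_piMl.
    by apply: ler_pM => //; [exact: B0P|exact: row_norm_coord].
  - move=> t tc; apply: derivable_within_continuous => s /[!in_itv]/= s01.
    have UU := Ur _ (xtr _ tc).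
    have dsi i : is_derive s 1 (fun s => (x + t *: v - x0) 0 i * w i (x0 + s *: (x + t *: v - x0)))
        ((x + t *: v - x0) 0 i *: 'D_(x + t *: v - x0) (w i) (x0 + s *: (x + t *: v - x0))).
      exact: is_deriveZ (dws i _ s UU s01).
    by have := is_derive_big_sum dsi; case.
  - move=> s s01; have := dft 0 s c00 s01.
    by rewrite scale0r addr0; case.
  - move=> s s01.
    have dPi i : is_derive s 1 (fun s => w i (x0 + s *: (x - x0)) * v 0 i)
        ('D_(x - x0) (w i) (x0 + s *: (x - x0)) * v 0 i).
      have := is_deriveZ (v 0 i) (dws i _ s Ux s01).
      rewrite -[_ *: _]/(_ * _) mulrC.
      suff -> : (v 0 i \*: (fun s : R => w i (x0 + s *: (x - x0)))) =
          (fun s => w i (x0 + s *: (x - x0)) * v 0 i) by [].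
      by apply/funext => s' /=; rewrite mulrC.
    have := is_deriveM (is_derive_id s 1) (is_derive_big_sum dPi).
    move=> dP; suff E : s *: (\sum_i 'D_(x - x0) (w i) (x0 + s *: (x - x0)) * v 0 i) +
        (\sum_i w i (x0 + s *: (x - x0)) * v 0 i) *: 1 = f' s by rewrite -E.
    rewrite /f' big_split /= -[_ *: 1]/(_ * 1) mulr1; congr (_ + _).
    rewrite -[_ *: _]/(_ * _) mulr_sumr.
    have Us := segU x s Ux s01.
    have DE i u := derive_coord_sum u (Dw i _ Us).
    transitivity (\sum_i \sum_j s * ((x - x0) 0 j *
        'D_(delta_mx 0 j) (w i) (x0 + s *: (x - x0)) * v 0 i)).
      by apply: eq_bigr => i _; rewrite DE mulr_suml mulr_sumr.
    rewrite exchange_big /=; apply: eq_bigr => i _.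
    rewrite DE !mulr_sumr; apply: eq_bigr => j _.
    (* Closedness of the form exchanges the two indices here. *)
    by rewrite (dw _ Us); ring.
  - apply: derivable_within_continuous => s /[!in_itv]/= s01.
    have dsD i : derivable (fun s : R => 'D_v (w i) (x0 + s *: (x - x0))) s 1.
      have : is_derive s 1 (fun s : R => 'D_v (w i) (x0 + s *: (x - x0))) ('D_(x - x0) ('D_v (w i)) (x0 + s *: (x - x0))).
        apply: (is_derive_along (f := 'D_v (w i))); apply: DeriveDef => //.
        exact: diff_derivable (DDw i _ v (segU x s Ux s01)).
      by case.
    have dsw i : derivable (fun s : R => w i (x0 + s *: (x - x0))) s 1.
      by have := dws i _ s Ux s01; case.
    have dsi i : derivable (fun s : R => (x - x0) 0 i * (s * 'D_v (w i) (x0 + s *: (x - x0))) +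
                w i (x0 + s *: (x - x0)) * v 0 i) s 1.
      pose F1 (s : R) : R := 'D_v (w i) (x0 + s *: (x - x0)).
      pose F2 (s : R) : R := w i (x0 + s *: (x - x0)).
      have d1 : derivable (cst ((x - x0) 0 i) * (id * F1)) s 1.
        apply: derivableM; first exact: derivable_cst.
        by apply: derivableM; [exact: derivable_id|exact: dsD].
      have d2 : derivable (F2 * cst (v 0 i)) s 1.
        by apply: derivableM; [exact: dsw|exact: derivable_cst].
      exact: (derivableD d1 d2).
    by have := is_derive_big_sum (fun i => derivableP (dsi i)); case.
have Cg r : Ck_on r U g.
  have dfg x : U x -> differentiable g x.
    move=> Ux; have [e e0 eU] : exists2 e : R, 0 < e & ball x e `<=` U.
      have N : \forall y \near x, U y by have := open_nbhs_nbhs (conj oU Ux); apply: filterS.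
      by have [e] := (nbhs_ballP _ _).1 N; exists e.
    apply: (@differentiable_of_directional U g (fun y => \row_i w i y) x e) => //.
      move=> y v Uy; have := dg y v Uy.
      suff -> : \sum_i v 0 i * (\row_i w i y) 0 i = \sum_i v 0 i * w i y by [].
      by apply: eq_bigr => i _; rewrite mxE.
    have Cr : Ck_on 0 U (fun y => \row_i w i y).
      by apply/Ck_rowP => // j; apply: Ck_ext (Cw j 0) => // y _; rewrite mxE.
    exact: Cr.
  case: r => [|r]; first by move=> x /dfg; exact: differentiable_continuous.
  split=> // v.
  have Ci i : Ck_on r U (fun x => v 0 i * w i x) by apply: CkM => //; [exact: Ck_cst|exact: Cw].
  apply: Ck_ext (Ck_sum (index_enum _) predT oU Ci) => // x Ux.
  by have [_ ->] := dg x v Ux.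
exists g; split=> // x v Ux; by have [_ ->] := dg x v Ux.
Qed.

End Poincare.

(** * Derivatives of complex-valued maps *)

Section SmoothReal.
Context {R : realType} (k : nat) (U : set 'rV[R]_k).
Hypothesis oU : open U.
Implicit Types (f g : 'rV[R]_k -> R).

Lemma smooth_cst (V : normedModType R) (a : V) : smooth_on U (fun=> a).
Proof. by move=> r; exact: Ck_cst. Qed.

Lemma smoothD f g : smooth_on U f -> smooth_on U g -> smooth_on U (fun x => f x + g x).
Proof. by move=> Cf Cg r; apply: CkD. Qed.

Lemma smoothB f g : smooth_on U f -> smooth_on U g -> smooth_on U (fun x => f x - g x).
Proof. by move=> Cf Cg r; apply: CkB. Qed.

Lemma smoothN f : smooth_on U f -> smooth_on U (fun x => - f x).
Proof. by move=> Cf r; apply: CkN. Qed.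

Lemma smoothM f g : smooth_on U f -> smooth_on U g -> smooth_on U (fun x => f x * g x).
Proof. by move=> Cf Cg r; apply: CkM. Qed.

Lemma smooth_sum (I : Type) (s : seq I) (P : pred I) (f : I -> 'rV[R]_k -> R) :
  (forall i, smooth_on U (f i)) -> smooth_on U (fun x => \sum_(i <- s | P i) f i x).
Proof. by move=> Cf r; apply: Ck_sum => // i; exact: Cf. Qed.

Lemma smoothV f : (forall x, U x -> f x != 0) -> smooth_on U f ->
  smooth_on U (fun x => (f x)^-1).
Proof. by move=> f0 Cf r; apply: Ck_inv. Qed.

Lemma smooth_ext (V : normedModType R) (f g : 'rV[R]_k -> V) :
  (forall x, U x -> f x = g x) -> smooth_on U f -> smooth_on U g.
Proof. by move=> fg Cf r; exact: Ck_ext (Cf r). Qed.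

Lemma smooth_derive (V : normedModType R) (f : 'rV[R]_k -> V) v :
  smooth_on U f -> smooth_on U ('D_v f).
Proof. by move=> Cf r; exact: (Cf r.+1).2. Qed.

Lemma smooth_diff (V : normedModType R) (f : 'rV[R]_k -> V) x :
  smooth_on U f -> U x -> differentiable f x.
Proof. by move=> Cf; exact: (Cf 1).1. Qed.

Lemma smooth_derivable (V : normedModType R) (f : 'rV[R]_k -> V) x v :
  smooth_on U f -> U x -> derivable f x v.
Proof. by move=> Cf Ux; exact/diff_derivable/smooth_diff. Qed.

Lemma smooth_row l (f : 'rV[R]_k -> 'rV[R]_l) j :
  smooth_on U f -> smooth_on U (fun x => f x 0 j).
Proof. by move=> Cf r; exact: (Ck_rowP r f oU).1 (Cf r) j. Qed.

Lemma smooth_derive_along f (X : 'rV[R]_k -> 'rV[R]_k) :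
  smooth_on U f -> smooth_on U X -> smooth_on U (fun x => 'D_(X x) f x).
Proof.
move=> Cf CX; apply: (@smooth_ext _ (fun x => \sum_j X x 0 j * 'D_(delta_mx 0 j) f x)).
  by move=> x Ux; rewrite derive_coord_sum //; exact: smooth_diff Cf Ux.
by apply: smooth_sum => j; apply: smoothM; [exact: smooth_row|exact: smooth_derive].
Qed.

Lemma derive_lin (V : normedModType R) (f : 'rV[R]_k -> V) x a u v :
  differentiable f x -> 'D_(a *: u + v) f x = a *: 'D_u f x + 'D_v f x.
Proof. by move=> df; rewrite !deriveE // linearP. Qed.

Lemma derive_sub (V : normedModType R) (f : 'rV[R]_k -> V) x u v :
  differentiable f x -> 'D_(u - v) f x = 'D_u f x - 'D_v f x.
Proof. by move=> df; rewrite !deriveE // linearB. Qed.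

(** Each iterated derivative is a first-order term plus a contraction of the second derivatives of
    [f] with [X] and [Y]. The contractions cancel by [schwarz], and the first-order terms leave the
    Lie bracket in flat coordinates. *)
Lemma derive_bracket f (X Y : 'rV[R]_k -> 'rV[R]_k) x : U x ->
  smooth_on U f -> smooth_on U X -> smooth_on U Y ->
  'D_(X x) (fun y => 'D_(Y y) f y) x - 'D_(Y x) (fun y => 'D_(X y) f y) x =
  'D_('D_(X x) Y x - 'D_(Y x) X x) f x.
Proof.
move=> Ux Cf CX CY.
have df := smooth_diff Cf.
have E (Z : 'rV[R]_k -> 'rV[R]_k) v : smooth_on U Z ->
    'D_v (fun y => 'D_(Z y) f y) x =
    'D_('D_v Z x) f x + \sum_j Z x 0 j * 'D_v ('D_(delta_mx 0 j) f) x.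
  move=> CZ; pose h := fun y => \sum_j Z y 0 j * 'D_(delta_mx 0 j) f y.
  have -> : 'D_v (fun y => 'D_(Z y) f y) x = 'D_v h x.
    apply: near_eq_derive; have := open_nbhs_nbhs (conj oU Ux); apply: filterS => y Uy.
    by rewrite derive_coord_sum //; exact: df.
  rewrite /h; have -> : (fun y => \sum_j Z y 0 j * 'D_(delta_mx 0 j) f y) =
    \sum_j ((fun y => Z y 0 j) * 'D_(delta_mx 0 j) f).
    by apply/funext => y; rewrite fct_sumE.
  have dZ j : derivable (fun y => Z y 0 j) x v by exact: smooth_derivable (smooth_row j CZ) Ux.
  have dD j : derivable ('D_(delta_mx 0 j) f) x v.
    exact: smooth_derivable (smooth_derive _ Cf) Ux.
  rewrite derive_sum; last by move=> j; exact: derivableM (dZ j) (dD j).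
  rewrite (derive_coord_sum _ (df _ Ux)) -big_split; apply: eq_bigr => j _ /=.
  rewrite (deriveM (dZ j) (dD j)) (derive_row_coord _ _ (smooth_diff CZ Ux)).
  by rewrite [LHS]addrC; congr (_ + _); exact: mulrC.
rewrite !E // opprD addrACA.
rewrite [in RHS](derive_sub _ _ (df _ Ux)).
rewrite -[RHS]addr0; congr (_ + _).
have DD (u v : 'rV[R]_k) : \sum_j u 0 j * 'D_v ('D_(delta_mx 0 j) f) x =
    \sum_j \sum_l u 0 j * (v 0 l * 'D_(delta_mx 0 l) ('D_(delta_mx 0 j) f) x).
  apply: eq_bigr => j _; rewrite (derive_coord_sum _ (smooth_diff (smooth_derive _ Cf) Ux)).
  by rewrite mulr_sumr.
apply/eqP; rewrite subr_eq0; apply/eqP.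
apply: (etrans (DD (Y x) (X x))); apply: (etrans _ (esym (DD (X x) (Y x)))).
rewrite exchange_big; apply: eq_bigr => j _; apply: eq_bigr => l _.
by rewrite (schwarz oU (Cf 2) _ _ Ux) mulrCA.
Qed.

End SmoothReal.

Section ComplexArith.
Context {R : realType}.
Implicit Types a b : R[i].
Local Notation Re := complex.Re.
Local Notation Im := complex.Im.

Lemma cReD a b : Re (a + b) = Re a + Re b. Proof. by case: a b => ? ? [? ?]. Qed.
Lemma cImD a b : Im (a + b) = Im a + Im b. Proof. by case: a b => ? ? [? ?]. Qed.
Lemma cReN a : Re (- a) = - Re a. Proof. by case: a. Qed.
Lemma cImN a : Im (- a) = - Im a. Proof. by case: a. Qed.
Lemma cReM a b : Re (a * b) = Re a * Re b - Im a * Im b. Proof. by case: a b => ? ? [? ?]. Qed.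
Lemma cImM a b : Im (a * b) = Re a * Im b + Im a * Re b. Proof. by case: a b => ? ? [? ?]. Qed.
Lemma cReJ a : Re a^* = Re a. Proof. by case: a. Qed.
Lemma cImJ a : Im a^* = - Im a. Proof. by case: a. Qed.
Lemma cReC (x : R) : Re x%:C = x. Proof. by []. Qed.
Lemma cImC (x : R) : Im x%:C = 0. Proof. by []. Qed.
Lemma complex_eq a b : Re a = Re b -> Im a = Im b -> a = b.
Proof. by case: a b => ? ? [? ?] /= -> ->. Qed.

Definition cReImE := (cReD, cImD, cReN, cImN, cReM, cImM, cReJ, cImJ, cReC, cImC).

End ComplexArith.

Section ComplexFunctions.
Context {R : realType} (k : nat).
Implicit Types (U : set 'rV[R]_k) (f g : 'rV[R]_k -> R[i]).

(** [csm] and [cdr] are the scalar forms to which [csmooth_on] and [cderive] unfold at each matrix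
    entry. *)
Definition csm U f : Prop :=
  smooth_on U (fun x => complex.Re (f x)) /\ smooth_on U (fun x => complex.Im (f x)).

Definition cdr f (x v : 'rV[R]_k) : R[i] :=
  'D_v (fun y => complex.Re (f y)) x +i* 'D_v (fun y => complex.Im (f y)) x.

Lemma Re_cdr f x v : complex.Re (cdr f x v) = 'D_v (fun y => complex.Re (f y)) x.
Proof. by []. Qed.

Lemma Im_cdr f x v : complex.Im (cdr f x v) = 'D_v (fun y => complex.Im (f y)) x.
Proof. by []. Qed.

Lemma deriveMR (f g : 'rV[R]_k -> R) x v : derivable f x v -> derivable g x v ->
  'D_v (f * g) x = (f x * 'D_v g x + g x * 'D_v f x)%R.
Proof. exact: deriveM. Qed.

Variable U : set 'rV[R]_k.
Hypothesis oU : open U.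

Lemma csm_ext f g : (forall x, U x -> f x = g x) -> csm U f -> csm U g.
Proof. by move=> fg [C1 C2]; split; [move: C1|move: C2]; apply: smooth_ext => // x /fg->. Qed.

Lemma cdr_ext f g x v : U x -> (forall x, U x -> f x = g x) -> cdr f x v = cdr g x v.
Proof.
move=> Ux fg; have N := open_nbhs_nbhs (conj oU Ux).
by rewrite /cdr; congr (_ +i* _); apply: near_eq_derive; apply: filterS N => y /fg->.
Qed.

Lemma csm_cst (c : R[i]) : csm U (fun=> c).
Proof. by split; exact: smooth_cst. Qed.

Lemma csmD f g : csm U f -> csm U g -> csm U (fun x => f x + g x).
Proof.
move=> [f1 f2] [g1 g2]; split.
  by apply: smooth_ext (smoothD oU f1 g1) => // x _; rewrite cReImE.
by apply: smooth_ext (smoothD oU f2 g2) => // x _; rewrite cReImE.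
Qed.

Lemma csmM f g : csm U f -> csm U g -> csm U (fun x => f x * g x).
Proof.
move=> [f1 f2] [g1 g2]; split.
  by apply: smooth_ext (smoothB oU (smoothM oU f1 g1) (smoothM oU f2 g2)) => // x _; rewrite cReImE.
by apply: smooth_ext (smoothD oU (smoothM oU f1 g2) (smoothM oU f2 g1)) => // x _; rewrite cReImE.
Qed.

Lemma csmJ f : csm U f -> csm U (fun x => (f x)^*).
Proof.
move=> [f1 f2]; split; first by apply: smooth_ext f1 => // x _; rewrite cReImE.
by apply: smooth_ext (smoothN oU f2) => // x _; rewrite cReImE.
Qed.

Lemma csm_real (r : 'rV[R]_k -> R) : smooth_on U r -> csm U (fun x => (r x)%:C).
Proof. by split => //; exact: smooth_cst. Qed.

Lemma csm_sum (I : Type) (s : seq I) (P : pred I) (f : I -> 'rV[R]_k -> R[i]) :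
  (forall i, csm U (f i)) -> csm U (fun x => \sum_(i <- s | P i) f i x).
Proof.
move=> Cf; elim: s => [|a s IH].
  by apply: csm_ext (csm_cst 0) => x _; rewrite big_nil.
have [Pa|Pa] := boolP (P a).
  by apply: csm_ext (csmD (Cf a) IH) => x _; rewrite big_cons Pa.
by apply: csm_ext IH => x _; rewrite big_cons (negbTE Pa).
Qed.

Lemma cdr_cst (c : R[i]) x v : cdr (fun=> c) x v = 0.
Proof. by rewrite /cdr !derive_cst. Qed.

Lemma cdrD f g x v : csm U f -> csm U g -> U x ->
  cdr (fun y => f y + g y) x v = cdr f x v + cdr g x v.
Proof.
move=> [f1 f2] [g1 g2] Ux.
have df1 := smooth_derivable (v := v) f1 Ux; have df2 := smooth_derivable (v := v) f2 Ux.
have dg1 := smooth_derivable (v := v) g1 Ux; have dg2 := smooth_derivable (v := v) g2 Ux.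
apply: complex_eq.
  rewrite Re_cdr cReD !Re_cdr -(deriveD df1 dg1).
  by congr (derive _ x v); apply/funext => y; rewrite cReD.
rewrite Im_cdr cImD !Im_cdr -(deriveD df2 dg2).
by congr (derive _ x v); apply/funext => y; rewrite cImD.
Qed.

Lemma cdrM f g x v : csm U f -> csm U g -> U x ->
  cdr (fun y => f y * g y) x v = cdr f x v * g x + f x * cdr g x v.
Proof.
move=> [f1 f2] [g1 g2] Ux.
have df1 := smooth_derivable (v := v) f1 Ux; have df2 := smooth_derivable (v := v) f2 Ux.
have dg1 := smooth_derivable (v := v) g1 Ux; have dg2 := smooth_derivable (v := v) g2 Ux.
apply: complex_eq.
  rewrite cReD !cReM !Re_cdr !Im_cdr.
  have -> : (fun y => complex.Re (f y * g y)) =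
      ((fun y => complex.Re (f y)) * (fun y => complex.Re (g y)) -
       (fun y => complex.Im (f y)) * (fun y => complex.Im (g y)) : 'rV[R]_k -> R).
    by apply/funext => y; rewrite cReM.
  rewrite (deriveB (derivableM df1 dg1) (derivableM df2 dg2)).
  rewrite (deriveMR df1 dg1) (deriveMR df2 dg2).
  by move: ('D_v _ x) ('D_v _ x) ('D_v _ x) ('D_v _ x) => *; ring.
rewrite cImD !cImM !Re_cdr !Im_cdr.
have -> : (fun y => complex.Im (f y * g y)) =
      ((fun y => complex.Re (f y)) * (fun y => complex.Im (g y)) +
       (fun y => complex.Im (f y)) * (fun y => complex.Re (g y)) : 'rV[R]_k -> R).
  by apply/funext => y; rewrite cImM.
rewrite (deriveD (derivableM df1 dg2) (derivableM df2 dg1)).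
rewrite (deriveMR df1 dg2) (deriveMR df2 dg1).
by move: ('D_v _ x) ('D_v _ x) ('D_v _ x) ('D_v _ x) => *; ring.
Qed.

Lemma cdrJ f x v : csm U f -> U x -> cdr (fun y => (f y)^*) x v = (cdr f x v)^*.
Proof.
move=> [f1 f2] Ux; have df2 := smooth_derivable (v := v) f2 Ux.
apply: complex_eq.
  rewrite Re_cdr cReJ Re_cdr.
  by congr (derive _ x v); apply/funext => y; rewrite cReJ.
rewrite Im_cdr cImJ Im_cdr -deriveN //.
by congr (derive _ x v); apply/funext => y; rewrite cImJ.
Qed.

Lemma cdr_real (r : 'rV[R]_k -> R) x v : cdr (fun y => (r y)%:C) x v = ('D_v r x)%:C.
Proof. by apply: complex_eq; [rewrite Re_cdr|rewrite Im_cdr derive_cst]. Qed.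

Lemma cdr_sum (I : Type) (s : seq I) (P : pred I) (f : I -> 'rV[R]_k -> R[i]) x v :
  (forall i, csm U (f i)) -> U x ->
  cdr (fun y => \sum_(i <- s | P i) f i y) x v = \sum_(i <- s | P i) cdr (f i) x v.
Proof.
move=> Cf Ux; elim: s => [|a s IH].
  by rewrite big_nil -[RHS](cdr_cst 0 x v); apply: cdr_ext => // y _; rewrite big_nil.
rewrite big_cons; case: ifP => Pa.
  rewrite -IH -cdrD //; last exact: csm_sum.
  by apply: cdr_ext => // y _; rewrite big_cons Pa.
by rewrite -IH; apply: cdr_ext => // y _; rewrite big_cons Pa.
Qed.

End ComplexFunctions.

(** * Product rules and brackets for maps into complex matrices *)

Section ComplexMatrices.
Context {R : realType} (k : nat) (U : set 'rV[R]_k).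
Hypothesis oU : open U.

Lemma csmooth_ext p q (F G : 'rV[R]_k -> 'M[R[i]]_(p, q)) :
  (forall x, U x -> F x = G x) -> csmooth_on U F -> csmooth_on U G.
Proof. by move=> FG CF i j; apply: (csm_ext oU _ (CF i j)) => x /FG->. Qed.

Lemma cderive_ext p q (F G : 'rV[R]_k -> 'M[R[i]]_(p, q)) x v : U x ->
  (forall x, U x -> F x = G x) -> cderive F x v = cderive G x v.
Proof.
move=> Ux FG; apply/matrixP => i j; rewrite !mxE.
exact: (cdr_ext oU v Ux (fun x Ux => congr1 (fun M : 'M_(p, q) => M i j) (FG x Ux))).
Qed.

Lemma csmooth_cst p q (A : 'M[R[i]]_(p, q)) : csmooth_on U (fun=> A).
Proof. by move=> i j; exact: csm_cst. Qed.

Lemma cderive_cst p q (A : 'M[R[i]]_(p, q)) (x v : 'rV[R]_k) : cderive (fun=> A) x v = 0.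
Proof. by apply/matrixP => i j; rewrite !mxE; exact: cdr_cst. Qed.

Lemma csmoothD p q (F G : 'rV[R]_k -> 'M[R[i]]_(p, q)) :
  csmooth_on U F -> csmooth_on U G -> csmooth_on U (fun x => F x + G x).
Proof.
by move=> CF CG i j; apply: (csm_ext oU _ (csmD oU (CF i j) (CG i j))) => x _; rewrite mxE.
Qed.

Lemma cderiveD p q (F G : 'rV[R]_k -> 'M[R[i]]_(p, q)) x v :
  csmooth_on U F -> csmooth_on U G -> U x ->
  cderive (fun y => F y + G y) x v = cderive F x v + cderive G x v.
Proof.
move=> CF CG Ux; apply/matrixP => i j; rewrite !mxE -[RHS](cdrD v (CF i j) (CG i j) Ux).
by apply: (cdr_ext oU _ Ux) => y _; rewrite mxE.
Qed.

Lemma csmoothM p q r (F : 'rV[R]_k -> 'M[R[i]]_(p, q)) (G : 'rV[R]_k -> 'M[R[i]]_(q, r)) :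
  csmooth_on U F -> csmooth_on U G -> csmooth_on U (fun x => F x *m G x).
Proof.
move=> CF CG i j.
apply: (csm_ext oU _ (csm_sum oU (index_enum _) predT (fun l => csmM oU (CF i l) (CG l j)))).
by move=> x _; rewrite mxE.
Qed.

Lemma cderiveM p q r (F : 'rV[R]_k -> 'M[R[i]]_(p, q)) (G : 'rV[R]_k -> 'M[R[i]]_(q, r)) x v :
  csmooth_on U F -> csmooth_on U G -> U x ->
  cderive (fun y => F y *m G y) x v = cderive F x v *m G x + F x *m cderive G x v.
Proof.
move=> CF CG Ux; apply/matrixP => i j; rewrite !mxE -big_split /=.
have := cdr_sum oU (index_enum _) predT v (fun l => csmM oU (CF i l) (CG l j)) Ux.
rewrite (eq_bigr _ (fun l _ => cdrM v (CF i l) (CG l j) Ux)).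
move=> E; transitivity (cdr (fun y => \sum_l F y i l * G y l j) x v).
  by apply: (cdr_ext oU _ Ux) => y _; rewrite mxE.
by rewrite E; apply: eq_bigr => l _; rewrite !mxE.
Qed.

Lemma csmooth_adj p q (F : 'rV[R]_k -> 'M[R[i]]_(p, q)) :
  csmooth_on U F -> csmooth_on U (fun x => (F x)^t*).
Proof.
by move=> CF i j; apply: (csm_ext oU _ (csmJ oU (CF j i))) => x _; rewrite !mxE.
Qed.

Lemma cderive_adj p q (F : 'rV[R]_k -> 'M[R[i]]_(p, q)) x v :
  csmooth_on U F -> U x -> cderive (fun y => (F y)^t*) x v = (cderive F x v)^t*.
Proof.
move=> CF Ux; apply/matrixP => i j; rewrite !mxE -[RHS](cdrJ v (CF j i) Ux).
by apply: (cdr_ext oU _ Ux) => y _; rewrite !mxE.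
Qed.

Lemma csmoothZ p q (c : 'rV[R]_k -> R[i]) (F : 'rV[R]_k -> 'M[R[i]]_(p, q)) :
  csm U c -> csmooth_on U F -> csmooth_on U (fun x => c x *: F x).
Proof.
by move=> Cc CF i j; apply: (csm_ext oU _ (csmM oU Cc (CF i j))) => x _; rewrite mxE.
Qed.

Lemma cderiveZ p q (c : 'rV[R]_k -> R[i]) (F : 'rV[R]_k -> 'M[R[i]]_(p, q)) x v :
  csm U c -> csmooth_on U F -> U x ->
  cderive (fun y => c y *: F y) x v = cdr c x v *: F x + c x *: cderive F x v.
Proof.
move=> Cc CF Ux; apply/matrixP => i j; rewrite !mxE -[RHS](cdrM v Cc (CF i j) Ux).
by apply: (cdr_ext oU _ Ux) => y _; rewrite mxE.
Qed.

Lemma csmooth_cderive p q (F : 'rV[R]_k -> 'M[R[i]]_(p, q)) (X : 'rV[R]_k -> 'rV[R]_k) :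
  csmooth_on U F -> smooth_on U X -> csmooth_on U (fun x => cderive F x (X x)).
Proof.
move=> CF CX i j; have [C1 C2] := CF i j; split.
  by apply: smooth_ext (smooth_derive_along oU C1 CX) => // x _; rewrite mxE.
by apply: smooth_ext (smooth_derive_along oU C2 CX) => // x _; rewrite mxE.
Qed.

Lemma cderive_lin p q (F : 'rV[R]_k -> 'M[R[i]]_(p, q)) x a u v :
  csmooth_on U F -> U x ->
  cderive F x (a *: u + v) = a%:C *: cderive F x u + cderive F x v.
Proof.
move=> CF Ux; apply/matrixP => i j; have [C1 C2] := CF i j; rewrite !mxE.
rewrite (derive_lin _ _ _ (smooth_diff C1 Ux)) (derive_lin _ _ _ (smooth_diff C2 Ux)).
by apply: complex_eq; rewrite !cReImE /= -[_ *: _]/(_ * _) ?mul0r ?subr0 ?addr0.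
Qed.

Lemma cderive_bracket p q (F : 'rV[R]_k -> 'M[R[i]]_(p, q)) (X Y : 'rV[R]_k -> 'rV[R]_k) x :
  U x -> csmooth_on U F -> smooth_on U X -> smooth_on U Y ->
  cderive (fun y => cderive F y (Y y)) x (X x) - cderive (fun y => cderive F y (X y)) x (Y x) =
  cderive F x ('D_(X x) Y x - 'D_(Y x) X x).
Proof.
move=> Ux CF CX CY; apply/matrixP => i j; have [C1 C2] := CF i j.
have ReE (Z : 'rV[R]_k -> 'rV[R]_k) : (fun y => complex.Re (cderive F y (Z y) i j)) =
    (fun y => 'D_(Z y) (fun z => complex.Re (F z i j)) y).
  by apply/funext => y; rewrite mxE.
have ImE (Z : 'rV[R]_k -> 'rV[R]_k) : (fun y => complex.Im (cderive F y (Z y) i j)) =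
    (fun y => 'D_(Z y) (fun z => complex.Im (F z i j)) y).
  by apply/funext => y; rewrite mxE.
rewrite !mxE !ReE !ImE -(derive_bracket oU Ux C1 CX CY) -(derive_bracket oU Ux C2 CX CY).
by [].
Qed.

End ComplexMatrices.

(** * Hermitian products and horizontal unitary frames *)

(** Linear in the first argument and antilinear in the second. It is locked so that the sesquilinear
    rules below are the only way to compute with it and simplification does not expose the matrix
    product. *)
HB.lock Definition herm (R : realType) (m : nat) (p q : 'rV[R[i]]_m) : R[i] :=
  (p *m q^t*) 0 0.
Arguments herm {R m} p q.

Section Hermitian.
Context {R : realType} (m : nat).
Implicit Types (p q r : 'rV[R[i]]_m) (c : R[i]).

Lemma hermE p q : herm p q = \sum_j p 0 j * (q 0 j)^*.
Proof. by rewrite herm.unlock mxE; apply: eq_bigr => j _; rewrite !mxE. Qed.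

Lemma redot_herm p q : redot p q = complex.Re (herm p q).
Proof. by rewrite /redot /mxtrace big_ord1 herm.unlock. Qed.

Lemma herm_conj p q : (herm q p)^* = herm p q.
Proof.
rewrite !hermE rmorph_sum; apply: eq_bigr => j _.
by apply: complex_eq; rewrite !cReImE; ring.
Qed.

Lemma hermDl p q r : herm (p + q) r = herm p r + herm q r.
Proof. by rewrite herm.unlock mulmxDl mxE. Qed.

Lemma hermNl p r : herm (- p) r = - herm p r.
Proof. by rewrite herm.unlock mulNmx mxE. Qed.

Lemma hermBl p q r : herm (p - q) r = herm p r - herm q r.
Proof. by rewrite hermDl hermNl. Qed.

Lemma hermZl c p r : herm (c *: p) r = c * herm p r.
Proof. by rewrite herm.unlock -scalemxAl mxE. Qed.

Lemma hermDr p q r : herm p (q + r) = herm p q + herm p r.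
Proof. by rewrite -herm_conj hermDl rmorphD -(herm_conj p q) -(herm_conj p r). Qed.

Lemma hermNr p q : herm p (- q) = - herm p q.
Proof. by rewrite -herm_conj hermNl rmorphN -(herm_conj p q). Qed.

Lemma hermBr p q r : herm p (q - r) = herm p q - herm p r.
Proof. by rewrite hermDr hermNr. Qed.

Lemma hermZr c p q : herm p (c *: q) = conjc c * herm p q.
Proof. by rewrite -herm_conj hermZl rmorphM -(herm_conj p q). Qed.

Lemma herm_suml (I : Type) (s : seq I) (P : pred I) (F : I -> 'rV[R[i]]_m) q :
  herm (\sum_(i <- s | P i) F i) q = \sum_(i <- s | P i) herm (F i) q.
Proof. by rewrite herm.unlock mulmx_suml summxE. Qed.

Lemma herm_sumr (I : Type) (s : seq I) (P : pred I) (F : I -> 'rV[R[i]]_m) q :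
  herm q (\sum_(i <- s | P i) F i) = \sum_(i <- s | P i) herm q (F i).
Proof.
rewrite -herm_conj herm_suml rmorph_sum.
by apply: eq_bigr => i _; rewrite -(herm_conj q).
Qed.

Lemma herm0l p : herm 0 p = 0. Proof. by rewrite herm.unlock mul0mx mxE. Qed.
Lemma herm0r p : herm p 0 = 0. Proof. by rewrite -herm_conj herm0l rmorph0. Qed.

Lemma herm_Re_ge0 p : 0 <= complex.Re (herm p p).
Proof.
rewrite hermE (raddf_sum (@complex.Re R : {additive R[i] -> R})).
apply: sumr_ge0 => j _ /=.
by case: (p 0 j) => a b /=; nra.
Qed.

End Hermitian.

Section HermCalculus.
Context {R : realType} (k m : nat) (U : set 'rV[R]_k).
Hypothesis oU : open U.
Implicit Types (F G : 'rV[R]_k -> 'rV[R[i]]_m).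

Lemma csm_herm F G : csmooth_on U F -> csmooth_on U G -> csm U (fun x => herm (F x) (G x)).
Proof. by move=> CF CG; rewrite herm.unlock; exact: (csmoothM oU CF (csmooth_adj oU CG)). Qed.

Lemma cdr_herm F G x v : csmooth_on U F -> csmooth_on U G -> U x ->
  cdr (fun y => herm (F y) (G y)) x v = herm (cderive F x v) (G x) + herm (F x) (cderive G x v).
Proof.
move=> CF CG Ux; have := cderiveM oU v CF (csmooth_adj oU CG) Ux.
rewrite (cderive_adj oU _ CG Ux) => /matrixP/(_ 0 0).
by rewrite herm.unlock [LHS]mxE [RHS]mxE.
Qed.

End HermCalculus.

Section Orthonormal.
Context {R : realType} (m : nat) (f : 'I_m -> 'rV[R[i]]_m).
Hypothesis ff : forall a b, herm (f a) (f b) = (a == b)%:R.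

Definition rows_mx : 'M[R[i]]_m := \matrix_(a, j) f a 0 j.

Lemma rows_mx_unitary : rows_mx *m rows_mx^t* = 1%:M /\ rows_mx^t* *m rows_mx = 1%:M.
Proof.
have BB : rows_mx *m rows_mx^t* = 1%:M.
  apply/matrixP => a b; rewrite [RHS]mxE -ff hermE mxE.
  by apply: eq_bigr => j _; rewrite !mxE.
by split=> //; exact: mulmx1C.
Qed.

Lemma orthonormal_expand (Y : 'rV[R[i]]_m) : Y = \sum_a herm Y (f a) *: f a.
Proof.
rewrite -[LHS]mulmx1 -rows_mx_unitary.2 mulmxA mulmx_sum_row.
apply: eq_bigr => a _; congr (_ *: _); last by apply/rowP => j; rewrite !mxE.
by rewrite hermE mxE; apply: eq_bigr => j _; rewrite !mxE.
Qed.

Lemma orthonormal_parseval (X Y : 'rV[R[i]]_m) :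
  herm X Y = \sum_a herm X (f a) * conjc (herm Y (f a)).
Proof.
rewrite {1}[X]orthonormal_expand herm_suml; apply: eq_bigr => a _.
by rewrite hermZl -(herm_conj _ Y).
Qed.

End Orthonormal.

Definition adjoin {T : Type} {n : nat} (z : T) (w : 'I_n -> T) (i : 'I_n.+1) : T :=
  oapp w z (unlift ord0 i).

Lemma adjoin0 T n (z : T) (w : 'I_n -> T) : adjoin z w ord0 = z.
Proof. by rewrite /adjoin unlift_none. Qed.

Lemma adjoinS T n (z : T) (w : 'I_n -> T) a : adjoin z w (lift ord0 a) = w a.
Proof. by rewrite /adjoin liftK. Qed.

Section CderiveSum.
Context {R : realType} (k : nat) (U : set 'rV[R]_k) (p q : nat) (F : 'rV[R]_k -> 'M[R[i]]_(p, q)).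
Hypothesis CF : csmooth_on U F.

Lemma cderive0 x : cderive F x 0 = 0.
Proof. by apply/matrixP => i j; rewrite !mxE !derive0. Qed.

Lemma cderive_sum (I : Type) (s : seq I) (c : I -> R) (u : I -> 'rV[R]_k) x : U x ->
  cderive F x (\sum_(a <- s) c a *: u a) = \sum_(a <- s) (c a)%:C *: cderive F x (u a).
Proof.
move=> Ux; elim: s => [|a s IH]; first by rewrite !big_nil cderive0.
by rewrite !big_cons (cderive_lin _ _ _ CF Ux) IH.
Qed.

End CderiveSum.

(* In the notation of the header: w_a, the derivative of w_j along e_i, and the
   components Gamma_ijl and C_ijl. *)
HB.lock Definition fvec (R : realType) (n : nat) (z : 'rV[R]_n.+1 -> 'rV[R[i]]_n.+2)
    (E : 'I_n.+1 -> 'rV[R]_n.+1 -> 'rV[R]_n.+1) a x : 'rV[R[i]]_n.+2 :=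
  cderive z x (E a x).

HB.lock Definition fcov (R : realType) (n : nat) (z : 'rV[R]_n.+1 -> 'rV[R[i]]_n.+2)
    (E : 'I_n.+1 -> 'rV[R]_n.+1 -> 'rV[R]_n.+1) i j x : 'rV[R[i]]_n.+2 :=
  cderive (fvec z E j) x (E i x).

HB.lock Definition conn (R : realType) (n : nat) (z : 'rV[R]_n.+1 -> 'rV[R[i]]_n.+2)
    (E : 'I_n.+1 -> 'rV[R]_n.+1 -> 'rV[R]_n.+1) i j l x : R :=
  complex.Re (herm (fcov z E i j x) (fvec z E l x)).

HB.lock Definition cubic (R : realType) (n : nat) (z : 'rV[R]_n.+1 -> 'rV[R[i]]_n.+2)
    (E : 'I_n.+1 -> 'rV[R]_n.+1 -> 'rV[R]_n.+1) i j l x : R :=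
  complex.Im (herm (fcov z E i j x) (fvec z E l x)).

Arguments fvec {R n} z E a x.
Arguments fcov {R n} z E i j x.
Arguments conn {R n} z E i j l x.
Arguments cubic {R n} z E i j l x.

Section Frame.
Context {R : realType} (n : nat) (U : set 'rV[R]_n.+1).
Context (z : 'rV[R]_n.+1 -> 'rV[R[i]]_n.+2) (E : 'I_n.+1 -> 'rV[R]_n.+1 -> 'rV[R]_n.+1).

Local Notation fvec := (fvec z E).
Local Notation fcov := (fcov z E).
Local Notation conn := (conn z E).
Local Notation cubic := (cubic z E).

Lemma fvecE a x : fvec a x = cderive z x (E a x). Proof. by rewrite fvec.unlock. Qed.
Lemma fcovE i j x : fcov i j x = cderive (fvec j) x (E i x). Proof. by rewrite fcov.unlock. Qed.

Lemma herm_fcov i j l x : herm (fcov i j x) (fvec l x) = conn i j l x +i* cubic i j l x.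
Proof. by rewrite conn.unlock cubic.unlock; case: (herm _ _). Qed.

(** The complex equation in the last clause carries two conditions: its real part makes [E]
    orthonormal for the metric induced by [z], its imaginary part makes the tangent spaces totally
    real. Together with the other two, [z] and the [fvec a] form a unitary basis at each point. *)
Definition legendrian_frame : Prop :=
  [/\ open U, csmooth_on U z, forall a, smooth_on U (E a) &
   forall x, U x -> [/\ herm (z x) (z x) = 1, forall a, herm (fvec a x) (z x) = 0 &
     forall a b, herm (fvec a x) (fvec b x) = (a == b)%:R]].

Hypothesis H : legendrian_frame.
Let oU : open U. Proof. by case: H. Qed.
Let Cz : csmooth_on U z. Proof. by case: H. Qed.
Let CE a : smooth_on U (E a). Proof. by case: H. Qed.
Let zz x : U x -> herm (z x) (z x) = 1. Proof. by case: H => _ _ _ h /h[]. Qed.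
Let wz a x : U x -> herm (fvec a x) (z x) = 0. Proof. by case: H => _ _ _ h /h[]. Qed.
Let ww a b x : U x -> herm (fvec a x) (fvec b x) = (a == b)%:R.
Proof. by case: H => _ _ _ h /h[]. Qed.
Let zw a x : U x -> herm (z x) (fvec a x) = 0.
Proof. by move=> Ux; rewrite -herm_conj wz // rmorph0. Qed.

Lemma csmooth_fvec a : csmooth_on U (fvec a).
Proof.
by apply: csmooth_ext (csmooth_cderive oU Cz (CE a)) => // x _; rewrite fvecE.
Qed.
Let Cw := csmooth_fvec.

Lemma csmooth_fcov i j : csmooth_on U (fcov i j).
Proof.
by apply: csmooth_ext (csmooth_cderive oU (Cw j) (CE i)) => // x _; rewrite fcovE.
Qed.

Lemma smooth_cubic i j l : smooth_on U (cubic i j l).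
Proof. by rewrite cubic.unlock; exact: (csm_herm oU (csmooth_fcov i j) (Cw l)).2. Qed.

Lemma frame_orthonormal x : U x -> forall a b : 'I_n.+2,
  herm (adjoin (z x) (fvec^~ x) a) (adjoin (z x) (fvec^~ x) b) = (a == b)%:R.
Proof.
move=> Ux a b; rewrite /adjoin; case: unliftP => [i ->|->]; case: unliftP => [j ->|->] /=.
- by rewrite ww // (inj_eq lift_inj).
- by rewrite wz // eq_sym (negbTE (neq_lift _ _)).
- by rewrite zw // (negbTE (neq_lift _ _)).
- by rewrite zz // eqxx.
Qed.

Lemma frame_expand x (Y : 'rV[R[i]]_n.+2) : U x ->
  Y = herm Y (z x) *: z x + \sum_a herm Y (fvec a x) *: fvec a x.
Proof.
move=> Ux; rewrite [LHS](orthonormal_expand (frame_orthonormal Ux)) big_ord_recl adjoin0.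
by congr (_ + _); apply: eq_bigr => a _; rewrite adjoinS.
Qed.

Lemma frame_parseval x (X Y : 'rV[R[i]]_n.+2) : U x ->
  herm X Y = herm X (z x) * conjc (herm Y (z x)) +
    \sum_a herm X (fvec a x) * conjc (herm Y (fvec a x)).
Proof.
move=> Ux; rewrite [LHS](orthonormal_parseval (frame_orthonormal Ux)) big_ord_recl adjoin0.
by congr (_ + _); apply: eq_bigr => a _; rewrite adjoinS.
Qed.

(** A linear relation among the [E a x] would be carried by [dz] to a relation among the orthonormal
    [fvec a x], so the matrix of the frame is invertible; the coefficients are then read off by
    pairing with [fvec a x]. *)
Lemma frame_decomp x v : U x ->
  v = \sum_a complex.Re (herm (cderive z x v) (fvec a x)) *: E a x.
Proof.
move=> Ux; pose M : 'M[R]_n.+1 := \matrix_(a, j) E a x 0 j.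
have cM (c : 'rV[R]_n.+1) : c *m M = \sum_a c 0 a *: E a x.
  by rewrite mulmx_sum_row; apply: eq_bigr => a _; congr (_ *: _); apply/rowP => j; rewrite !mxE.
have coef (c : 'rV[R]_n.+1) a : herm (cderive z x (c *m M)) (fvec a x) = (c 0 a)%:C.
  rewrite cM (cderive_sum Cz) // herm_suml (bigD1 a) //= hermZl -fvecE ww // eqxx mulr1.
  by rewrite big1 ?addr0 // => b ba; rewrite hermZl -fvecE ww // (negbTE ba) mulr0.
have uM : M \in unitmx.
  rewrite -row_free_unit -kermx_eq0; apply/eqP/row_matrixP => i; rewrite row0.
  have : row i (kermx M) *m M = 0 by rewrite -row_mul mulmx_ker row0.
  move=> r0; apply/rowP => a; have := coef (row i (kermx M)) a.
  by rewrite r0 cderive0 herm0l => /(congr1 (@complex.Re R)) /= <-; rewrite mxE.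
rewrite {1}(_ : v = v *m invmx M *m M); last by rewrite mulmxKV.
rewrite [LHS]cM; apply: eq_bigr => a _; congr (_ *: _).
by rewrite -[X in cderive z x X](mulmxKV uM) coef.
Qed.

Lemma fcov_z i j x : U x -> herm (fcov i j x) (z x) = - (i == j)%:R.
Proof.
move=> Ux; have := cdr_herm oU (E i x) (Cw j) Cz Ux.
rewrite (cdr_ext oU _ Ux (fun y Uy => wz j Uy)) cdr_cst -fcovE -fvecE ww //.
by move/esym/eqP; rewrite addr_eq0 => /eqP->; rewrite (eq_sym j).
Qed.

Lemma fcov_expand i j x : U x ->
  fcov i j x = - (i == j)%:R *: z x + \sum_a (conn i j a x +i* cubic i j a x) *: fvec a x.
Proof.
move=> Ux; rewrite [LHS](frame_expand _ Ux) fcov_z //; congr (_ + _).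
by apply: eq_bigr => a _; rewrite herm_fcov.
Qed.

(** Differentiating the constant product of [fvec j] and [fvec l] gives a complex equation: its real
    part says that the connection is metric, its imaginary part is the symmetry of the cubic form in
    the last two slots. *)
Lemma conn_cubic_sym i j l x : U x ->
  conn i j l x = - conn i l j x /\ cubic i j l x = cubic i l j x.
Proof.
move=> Ux; have := cdr_herm oU (E i x) (Cw j) (Cw l) Ux.
rewrite (cdr_ext oU _ Ux (fun y Uy => ww j l Uy)) cdr_cst -!fcovE.
rewrite -(herm_conj (fvec j x) (fcov i l x)) !herm_fcov => /esym/eqP.
by rewrite eq_complex /= => /andP[/eqP E1 /eqP E2]; split; lra.
Qed.

Definition fbracket i j x : 'rV[R]_n.+1 := 'D_(E i x) (E j) x - 'D_(E j x) (E i) x.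

(** The flat connection has no torsion, so the skew part of [fcov] is the image of a real tangent
    vector. Its real components compute the bracket ([fbracketE]), and the vanishing of its
    imaginary components is the remaining symmetry of the cubic form ([cubic_symm]). *)
Lemma fcov_bracket i j x : U x -> fcov i j x - fcov j i x = cderive z x (fbracket i j x).
Proof.
move=> Ux; rewrite -(cderive_bracket oU Ux Cz (CE i) (CE j)) !fcovE.
have fE a : (fun y => cderive z y (E a y)) = fvec a by apply/funext => y; rewrite fvecE.
by rewrite !fE.
Qed.

Lemma fbracketE i j x : U x ->
  fbracket i j x = \sum_l (conn i j l x - conn j i l x) *: E l x.
Proof.
move=> Ux; rewrite [LHS](frame_decomp _ Ux); apply: eq_bigr => l _.
by rewrite -fcov_bracket // hermBl !herm_fcov.
Qed.

Lemma cubic_symm i j l x : U x -> cubic i j l x = cubic j i l x.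
Proof.
move=> Ux; apply/eqP; rewrite -subr_eq0; apply/eqP.
have : complex.Im (herm (fcov i j x - fcov j i x) (fvec l x)) = 0.
  rewrite fcov_bracket // fbracketE // (cderive_sum Cz) // herm_suml.
  rewrite (bigD1 l) //= hermZl -fvecE ww // eqxx mulr1 big1 ?addr0 // => b bl.
  by rewrite hermZl -fvecE ww // (negbTE bl) mulr0.
by rewrite hermBl !herm_fcov.
Qed.

Lemma derive_fbracket (f : 'rV[R]_n.+1 -> R) i j x : U x -> smooth_on U f ->
  'D_(E i x) (fun y => 'D_(E j y) f y) x - 'D_(E j x) (fun y => 'D_(E i y) f y) x =
  \sum_l (conn i j l x - conn j i l x) * 'D_(E l x) f x.
Proof.
move=> Ux Cf; rewrite (derive_bracket oU Ux Cf (CE i) (CE j)) -/(fbracket i j x) fbracketE //.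
rewrite deriveE; last exact: smooth_diff Cf Ux.
rewrite linear_sum; apply: eq_bigr => l _; rewrite linearZ deriveE //.
exact: smooth_diff Cf Ux.
Qed.

(** Flatness of the ambient space: the two iterated derivatives of [fvec l] differ by its derivative
    along the bracket. Pairing with [fvec p] and expanding the products in the unitary basis gives
    the equation; the [z]-components produce the constant curvature term. The real part is the Gauss
    equation, the imaginary part the Codazzi equation. *)
Lemma structure_eq i j l p x : U x ->
  let om i j l := conn i j l x +i* cubic i j l x in
  let Dom i j l p := 'D_(E i x) (conn j l p) x +i* 'D_(E i x) (cubic j l p) x in
  Dom i j l p - Dom j i l p =
    ((j == l)%:R * (i == p)%:R - (i == l)%:R * (j == p)%:R) +
    \sum_m (om j l m * conjc (om i p m) - om i l m * conjc (om j p m)) +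
    \sum_m (conn i j m x - conn j i m x)%:C * om m l p.
Proof.
move=> Ux om Dom.
have DE i' j' : cdr (fun y => herm (fcov j' l y) (fvec p y)) x (E i' x) = Dom i' j' l p.
  by rewrite /Dom conn.unlock cubic.unlock.
rewrite -!DE !(cdr_herm oU _ (csmooth_fcov _ _) (Cw p) Ux) -!fcovE.
rewrite opprD addrACA -hermBl.
have -> : cderive (fcov j l) x (E i x) - cderive (fcov i l) x (E j x) =
    cderive (fvec l) x (fbracket i j x).
  rewrite -(cderive_bracket oU Ux (Cw l) (CE i) (CE j)).
  have fE a : (fun y => cderive (fvec l) y (E a y)) = fcov a l.
    by apply/funext => y; rewrite fcovE.
  by rewrite !fE.
rewrite fbracketE // (cderive_sum (Cw l)) // herm_suml addrC; congr (_ + _).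
  rewrite !(frame_parseval _ (fcov _ p x) Ux) opprD addrACA !fcov_z //.
  congr (_ + _).
    by rewrite !rmorphN /= !mulrNN !rmorph_nat.
  by rewrite -sumrB; apply: eq_bigr => m _; rewrite !herm_fcov.
by apply: eq_bigr => m _; rewrite hermZl -fcovE herm_fcov.
Qed.

End Frame.

(** * The Codazzi equations of the normal form *)

Section CodazziAlgebra.
Context {R : realFieldType} (n : nat).
Local Notation O := (@ord0 n).
Local Notation S := (lift (@ord0 n)).

Lemma sum_delta m (a : 'I_m) (F : 'I_m -> R) : \sum_c (a == c)%:R * F c = F a.
Proof.
rewrite (bigD1 a) //= eqxx mul1r big1 ?addr0 // => c ca.
by rewrite eq_sym (negbTE ca) mul0r.
Qed.

(* G, C, dC i j l p and L i stand for Gamma, the cubic form, e_i(C_jlp) and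
   e_i(lambda). *)
Variables (d la : R) (G C : 'I_n.+1 -> 'I_n.+1 -> 'I_n.+1 -> R).
Variables (dC : 'I_n.+1 -> 'I_n.+1 -> 'I_n.+1 -> 'I_n.+1 -> R) (L : 'I_n.+1 -> R).
Hypotheses (n2 : (1 < n)%N) (d0 : d != 0) (d2 : d != 2^-1) (la0 : la != 0).
Hypothesis Gas : forall i j l, G i j l = - G i l j.
Hypothesis codazzi : forall i j l p, dC i j l p - dC j i l p =
  \sum_m (C j l m * G i p m - G j l m * C i p m - (C i l m * G j p m - G i l m * C j p m)) +
  \sum_m (G i j m - G j i m) * C m l p.
Hypotheses (C01 : forall i j l, C i j l = C j i l) (C12 : forall i j l, C i j l = C i l j).
Hypotheses (C000 : C O O O = la) (C00 : forall a, C O O (S a) = 0).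
Hypothesis C0 : forall a b, C O (S a) (S b) = (a == b)%:R * (d * la).
Hypothesis Ctr : forall c, \sum_a C (S a) (S a) (S c) = 0.
Hypotheses (D000 : forall i, dC i O O O = L i) (D00 : forall i a, dC i (S a) O O = 0).
Hypotheses (D00' : forall i a, dC i O O (S a) = 0).
Hypothesis D0 : forall i a b, dC i O (S a) (S b) = (a == b)%:R * (d * L i).
Hypothesis D0' : forall i a b, dC i (S a) O (S b) = (a == b)%:R * (d * L i).
Hypothesis Dtr : forall i a, \sum_b dC i (S a) (S b) (S b) = 0.

Let G0 i j : G i j j = 0.
Proof. by have := Gas i j j; lra. Qed.
Let C00' a : C O (S a) O = 0. Proof. by rewrite C12 C00. Qed.
Let C00'' a : C (S a) O O = 0. Proof. by rewrite C01 C00'. Qed.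
Let C0' a b : C (S a) O (S b) = (a == b)%:R * (d * la). Proof. by rewrite C01 C0. Qed.
Let C0'' a b : C (S a) (S b) O = (a == b)%:R * (d * la). Proof. by rewrite C12 C0'. Qed.

Let CE := (C000, C00, C00', C00'', C0, C0', C0'', G0).

Let codazzi1 a : L (S a) = (1 - 2 * d) * la * G O O (S a).
Proof.
have := codazzi (S a) O O O; rewrite D000 D00 !big_ord_recl !CE.
rewrite (_ : \sum_(i < n) _ = - (2 * (d * la)) * G O O (S a)); last first.
  rewrite -(sum_delta a (fun c => G O O (S c))) mulr_sumr; apply: eq_bigr => c _.
  by rewrite !CE; ring.
rewrite big1 => [|c _]; last by rewrite CE mulr0.
by rewrite (Gas O (S a) O) => h; lra.
Qed.

(** This determines [G (S a) O (S b)], the second fundamental form of the hypersurfaces orthogonal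
    to e_1, up to a correction linear in [G O O]; once [G O O] vanishes they are umbilic. *)
Let codazzi2 a b : (1 - 2 * d) * la * G (S a) O (S b) =
  (a == b)%:R * (d * L O) - \sum_c G O O (S c) * C (S a) (S b) (S c).
Proof.
have := codazzi (S a) O O (S b); rewrite D00' D0' !big_ord_recl !CE.
rewrite [X in (_ + X) + (_ + _)](_ : _ = - (\sum_c G O O (S c) * C (S a) (S b) (S c)) -
    d * la * G O (S b) (S a) + d * la * G (S a) O (S b)); last first.
  rewrite -(sum_delta a (fun c => G O (S b) (S c))) -(sum_delta b (fun c => G (S a) O (S c))).
  rewrite !mulr_sumr -!sumrN -!big_split; apply: eq_bigr => c _.
  by rewrite !CE /=; ring.
rewrite [X in (_ + _) + (_ + X)](_ : _ = d * la * (G (S a) O (S b) - G O (S a) (S b))); last first.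
  rewrite -(sum_delta b (fun c => G (S a) O (S c) - G O (S a) (S c))) mulr_sumr.
  by apply: eq_bigr => c _; rewrite CE eq_sym; ring.
rewrite (Gas (S a) (S b) O) (Gas O (S b) (S a)) => h.
by move: h; move: (\sum_c _) => X h; lra.
Qed.

(** The Codazzi equations with indices (a, b, 0, b), summed over b. The terms containing the trace
    of [C] over b drop out by [Ctr]. *)
Let codazzi3 a : d * (n%:R - 1) * L (S a) =
  - \sum_b \sum_e G (S b) O (S e) * C (S a) (S b) (S e).
Proof.
have E b : d * L (S a) - (a == b)%:R * (d * L (S b)) =
    \sum_e (G (S a) O (S e) * C (S b) (S b) (S e) - G (S b) O (S e) * C (S a) (S b) (S e)).
  have := codazzi (S a) (S b) O (S b); rewrite !D0' eqxx mul1r !big_ord_recl !CE.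
  rewrite [X in (_ + X) + (_ + _)](_ : _ = \sum_e (G (S a) O (S e) * C (S b) (S b) (S e) -
      G (S b) O (S e) * C (S a) (S b) (S e)) + d * la * (G (S a) (S b) (S b) - G (S b) (S b) (S a))); last first.
    rewrite mulrBr -(sum_delta b (fun c => G (S a) (S b) (S c))) -(sum_delta a (fun c => G (S b) (S b) (S c))).
    by rewrite !mulr_sumr -!sumrN -!big_split; apply: eq_bigr => c _; rewrite !CE /=; ring.
  rewrite [X in (_ + _) + (_ + X)](_ : _ = d * la * (G (S a) (S b) (S b) - G (S b) (S a) (S b))); last first.
    rewrite -(sum_delta b (fun c => G (S a) (S b) (S c) - G (S b) (S a) (S c))) mulr_sumr.
    by apply: eq_bigr => c _; rewrite CE eq_sym; ring.
  rewrite !G0 (Gas (S b) (S b) (S a)) => h.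
  by move: h; move: (\sum_e _) => X h; lra.
have : \sum_b (d * L (S a) - (a == b)%:R * (d * L (S b))) = d * (n%:R - 1) * L (S a).
  by rewrite sumrB sumr_const card_ord sum_delta -mulr_natl; ring.
move=> <-; rewrite (eq_bigr _ (fun b _ => E b)).
rewrite -sumrN.
transitivity (\sum_b ((\sum_e G (S a) O (S e) * C (S b) (S b) (S e)) -
   \sum_e G (S b) O (S e) * C (S a) (S b) (S e))).
  by apply: eq_bigr => b _; rewrite sumrB.
rewrite sumrB exchange_big /= big1 => [|e _]; last by rewrite -mulr_sumr Ctr mulr0.
by rewrite sub0r sumrN.
Qed.

(** The Codazzi equations with indices (a, 0, b, b), summed over b. [Dtr] removes the unknown
    derivatives of the cubic form, and the sum over the unknown [G O (S b) (S e)] vanishes because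
    this is skew in b and e while [C] is symmetric. *)
Let codazzi4 a : n%:R * L (S a) = (n%:R + 2) * la * G O O (S a).
Proof.
have E b : d * L (S a) - dC O (S a) (S b) (S b) =
    - (2 * \sum_e G O (S b) (S e) * C (S a) (S b) (S e)) + 2 * ((a == b)%:R * (d * la * G O O (S b)))
    + d * la * G O O (S a) + \sum_e (G (S a) O (S e) - G O (S a) (S e)) * C (S e) (S b) (S b).
  have := codazzi (S a) O (S b) (S b); rewrite !D0 eqxx mul1r !big_ord_recl !CE.
  rewrite [X in (_ + X) + (_ + _)](_ : _ = - (2 * \sum_e G O (S b) (S e) * C (S a) (S b) (S e)) +
      2 * (d * la * G (S a) (S b) (S b))); last first.
    rewrite -(sum_delta b (fun c => G (S a) (S b) (S c))).
    by rewrite !mulr_sumr -!sumrN -!big_split; apply: eq_bigr => c _; rewrite !CE /=; ring.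
  rewrite eqxx mul1r G0 (Gas O (S b) O) (Gas O (S a) O) => h.
  by move: h; move: (\sum_e _) (\sum_e _) => X Y; lra.
have DL : \sum_b (d * L (S a) - dC O (S a) (S b) (S b)) = d * (n%:R * L (S a)).
  by rewrite sumrB sumr_const card_ord Dtr subr0 -mulr_natl; ring.
pose X := \sum_b \sum_e G O (S b) (S e) * C (S a) (S b) (S e).
have X0 : X = 0.
  suff : X = - X by lra.
  rewrite {1}/X exchange_big /= /X -sumrN; apply: eq_bigr => b _; rewrite -sumrN.
  by apply: eq_bigr => e _; rewrite (Gas O (S e)) (C12 (S a)) mulNr.
have Y0 : \sum_b \sum_e (G (S a) O (S e) - G O (S a) (S e)) * C (S e) (S b) (S b) = 0.
  rewrite exchange_big /= big1 // => e _; rewrite -mulr_sumr -[RHS](mulr0 (G (S a) O (S e) - G O (S a) (S e))).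
  by congr (_ * _); rewrite -[RHS](Ctr e); apply: eq_bigr => b _; rewrite C01 C12.
move: DL; rewrite (eq_bigr _ (fun b _ => E b)) !big_split /= Y0 addr0 sumrN -!mulr_sumr.
rewrite -/X X0 mulr0 oppr0 add0r sum_delta sumr_const card_ord -mulr_natl => h.
by apply: (mulfI d0); rewrite -h; ring.
Qed.

(** Inserting [codazzi1] and [codazzi2] into [codazzi3] shows that the vector [G O O] is, up to the
    displayed factor, obtained from itself by contracting twice with [C]. Pairing this identity with
    [G O O] makes the right side a sum of squares; the term with [L O] is a trace and disappears. *)
Let sqr_ge0 : d * (n%:R - 1) * ((1 - 2 * d) * la) ^+ 2 * \sum_a G O O (S a) ^+ 2 =
  \sum_b \sum_e (\sum_c G O O (S c) * C (S b) (S e) (S c)) ^+ 2.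
Proof.
have E a : d * (n%:R - 1) * ((1 - 2 * d) * la) ^+ 2 * G O O (S a) =
    \sum_b \sum_e (\sum_c G O O (S c) * C (S b) (S e) (S c)) * C (S a) (S b) (S e).
  transitivity ((1 - 2 * d) * la * (d * (n%:R - 1) * L (S a))).
    by rewrite codazzi1; ring.
  rewrite codazzi3 mulrN mulr_sumr -sumrN.
  transitivity (\sum_b ((\sum_e (\sum_c G O O (S c) * C (S b) (S e) (S c)) * C (S a) (S b) (S e)) -
      d * L O * C (S b) (S b) (S a))).
    apply: eq_bigr => b _; rewrite mulr_sumr -sumrN.
    rewrite (_ : d * L O * C (S b) (S b) (S a) = \sum_e (b == e)%:R * (d * L O * C (S a) (S b) (S e))); last first.
      by rewrite sum_delta C12 C01.
    rewrite -sumrB; apply: eq_bigr => e _.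
    transitivity (- ((1 - 2 * d) * la * G (S b) O (S e) * C (S a) (S b) (S e))); first by ring.
    by rewrite codazzi2; move: (\sum_c _) => X; ring.
  by rewrite sumrB -mulr_sumr Ctr mulr0 subr0.
rewrite mulr_sumr.
transitivity (\sum_a \sum_b \sum_e (\sum_c G O O (S c) * C (S b) (S e) (S c)) *
    (G O O (S a) * C (S b) (S e) (S a))).
  apply: eq_bigr => a _.
  transitivity (d * (n%:R - 1) * ((1 - 2 * d) * la) ^+ 2 * G O O (S a) * G O O (S a)).
    by ring.
  rewrite E mulr_suml; apply: eq_bigr => b _.
  rewrite mulr_suml; apply: eq_bigr => e _.
  by rewrite (C01 (S a)) (C12 (S b) (S a)); move: (\sum_c _) => X; ring.
rewrite exchange_big; apply: eq_bigr => b _ /=.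
rewrite exchange_big; apply: eq_bigr => e _ /=.
by rewrite -mulr_sumr expr2.
Qed.

(* If some Gamma_00a is nonzero, codazzi1 and the traced equation codazzi4 give
   n d = -1; but a positive multiple of d |Gamma_00|^2 is a sum of squares. *)
Lemma codazzi_conn00 a : G O O (S a) = 0.
Proof.
have [//|Ga] := eqVneq (G O O (S a)) 0.
have dn : n%:R * d = -1.
  have := codazzi4 a; rewrite codazzi1 => h.
  have : (la * G O O (S a)) * (n%:R * (1 - 2 * d)) = (la * G O O (S a)) * (n%:R + 2).
    by move: h; lra.
  by move/(mulfI (mulf_neq0 la0 Ga)); lra.
have n0 : 0 < n%:R - 1 :> R by rewrite subr_gt0 ltr1n.
have dlt0 : d < 0.
  rewrite ltNge; apply/negP => dge; have := mulr_ge0 (ler0n R n) dge; rewrite dn; lra.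
have : 0 <= d * (n%:R - 1) * ((1 - 2 * d) * la) ^+ 2 * \sum_a G O O (S a) ^+ 2.
  by rewrite sqr_ge0; apply: sumr_ge0 => b _; apply: sumr_ge0 => e _; exact: exprn_even_ge0.
have s0 : 0 < \sum_a G O O (S a) ^+ 2.
  rewrite (bigD1 a) //=; apply: ltr_pwDl; first by rewrite exprn_even_gt0.
  by apply: sumr_ge0 => b _; exact: exprn_even_ge0.
have k0 : 0 < ((1 - 2 * d) * la) ^+ 2.
  rewrite exprn_even_gt0 //= mulf_neq0 //; apply: contra d2 => /eqP h.
  by apply/eqP; lra.
rewrite pmulr_lge0 // pmulr_lge0 // pmulr_lge0 //; lra.
Qed.

Lemma codazzi_derive a : L (S a) = 0.
Proof. by rewrite codazzi1 codazzi_conn00 mulr0. Qed.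

Lemma codazzi_conn a b : G (S a) O (S b) = (a == b)%:R * (d / ((1 - 2 * d) * la) * L O).
Proof.
have h : (1 - 2 * d) * la != 0.
  by rewrite mulf_neq0 //; apply: contra d2 => /eqP h; apply/eqP; lra.
apply: (mulfI h); rewrite codazzi2 big1 ?subr0; last by move=> c _; rewrite codazzi_conn00 mul0r.
rewrite mulf_eq0 negb_or in h; case/andP: h => h1 h2.
by field; rewrite h1 h2.
Qed.

End CodazziAlgebra.

Section ReIm.
Context {R : realType}.

Lemma cRe_nat (k : nat) : complex.Re (k%:R : R[i]) = k%:R.
Proof. by rewrite -[k%:R]/(1 *+ k) (raddfMn (@complex.Re R)). Qed.

Lemma cIm_nat (k : nat) : complex.Im (k%:R : R[i]) = 0.
Proof. by rewrite -[k%:R]/(1 *+ k) (raddfMn (@complex.Im R)) /= mul0rn. Qed.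

Lemma cRe_sum (I : Type) (s : seq I) (P : pred I) (F : I -> R[i]) :
  complex.Re (\sum_(i <- s | P i) F i) = \sum_(i <- s | P i) complex.Re (F i).
Proof. exact: (raddf_sum (@complex.Re R)). Qed.

Lemma cIm_sum (I : Type) (s : seq I) (P : pred I) (F : I -> R[i]) :
  complex.Im (\sum_(i <- s | P i) F i) = \sum_(i <- s | P i) complex.Im (F i).
Proof. exact: (raddf_sum (@complex.Im R)). Qed.

End ReIm.

Definition fmu (R : realType) (k : nat) (d : R) (la : 'rV[R]_k -> R)
    (X : 'rV[R]_k -> 'rV[R]_k) (x : 'rV[R]_k) : R :=
  d / ((1 - 2 * d) * la x) * 'D_(X x) la x.

(** * Derivatives of lambda, mu and the moving frame in the normal form *)

Section LagrangianFrame.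
Context {R : realType} (n : nat) (U : set 'rV[R]_n.+1).
Context (z : 'rV[R]_n.+1 -> 'rV[R[i]]_n.+2) (E : 'I_n.+1 -> 'rV[R]_n.+1 -> 'rV[R]_n.+1).
Variables (d : R) (la : 'rV[R]_n.+1 -> R).
Local Notation S := (lift (@ord0 n)).
Local Notation fvec := (fvec z E).
Local Notation fcov := (fcov z E).
Local Notation conn := (conn z E).
Local Notation cubic := (cubic z E).

Definition normal_form : Prop := forall x, U x ->
  [/\ la x != 0, cubic ord0 ord0 ord0 x = la x,
   forall a, cubic ord0 ord0 (S a) x = 0,
   forall a b, cubic ord0 (S a) (S b) x = (a == b)%:R * (d * la x) &
   forall c, \sum_a cubic (S a) (S a) (S c) x = 0].

Hypotheses (n2 : (1 < n)%N) (d0 : d != 0) (d2 : d != 2^-1).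
Hypotheses (H : legendrian_frame U z E) (NF : normal_form).

Let oU : open U. Proof. by case: H. Qed.
Let Cz : csmooth_on U z. Proof. by case: H. Qed.
Let CE a : smooth_on U (E a). Proof. by case: H. Qed.

Lemma derive_ext (f g : 'rV[R]_n.+1 -> R) x v : U x -> (forall y, U y -> f y = g y) ->
  'D_v f x = 'D_v g x.
Proof.
move=> Ux fg; apply: near_eq_derive.
by have := open_nbhs_nbhs (conj oU Ux); apply: filterS.
Qed.

Lemma smooth_la : smooth_on U la.
Proof. by apply: smooth_ext (smooth_cubic H ord0 ord0 ord0) => // x /NF[]. Qed.

Local Notation mu := (fmu d la (E ord0)).

Let dd0 : 1 - 2 * d != 0.
Proof. by apply: contra d2 => /eqP h; apply/eqP; lra. Qed.

Lemma smooth_mu : smooth_on U mu.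
Proof.
apply: smoothM => //; last exact: smooth_derive_along smooth_la (CE _).
apply: smoothM => //; first exact: smooth_cst.
apply: smoothV => //; first by move=> x /NF[l0 _ _ _ _]; rewrite mulf_neq0.
by apply: smoothM => //; [exact: smooth_cst|exact: smooth_la].
Qed.

Let cub (i j l : 'I_n.+1) x : U x -> cubic i j l x = cubic j i l x /\ cubic i j l x = cubic i l j x.
Proof. by move=> Ux; split; [apply: (cubic_symm H)|apply: (conn_cubic_sym H _ _ _ _).2]. Qed.

Let codazzi x (Ux : U x) i j l p :
  'D_(E i x) (cubic j l p) x - 'D_(E j x) (cubic i l p) x =
  \sum_m (cubic j l m x * conn i p m x - conn j l m x * cubic i p m x -
          (cubic i l m x * conn j p m x - conn i l m x * cubic j p m x)) +
  \sum_m (conn i j m x - conn j i m x) * cubic m l p x.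
Proof.
have /(congr1 (@complex.Im R)) /= := structure_eq H i j l p Ux.
move=> ->; rewrite !cImD !cIm_sum cImN !cImM !cRe_nat !cIm_nat.
rewrite !mul0r !mulr0 addr0 subr0 add0r.
by congr (_ + _); apply: eq_bigr => m _ /=; ring.
Qed.

Let gauss x (Ux : U x) i j l p :
  'D_(E i x) (conn j l p) x - 'D_(E j x) (conn i l p) x =
  ((j == l)%:R * (i == p)%:R - (i == l)%:R * (j == p)%:R) +
  \sum_m (conn j l m x * conn i p m x + cubic j l m x * cubic i p m x -
          (conn i l m x * conn j p m x + cubic i l m x * cubic j p m x)) +
  \sum_m (conn i j m x - conn j i m x) * conn m l p x.
Proof.
have /(congr1 (@complex.Re R)) /= := structure_eq H i j l p Ux.
move=> ->; rewrite !cReD !cRe_sum cReN !cReM !cRe_nat !cIm_nat.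
rewrite !mulr0 !subr0.
by congr (_ + _ + _); apply: eq_bigr => m _ /=; ring.
Qed.

Let nf x : U x -> [/\ la x != 0, cubic ord0 ord0 ord0 x = la x,
   forall a, cubic ord0 ord0 (S a) x = 0,
   forall a b, cubic ord0 (S a) (S b) x = (a == b)%:R * (d * la x) &
   forall c, \sum_a cubic (S a) (S a) (S c) x = 0].
Proof. exact: NF. Qed.

Let Cla := smooth_la.

Let dcub x (Ux : U x) i j l p (f : 'rV[R]_n.+1 -> R) :
  (forall y, U y -> cubic j l p y = f y) -> 'D_(E i x) (cubic j l p) x = 'D_(E i x) f x.
Proof. by move=> cf; exact: derive_ext. Qed.

Let dZ x (Ux : U x) v (c : R) : 'D_v (fun y => c * (d * la y)) x = c * (d * 'D_v la x).
Proof.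
have dl : derivable la x v := smooth_derivable Cla Ux.
have -> : (fun y => c * (d * la y)) = (c * d) *: la by apply/funext => y /=; rewrite mulrA.
by rewrite deriveZ // -[_ *: _]/(_ * _) mulrA.
Qed.

(** The pointwise algebra applies with [dC] the frame derivatives of [cubic]; its hypotheses on [dC]
    arise by differentiating the identities of the normal form, which hold on all of [U]. *)
Let summary x : U x ->
  [/\ forall a, conn ord0 ord0 (S a) x = 0, forall a, 'D_(E (S a) x) la x = 0 &
      forall a b, conn (S a) ord0 (S b) x = (a == b)%:R * mu x].
Proof.
move=> Ux; have [l0 c000 c00 c0 ctr] := nf Ux.
pose dC i j l p := 'D_(E i x) (cubic j l p) x.
have D000 i : dC i ord0 ord0 ord0 = 'D_(E i x) la x by apply: dcub => // y /nf[].
have D00 i a : dC i (S a) ord0 ord0 = 0.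
  rewrite -(derive_cst (0 : R) x (E i x)); apply: dcub => // y Uy; have [_ _ h _ _] := nf Uy.
  by rewrite (cub _ _ _ Uy).1 (cub _ _ _ Uy).2 h.
have D00' i a : dC i ord0 ord0 (S a) = 0.
  by rewrite -(derive_cst (0 : R) x (E i x)); apply: dcub => // y Uy; have [_ _ h _ _] := nf Uy.
have D0 i a b : dC i ord0 (S a) (S b) = (a == b)%:R * (d * 'D_(E i x) la x).
  by rewrite -dZ //; apply: dcub => // y Uy; have [_ _ _ h _] := nf Uy.
have D0' i a b : dC i (S a) ord0 (S b) = (a == b)%:R * (d * 'D_(E i x) la x).
  by rewrite -dZ //; apply: dcub => // y Uy; have [_ _ _ h _] := nf Uy; rewrite (cub _ _ _ Uy).1 h.
have Dtr i a : \sum_b dC i (S a) (S b) (S b) = 0.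
  transitivity ('D_(E i x) (cst (0 : R)) x); last exact: derive_cst.
  have dcb b : derivable (cubic (S a) (S b) (S b)) x (E i x).
    exact: smooth_derivable (smooth_cubic H _ _ _) Ux.
  apply: (etrans (esym (derive_sum dcb))).
  apply: derive_ext => // y Uy; have [_ _ _ _ h] := nf Uy.
  rewrite fct_sumE -[RHS](h a); apply: eq_bigr => b _.
  by rewrite (cub _ _ _ Uy).1 (cub _ _ _ Uy).2.
have Gas i j l : conn i j l x = - conn i l j x := (conn_cubic_sym H i j l Ux).1.
have c01 i j l := (cub i j l Ux).1; have c12 i j l := (cub i j l Ux).2.
split=> [a|a|a b].
- exact: (codazzi_conn00 n2 d0 d2 l0 Gas (codazzi Ux) c01 c12 c000 c00 c0 ctr D000 D00 D00' D0 D0' Dtr).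
- exact: (codazzi_derive n2 d0 d2 l0 Gas (codazzi Ux) c01 c12 c000 c00 c0 ctr D000 D00 D00' D0 D0' Dtr).
- exact: (codazzi_conn n2 d0 d2 l0 Gas (codazzi Ux) c01 c12 c000 c00 c0 ctr D000 D00 D00' D0 D0' Dtr).
Qed.

Lemma derive_la0 x : U x -> 'D_(E ord0 x) la x = (1 - 2 * d) / d * la x * mu x.
Proof.
move=> Ux; have [l0 _ _ _ _] := nf Ux; rewrite /fmu; move: ('D_ _ la x) => D.
by field; rewrite l0 dd0 d0.
Qed.

Lemma derive_laS x a : U x -> 'D_(E (S a) x) la x = 0.
Proof. by move=> /summary[]. Qed.

(** As e_a(lambda) = 0, the derivative of e_1(lambda) along e_a equals [e_a, e_1] lambda. The
    bracket has no e_1-component because [conn ord0 ord0 (S a)] vanishes, and its other components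
    kill lambda. Since mu lambda is a constant multiple of e_1(lambda), mu is constant along e_a
    too. *)
Lemma derive_muS x a : U x -> 'D_(E (S a) x) mu x = 0.
Proof.
move=> Ux; have [l0 _ _ _ _] := nf Ux.
have [G00 La G0] := summary Ux.
have DD : 'D_(E (S a) x) (fun y => 'D_(E ord0 y) la y) x = 0.
  have := derive_fbracket H (S a) ord0 Ux Cla.
  rewrite (derive_ext (g := cst 0) _ Ux (fun y Uy => derive_laS a Uy)) derive_cst subr0 => ->.
  rewrite big_ord_recl [X in _ + X]big1 => [|b _]; last by rewrite La mulr0.
  rewrite (conn_cubic_sym H ord0 (S a) ord0 Ux).1 G00 oppr0 subr0.
  have := (conn_cubic_sym H (S a) ord0 ord0 Ux).1; move: (conn _ _ _ _) => g gg.
  by rewrite (_ : g = 0) ?mul0r ?addr0 //; lra.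
pose g2 y := 'D_(E ord0 y) la y.
have C2 : smooth_on U g2 by exact: smooth_derive_along.
have dg2 := smooth_derivable (v := E (S a) x) C2 Ux.
have E1 : 'D_(E (S a) x) (mu * la) x = 'D_(E (S a) x) (d / (1 - 2 * d) \*: g2) x.
  apply: derive_ext => // y Uy; have [l0' _ _ _ _] := nf Uy.
  change (d / ((1 - 2 * d) * la y) * g2 y * la y = d / (1 - 2 * d) * g2 y).
  by move: (g2 y) => D; field; rewrite dd0 l0'.
move: E1; rewrite (deriveMR (smooth_derivable smooth_mu Ux) (smooth_derivable Cla Ux)).
rewrite (deriveZ _ dg2) DD La mulr0 add0r scaler0 => /eqP.
by rewrite mulf_eq0 (negbTE l0) => /eqP.
Qed.

Lemma derive_mu0 x : U x ->
  'D_(E ord0 x) mu x = - 1 - mu x ^+ 2 - d * (1 - d) * la x ^+ 2.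
Proof.
move=> Ux; have [l0 c000 c00 c0 ctr] := nf Ux.
have [G00 La G0] := summary Ux.
(* Any single direction orthogonal to e_1 will do: the Gauss equation for the plane spanned by e_1
   and e_a is the equation for mu. *)
have a : 'I_n := Ordinal (ltnW n2).
have h := gauss Ux ord0 (S a) ord0 (S a).
rewrite (derive_ext (g := mu) _ Ux) in h; last first.
  by move=> y Uy; have [_ _ hG] := summary Uy; rewrite hG eqxx mul1r.
rewrite (derive_ext (f := conn ord0 ord0 (S a)) (g := cst 0) _ Ux) in h; last first.
  by move=> y Uy; have [hG _ _] := summary Uy; rewrite hG.
have Gas i j l : conn i j l x = - conn i l j x := (conn_cubic_sym H i j l Ux).1.
have Gjj i j : conn i j j x = 0 by have := Gas i j j; lra.
have c01 i j l := (cub i j l Ux).1; have c12 i j l := (cub i j l Ux).2.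
rewrite derive_cst !eqxx eq_sym (negbTE (neq_lift _ _)) !big_ord_recl !Gjj G00 in h.
have ca00 : cubic (S a) ord0 ord0 x = 0 by rewrite c01 c12 c00.
have caa0 : cubic (S a) (S a) ord0 x = d * la x by rewrite c12 c01 c0 eqxx mul1r.
rewrite ca00 caa0 c000 in h.
have S1 : \sum_(i < n) (conn (S a) ord0 (S i) x * conn ord0 (S a) (S i) x +
       cubic (S a) ord0 (S i) x * cubic ord0 (S a) (S i) x -
       (conn ord0 ord0 (S i) x * conn (S a) (S a) (S i) x +
        cubic ord0 ord0 (S i) x * cubic (S a) (S a) (S i) x)) = (d * la x) ^+ 2.
  transitivity (\sum_i (a == i)%:R * (mu x * conn ord0 (S a) (S i) x + (a == i)%:R * (d * la x) ^+ 2)).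
    apply: eq_bigr => i _; rewrite G0 (c01 (S a)) !c0 G00 c00.
    by case: (a == i) => /=; ring.
  by rewrite sum_delta Gjj eqxx /=; ring.
have S2 : \sum_(i < n) (conn ord0 (S a) (S i) x - conn (S a) ord0 (S i) x) *
    conn (S i) ord0 (S a) x = - mu x ^+ 2.
  transitivity (\sum_i (a == i)%:R * ((conn ord0 (S a) (S i) x - (a == i)%:R * mu x) * mu x)).
    by apply: eq_bigr => i _; rewrite !G0 (eq_sym i) ; case: (a == i) => /=; ring.
  by rewrite sum_delta Gjj eqxx /=; ring.
rewrite S1 S2 /= in h; move: h; move: ('D_ _ mu x) => D h.
by rewrite -[D]subr0 h; ring.
Qed.

Lemma fcov00 x : U x -> fcov ord0 ord0 x = - z x + (0 +i* la x) *: fvec ord0 x.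
Proof.
move=> Ux; have [l0 c000 c00 c0 ctr] := nf Ux; have [G00 La G0] := summary Ux.
have G000 : conn ord0 ord0 ord0 x = 0.
  by have := (conn_cubic_sym H ord0 ord0 ord0 Ux).1; lra.
rewrite (fcov_expand H _ _ Ux) eqxx scaleN1r big_ord_recl G000 c000 big1 ?addr0 // => a _.
by rewrite G00 c00 scale0r.
Qed.

Lemma fcovS0 a x : U x -> fcov (S a) ord0 x = (mu x +i* (d * la x)) *: fvec (S a) x.
Proof.
move=> Ux; have [l0 c000 c00 c0 ctr] := nf Ux; have [G00 La G0] := summary Ux.
have Ga00 : conn (S a) ord0 ord0 x = 0.
  by have := (conn_cubic_sym H (S a) ord0 ord0 Ux).1; lra.
have ca00 : cubic (S a) ord0 ord0 x = 0.
  by rewrite (cub _ _ _ Ux).1 (cub _ _ _ Ux).2 c00.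
rewrite (fcov_expand H _ _ Ux) eq_sym (negbTE (neq_lift _ _)) oppr0 scale0r add0r.
rewrite big_ord_recl Ga00 ca00 scale0r add0r (bigD1 a) //= big1 => [|b ba].
  by rewrite addr0 G0 (cub _ _ _ Ux).1 c0 eqxx !mul1r.
by rewrite G0 (cub _ _ _ Ux).1 c0 eq_sym (negbTE ba) !mul0r scale0r.
Qed.

(** The components along [z] and [fvec ord0] combine into z + conj(kappa) w_0, the vector of which
    [leg] is a multiple; this is why the second derivatives of [leg] stay in the span of [leg] and
    its first derivatives. *)
Lemma fcovSS a b x : U x -> fcov (S a) (S b) x =
  - ((a == b)%:R *: (z x + (mu x -i* (d * la x)) *: fvec ord0 x))
  + \sum_c (conn (S a) (S b) (S c) x +i* cubic (S a) (S b) (S c) x) *: fvec (S c) x.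
Proof.
move=> Ux; have [l0 c000 c00 c0 ctr] := nf Ux; have [G00 La G0] := summary Ux.
rewrite (fcov_expand H _ _ Ux) big_ord_recl addrA; congr (_ + _).
rewrite (conn_cubic_sym H (S a) (S b) ord0 Ux).1 G0 (cub _ _ _ Ux).2 (cub _ _ _ Ux).1 c0.
rewrite (inj_eq lift_inj); case: (a == b); last first.
  rewrite !mulr0n !mul0r !oppr0 -[0 +i* 0]/(0 : R[i]) !scale0r addr0.
  by rewrite oppr0.
rewrite !mulr1n !mul1r !scale1r scaleN1r opprD; congr (_ + _).
rewrite -[RHS]scaleNr; congr (_ *: _).
by apply: complex_eq => //=; rewrite opprK.
Qed.

(** This symmetry is the closedness of the one-form dual to [E ord0]. *)
Lemma conn_ord0_sym i j x : U x -> conn i ord0 j x = conn j ord0 i x.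
Proof.
move=> Ux; have [G00 _ G0] := summary Ux.
have Gi0 l : conn l ord0 ord0 x = 0 by have := (conn_cubic_sym H l ord0 ord0 Ux).1; lra.
case: (unliftP ord0 i) => [a ->|->]; case: (unliftP ord0 j) => [b ->|->]; rewrite ?Gi0 ?G00 //.
by rewrite !G0 eq_sym; case: eqVneq => // ->.
Qed.

End LagrangianFrame.

(** * The splitting of the horizontal lift *)

(* The hypothesis says that the 1-form rho Re <dz, A> is closed. *)
Lemma form_primitive {R : realType} (k m : nat) (x0 : 'rV[R]_k) (r : R)
    (z A : 'rV[R]_k -> 'rV[R[i]]_m) (rho : 'rV[R]_k -> R) : 0 < r ->
  let U := ball x0 r in
  csmooth_on U z -> csmooth_on U A -> smooth_on U rho ->
  (forall x u v, U x ->
    'D_u rho x * complex.Re (herm (cderive z x v) (A x)) +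
      rho x * complex.Re (herm (cderive z x v) (cderive A x u)) =
    'D_v rho x * complex.Re (herm (cderive z x u) (A x)) +
      rho x * complex.Re (herm (cderive z x u) (cderive A x v))) ->
  exists g : 'rV[R]_k -> R, smooth_on U g /\
    forall x v, U x -> 'D_v g x = rho x * complex.Re (herm (cderive z x v) (A x)).
Proof.
move=> r0 U Cz CA Cr sym.
have oU : open U by exact: ball_open.
have Cdz (v : 'rV[R]_k) : csmooth_on U (fun x => cderive z x v).
  by apply: csmooth_cderive => //; exact: smooth_cst.
pose h j x := complex.Re (herm (cderive z x (delta_mx 0 j)) (A x)).
have Ch j : smooth_on U (h j) by exact: (csm_herm oU (Cdz _) CA).1.
pose w j x := rho x * h j x.
have Cw j : smooth_on U (w j) by exact: smoothM.
have sym2 x (u v : 'rV[R]_k) : U x -> cderive (fun y => cderive z y v) x u = cderive (fun y => cderive z y u) x v.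
  move=> Ux; apply/eqP; rewrite -subr_eq0; apply/eqP.
  have := cderive_bracket oU Ux Cz (smooth_cst U u) (smooth_cst U v).
  by rewrite /= => ->; rewrite !derive_cst subrr cderive0.
have Dw x i j : U x -> 'D_(delta_mx 0 j) (w i) x = 'D_(delta_mx 0 j) rho x * h i x +
   rho x * (complex.Re (herm (cderive (fun y => cderive z y (delta_mx 0 i)) x (delta_mx 0 j)) (A x)) +
            complex.Re (herm (cderive z x (delta_mx 0 i)) (cderive A x (delta_mx 0 j)))).
  move=> Ux; rewrite /w.
  rewrite (deriveMR (smooth_derivable Cr Ux) (smooth_derivable (Ch i) Ux)) addrC mulrC; congr (_ + _ * _).
  by rewrite -cReD -(cdr_herm oU _ (Cdz _) CA Ux).
have dw x : U x -> forall i j, 'D_(delta_mx 0 j) (w i) x = 'D_(delta_mx 0 i) (w j) x.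
  move=> Ux i j; rewrite (Dw x i j Ux) (Dw x j i Ux) (sym2 x _ _ Ux).
  have := sym x (delta_mx 0 j) (delta_mx 0 i) Ux; rewrite /h.
  by rewrite !mulrDr => hs; apply: etrans (addrCA _ _ _) _; rewrite hs; exact: addrCA.
have [g [Cg Dg]] := poincare r0 Cw dw.
exists g; split=> // x v Ux; rewrite Dg // {2}(row_sum_delta v) (cderive_sum Cz) // herm_suml cRe_sum.
rewrite mulr_sumr; apply: eq_bigr => i _.
by rewrite hermZl cReM /= mul0r subr0 mulrCA.
Qed.

Section Expi.
Context {R : realType}.
Implicit Types a b : R.

Lemma expiD a b : expi (a + b) = expi a * expi b.
Proof. by apply: complex_eq; rewrite /= ?cosD ?sinD; ring. Qed.

Lemma expi0 : expi (0 : R) = 1.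
Proof. by rewrite /expi cos0 sin0. Qed.

Lemma expiN a : expi (- a) * expi a = 1.
Proof. by rewrite -expiD addNr expi0. Qed.

Lemma expi_conj a : conjc (expi a) = expi (- a).
Proof. by rewrite /expi cosN sinN. Qed.

Context (k : nat) (U : set 'rV[R]_k).
Hypothesis oU : open U.

Lemma csm_expi (g : 'rV[R]_k -> R) : smooth_on U g -> csm U (fun x => expi (g x)).
Proof. by move=> Cg; split=> r; have [] := Ck_trig oU (Cg r). Qed.

Lemma cdr_expi (g : 'rV[R]_k -> R) x v : smooth_on U g -> U x ->
  cdr (fun y => expi (g y)) x v = (0 +i* 'D_v g x) * expi (g x).
Proof.
move=> Cg Ux; have dg := smooth_diff Cg Ux.
apply: complex_eq; rewrite ?Re_cdr ?Im_cdr /=.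
  by apply: etrans (chain1 v (is_derive_cos _) dg).2 _; ring.
by apply: etrans (chain1 v (is_derive_sin _) dg).2 _; ring.
Qed.

End Expi.

Section Splitting.
Context {R : realType} (n : nat) (x0 : 'rV[R]_n.+1) (r : R).
Local Notation U := (ball x0 r).
Context (z : 'rV[R]_n.+1 -> 'rV[R[i]]_n.+2) (E : 'I_n.+1 -> 'rV[R]_n.+1 -> 'rV[R]_n.+1).
Variables (d : R) (la : 'rV[R]_n.+1 -> R).
Local Notation S := (lift (@ord0 n)).
Local Notation fvec := (fvec z E).
Local Notation fcov := (fcov z E).
Local Notation conn := (conn z E).
Local Notation cubic := (cubic z E).
Local Notation mu := (fmu d la (E ord0)).

Hypotheses (r0 : 0 < r) (n2 : (1 < n)%N) (d0 : d != 0) (d2 : d != 2^-1).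
Hypotheses (H : legendrian_frame U z E) (NF : normal_form U z E d la).

Let oU : open U. Proof. by case: H. Qed.
Let Cz : csmooth_on U z. Proof. by case: H. Qed.
Let CE a : smooth_on U (E a). Proof. by case: H. Qed.
Let Cw := csmooth_fvec H.
Let Cla : smooth_on U la := smooth_la H NF.
Let Cmu : smooth_on U mu := smooth_mu d2 H NF.
Let zz x : U x -> herm (z x) (z x) = 1. Proof. by case: H => _ _ _ h /h[]. Qed.
Let wz a x : U x -> herm (fvec a x) (z x) = 0. Proof. by case: H => _ _ _ h /h[]. Qed.
Let ww a b x : U x -> herm (fvec a x) (fvec b x) = (a == b)%:R.
Proof. by case: H => _ _ _ h /h[]. Qed.
Let zw a x : U x -> herm (z x) (fvec a x) = 0.
Proof. by move=> Ux; rewrite -herm_conj wz // rmorph0. Qed.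

(** The one-form dual to [E ord0]: by [frame_decomp] it is the first coordinate of [v] in the
    frame. *)
Definition coframe0 x v : R := complex.Re (herm (cderive z x v) (fvec ord0 x)).
Local Notation beta := coframe0.

Lemma coframe0_frame x a : U x -> beta x (E a x) = (a == ord0)%:R.
Proof. by move=> Ux; rewrite /beta -fvecE ww // cRe_nat. Qed.

Lemma derive_of_frame (V : normedModType R) (f : 'rV[R]_n.+1 -> V) x v : U x ->
  differentiable f x -> (forall a, 'D_(E (S a) x) f x = 0) ->
  'D_v f x = beta x v *: 'D_(E ord0 x) f x.
Proof.
move=> Ux df f0; have h a : 'd f x (E (S a) x) = 0 by rewrite -deriveE.
rewrite [in LHS](frame_decomp H v Ux) !deriveE // linear_sum big_ord_recl.
rewrite big1 ?addr0 => [|a _]; first by rewrite linearZ.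
by rewrite linearZ /= h scaler0.
Qed.

Lemma cderive_of_frame p q (F : 'rV[R]_n.+1 -> 'M[R[i]]_(p, q)) x v : U x -> csmooth_on U F ->
  cderive F x v =
  \sum_a (complex.Re (herm (cderive z x v) (fvec a x)))%:C *: cderive F x (E a x).
Proof. by move=> Ux CF; rewrite [in LHS](frame_decomp H v Ux) (cderive_sum CF). Qed.

Let sym x u v : U x -> complex.Re (herm (cderive z x v) (cderive (fvec ord0) x u)) =
  complex.Re (herm (cderive z x u) (cderive (fvec ord0) x v)).
Proof.
move=> Ux.
have HE u' v' : complex.Re (herm (cderive z x v') (cderive (fvec ord0) x u')) =
  \sum_a \sum_b complex.Re (herm (cderive z x u') (fvec a x)) *
     (complex.Re (herm (cderive z x v') (fvec b x)) * conn a ord0 b x).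
  rewrite (cderive_of_frame u' Ux (Cw ord0)) herm_sumr cRe_sum; apply: eq_bigr => a _.
  rewrite hermZr cReM /= oppr0 mul0r subr0 -mulr_sumr; congr (_ * _).
  rewrite [in LHS](cderive_of_frame v' Ux Cz) herm_suml cRe_sum; apply: eq_bigr => b _.
  rewrite hermZl cReM /= mul0r subr0 -fcovE -fvecE; congr (_ * _).
  by rewrite -herm_conj herm_fcov.
rewrite !HE exchange_big; apply: eq_bigr => a _; apply: eq_bigr => b _.
by rewrite (conn_ord0_sym n2 d0 d2 H NF b a Ux) mulrCA.
Qed.

Lemma arclength : exists tau : 'rV[R]_n.+1 -> R, smooth_on U tau /\
  forall x v, U x -> 'D_v tau x = beta x v.
Proof.
have [|tau [Ct Dt]] := form_primitive r0 Cz (Cw ord0) (smooth_cst U (1 : R)).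
  by move=> x u v Ux; rewrite !derive_cst !mul0r !mul1r !add0r; exact: sym.
by exists tau; split=> // x v Ux; rewrite Dt // mul1r.
Qed.

(** [beta] is closed and d lambda is a multiple of [beta], so lambda beta is closed as well. *)
Lemma angle : exists theta : 'rV[R]_n.+1 -> R, smooth_on U theta /\
  forall x v, U x -> 'D_v theta x = la x * beta x v.
Proof.
apply: (form_primitive r0 Cz (Cw ord0) Cla) => x u v Ux.
have dla := smooth_diff Cla Ux.
have la0 a : 'D_(E (S a) x) la x = 0 by exact: (derive_laS n2 d0 d2 H NF).
rewrite (derive_of_frame u Ux dla la0) (derive_of_frame v Ux dla la0) sym //.
congr (_ + _); move: ('D_ _ la x) => D.
by change (beta x u * D * beta x v = beta x v * D * beta x u); ring.
Qed.

Variable theta : 'rV[R]_n.+1 -> R.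
Hypotheses (Cth : smooth_on U theta)
  (Dth : forall x v, U x -> 'D_v theta x = la x * beta x v).

Definition fradius (x : 'rV[R]_n.+1) : R := Num.sqrt (1 + mu x ^+ 2 + d ^+ 2 * la x ^+ 2).
Local Notation s := fradius.

Let pos x : 0 < 1 + mu x ^+ 2 + d ^+ 2 * la x ^+ 2.
Proof. by move: (mu x) (la x) => a b; nra. Qed.

Lemma fradius_gt0 x : 0 < s x. Proof. by rewrite sqrtr_gt0. Qed.

Lemma fradius_sqr x : s x ^+ 2 = 1 + mu x ^+ 2 + d ^+ 2 * la x ^+ 2.
Proof. by rewrite sqr_sqrtr // ltW. Qed.

Let Cpos : smooth_on U (fun x => 1 + mu x ^+ 2 + d ^+ 2 * la x ^+ 2).
Proof.
apply: (smoothD oU (smoothD oU (smooth_cst U (1 : R)) (smoothM oU Cmu Cmu))).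
exact: (smoothM oU (smooth_cst U (d ^+ 2)) (smoothM oU Cla Cla)).
Qed.

Lemma smooth_fradius : smooth_on U s.
Proof. by move=> q; apply: Ck_sqrt => //; exact: Cpos. Qed.

(** The equations for lambda and mu give (s^2)' = -2 mu s^2 along e_1, and nothing changes along the
    other frame vectors. Working with s^2 avoids differentiating the root. *)
Lemma derive_fradius x v : U x -> 'D_v s x = - mu x * s x * beta x v.
Proof.
move=> Ux.
have D2 : 'D_v (s * s) x = 'D_v (fun y => 1 + mu y ^+ 2 + d ^+ 2 * la y ^+ 2) x.
  by congr (derive _ x v); apply/funext => y; rewrite -fradius_sqr.
have ds := smooth_derivable (v := v) smooth_fradius Ux.
have dm := smooth_derivable (v := v) Cmu Ux; have dl := smooth_derivable (v := v) Cla Ux.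
have Dmu : 'D_v mu x = beta x v * (- 1 - mu x ^+ 2 - d * (1 - d) * la x ^+ 2).
  rewrite -(derive_mu0 n2 d0 d2 H NF Ux); apply: derive_of_frame => //.
    exact: smooth_diff Cmu Ux.
  by move=> a; exact: (derive_muS n2 d0 d2 H NF).
have Dla : 'D_v la x = beta x v * ((1 - 2 * d) / d * la x * mu x).
  rewrite -(derive_la0 d0 d2 NF Ux); apply: derive_of_frame => //.
    exact: smooth_diff Cla Ux.
  by move=> a; exact: (derive_laS n2 d0 d2 H NF).
have D3 : 'D_v (fun y => 1 + mu y ^+ 2 + d ^+ 2 * la y ^+ 2) x =
    2 * (mu x * 'D_v mu x) + d ^+ 2 * (2 * (la x * 'D_v la x)).
  have -> : (fun y => 1 + mu y ^+ 2 + d ^+ 2 * la y ^+ 2) = cst 1 + mu * mu + cst (d ^+ 2) * (la * la).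
    by apply/funext => y.
  have dc (c : R) : derivable (cst c : 'rV[R]_n.+1 -> R) x v by exact: derivable_cst.
  have dmm := derivableM dm dm; have dll := derivableM dl dl.
  have dd := derivableM (dc (d ^+ 2)) dll.
  rewrite (deriveD (derivableD (dc 1) dmm) dd) (deriveD (dc 1) dmm).
  rewrite (deriveMR (dc _) dll) (deriveMR dm dm) (deriveMR dl dl).
  by rewrite !derive_cst; move: ('D_v mu x) ('D_v la x) => a b /=; ring.
move: D2; rewrite (deriveMR ds ds) D3 Dmu Dla => D2.
have s0 : s x != 0 by rewrite gt_eqF // fradius_gt0.
have dE : d ^+ 2 * ((1 - 2 * d) / d) = d * (1 - 2 * d) by field.
apply: (mulfI s0); have := fradius_sqr x; move: D2; move: ('D_v s x) (beta x v) => D b.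
move=> D2 s2; rewrite (_ : s x * (- mu x * s x * b) = - mu x * b * s x ^+ 2); last by ring.
rewrite s2; move: D2.
rewrite (_ : d ^+ 2 * (2 * (la x * (b * ((1 - 2 * d) / d * la x * mu x)))) =
   2 * (d ^+ 2 * ((1 - 2 * d) / d)) * la x ^+ 2 * b * mu x); last by ring.
rewrite dE; move: (s x * D) => X h; lra.
Qed.

Let Dmu0 x : U x -> 'D_(E ord0 x) mu x = - 1 - mu x ^+ 2 - d * (1 - d) * la x ^+ 2.
Proof. exact: (derive_mu0 n2 d0 d2 H NF). Qed.
Let DmuS a x : U x -> 'D_(E (S a) x) mu x = 0.
Proof. exact: (derive_muS n2 d0 d2 H NF). Qed.
Let Dla0 x : U x -> 'D_(E ord0 x) la x = (1 - 2 * d) / d * la x * mu x.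
Proof. exact: (derive_la0 d0 d2 NF). Qed.
Let DlaS a x : U x -> 'D_(E (S a) x) la x = 0.
Proof. exact: (derive_laS n2 d0 d2 H NF). Qed.

(** An integrating factor: along e_1 it solves y' = (mu + i c lambda) y. The derivatives of [eta]
    and [zeta] along e_1 are (-mu + i d lambda) eta and (-mu + i (1-d) lambda) zeta, which is why
    [c] is taken to be -d and -(1-d). *)
Definition twist c (x : 'rV[R]_n.+1) : R[i] := expi (c * theta x) * ((s x)^-1)%:C.

Let Cth' c : smooth_on U (fun x => c * theta x).
Proof. exact: (smoothM oU (smooth_cst U c) Cth). Qed.

Let Csi : smooth_on U (fun x => (s x)^-1).
Proof. by apply: (smoothV oU) => [x _|]; [rewrite gt_eqF // fradius_gt0|exact: smooth_fradius]. Qed.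

Lemma csm_twist c : csm U (twist c).
Proof.
exact: (csmM oU (csm_expi oU (Cth' c)) (csm_real Csi)).
Qed.

Lemma cdr_twist c x v : U x ->
  cdr (twist c) x v = (mu x +i* (c * la x)) * (beta x v)%:C * twist c x.
Proof.
move=> Ux; have s0 : s x != 0 by rewrite gt_eqF // fradius_gt0.
have -> : cdr (twist c) x v = _ := cdrM v (csm_expi oU (Cth' c)) (csm_real Csi) Ux.
rewrite (cdr_expi _ (Cth' c) Ux) cdr_real.
have -> : 'D_v (fun y => (s y)^-1) x = mu x * beta x v * (s x)^-1.
  have ds := smooth_derivable (v := v) smooth_fradius Ux.
  apply: etrans (deriveV s0 ds) _; rewrite derive_fradius //.
  change (- (s x) ^- 2 * (- mu x * s x * beta x v) = mu x * beta x v * (s x)^-1).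
  by field.
have -> : 'D_v (fun y => c * theta y) x = c * (la x * beta x v).
  rewrite -Dth //; apply: etrans (deriveZ _ (smooth_derivable Cth Ux)) _.
  by [].
rewrite /twist; case: (expi _) => e1 e2; move: (s x)^-1 (beta x v) => t b.
by apply: complex_eq => /=; ring.
Qed.

Let kap (x : 'rV[R]_n.+1) : R[i] := mu x +i* (d * la x).
Let ckap (x : 'rV[R]_n.+1) : R[i] := mu x -i* (d * la x).

Let Ckap : csm U kap.
Proof. by split; [exact: Cmu|exact: (smoothM oU (smooth_cst U d) Cla)]. Qed.

Let Cckap : csm U ckap.
Proof. by split; [exact: Cmu|exact: (smoothN oU (smoothM oU (smooth_cst U d) Cla))]. Qed.

Let Ddla x v : U x -> 'D_v (fun y => d * la y) x = d * 'D_v la x.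
Proof. by move=> Ux; exact: (deriveZ _ (smooth_derivable Cla Ux)). Qed.

Let cdr_kap x v : U x -> cdr kap x v = 'D_v mu x +i* (d * 'D_v la x).
Proof. by move=> Ux; rewrite /cdr /= Ddla. Qed.

Let cdr_ckap x v : U x -> cdr ckap x v = 'D_v mu x -i* (d * 'D_v la x).
Proof.
move=> Ux; rewrite /cdr /=; congr (_ +i* _); rewrite -Ddla //.
have dd := smooth_derivable (v := v) (smoothM oU (smooth_cst U d) Cla) Ux.
exact: (deriveN dd).
Qed.

Let kapK x : ckap x * kap x = (s x ^+ 2)%:C - 1.
Proof. by rewrite fradius_sqr; apply: complex_eq => /=; ring. Qed.

(** [eta] and [zeta] are orthogonal vectors of norm [s] in the plane of [z] and w_0, with
    [eta + conj(kappa) zeta = s^2 z]. *)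
Let eta (x : 'rV[R]_n.+1) := z x + ckap x *: fvec ord0 x.
Let zeta (x : 'rV[R]_n.+1) := kap x *: z x - fvec ord0 x.

(* phi and xi of the header. *)
Definition leg (x : 'rV[R]_n.+1) : 'rV[R[i]]_n.+2 := twist (- d) x *: eta x.
Definition pole (x : 'rV[R]_n.+1) : 'rV[R[i]]_n.+2 := - twist (- (1 - d)) x *: zeta x.

Let Ceta : csmooth_on U eta.
Proof. exact: (csmoothD oU Cz (csmoothZ oU Cckap (Cw ord0))). Qed.

Let Czeta : csmooth_on U zeta.
Proof.
apply: csmooth_ext (csmoothD oU (csmoothZ oU Ckap Cz) (csmoothZ oU (csm_cst U (-1)) (Cw ord0))) => //.
by move=> x _; rewrite /zeta scaleN1r.
Qed.

Lemma csmooth_leg : csmooth_on U leg.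
Proof. exact: (csmoothZ oU (csm_twist _) Ceta). Qed.

Let Cntwist c : csm U (fun x => - twist c x).
Proof.
by apply: csm_ext (csmM oU (csm_cst U (-1)) (csm_twist c)) => // x _; rewrite mulN1r.
Qed.

Lemma csmooth_pole : csmooth_on U pole.
Proof. exact: (csmoothZ oU (Cntwist _) Czeta). Qed.

Let Deta x v : U x -> cderive eta x v =
  cderive z x v + (cdr ckap x v *: fvec ord0 x + ckap x *: cderive (fvec ord0) x v).
Proof.
move=> Ux; rewrite -(cderiveZ oU v Cckap (Cw ord0) Ux).
exact: (cderiveD oU v Cz (csmoothZ oU Cckap (Cw ord0)) Ux).
Qed.

Let Dzeta x v : U x -> cderive zeta x v =
  cdr kap x v *: z x + kap x *: cderive z x v - cderive (fvec ord0) x v.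
Proof.
move=> Ux; rewrite -(cderiveZ oU v Ckap Cz Ux).
have Cn := csmoothZ oU (csm_cst U (-1)) (Cw ord0).
rewrite -(scaleN1r (cderive (fvec ord0) x v)).
have := cderiveZ oU v (csm_cst U (-1)) (Cw ord0) Ux; rewrite cdr_cst scale0r add0r => <-.
rewrite -(cderiveD oU v (csmoothZ oU Ckap Cz) Cn Ux).
by apply: (cderive_ext oU v Ux) => y _; rewrite /zeta scaleN1r.
Qed.

Lemma cderive_leg0 x : U x -> cderive leg x (E ord0 x) = 0.
Proof.
move=> Ux; have -> : cderive leg x _ = _ := cderiveZ oU (E ord0 x) (csm_twist (- d)) Ceta Ux.
rewrite cdr_twist // coframe0_frame // Deta // cdr_ckap // -fvecE -fcovE.
rewrite (fcov00 n2 d0 d2 H NF Ux) Dmu0 // Dla0 // /eta.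
set t := twist _ _; set k' := (_ -i* _); set k := ckap x.
(* The two real equations for mu and lambda become one Riccati equation for conj(kappa). *)
have -> : k' = - 1 - k * (0 +i* la x) - k ^+ 2.
  rewrite /k' /k /ckap; apply: complex_eq; rewrite expr2 /=.
    by ring.
  by field.
have -> : mu x +i* (- d * la x) = k by rewrite /k /ckap mulNr.
apply/rowP => j; rewrite !mxE; move: (z x 0 j) (fvec ord0 x 0 j) => a b.
by rewrite eqxx /=; ring.
Qed.

Lemma cderive_legS a x : U x ->
  cderive leg x (E (S a) x) = (expi (- (d * theta x)) * (s x)%:C) *: fvec (S a) x.
Proof.
move=> Ux; have -> : cderive leg x _ = _ := cderiveZ oU (E (S a) x) (csm_twist (- d)) Ceta Ux.
rewrite cdr_twist // coframe0_frame // Deta // cdr_ckap // -fvecE -fcovE.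
rewrite (fcovS0 n2 d0 d2 H NF a Ux) eq_sym (negbTE (neq_lift _ _)).
have -> : ('D_(E (S a) x) mu x -i* (d * 'D_(E (S a) x) la x)) = 0.
  by rewrite DmuS // DlaS //; apply: complex_eq => /=; ring.
rewrite mulr0 mul0r !scale0r !add0r scalerA -{1}[fvec _ _]scale1r -scalerDl.
rewrite -/(kap x) kapK addrCA subrr addr0 /twist mulNr scalerA -mulrA.
congr ((_ * _) *: _); rewrite -rmorphM /= expr2 mulrA mulVf ?mul1r //.
by rewrite gt_eqF // fradius_gt0.
Qed.

Lemma cderive_pole x v : U x -> cderive pole x v = 0.
Proof.
move=> Ux; rewrite (cderive_of_frame v Ux csmooth_pole) big1 // => i _.
rewrite (_ : cderive pole x _ = 0) ?scaler0 //.
have -> : cderive pole x _ = _ := cderiveZ oU (E i x) (Cntwist (- (1 - d))) Czeta Ux.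
have -> : cdr (fun y => - twist (- (1 - d)) y) x (E i x) = - cdr (twist (- (1 - d))) x (E i x).
  have := cdrM (E i x) (csm_cst U (-1)) (csm_twist (- (1 - d))) Ux.
  rewrite cdr_cst mul0r add0r mulN1r => <-.
  by apply: (cdr_ext oU _ Ux) => y _; rewrite mulN1r.
rewrite cdr_twist // coframe0_frame // Dzeta // cdr_kap // -fvecE -fcovE.
case: (unliftP ord0 i) => [a ->|->].
  rewrite (fcovS0 n2 d0 d2 H NF a Ux) eq_sym (negbTE (neq_lift _ _)).
  have -> : ('D_(E (S a) x) mu x +i* (d * 'D_(E (S a) x) la x)) = 0.
    by rewrite DmuS // DlaS //; apply: complex_eq => /=; ring.
  by rewrite mulr0 mul0r oppr0 !scale0r !add0r subrr scaler0.
rewrite (fcov00 n2 d0 d2 H NF Ux) Dmu0 // Dla0 // /zeta.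
set t := twist _ _; set k' := (_ +i* (d * _)); set k := kap x.
(* With l = kappa - i lambda the Riccati equation reads kappa' = -1 - l kappa, and the same l is the
   logarithmic derivative of the integrating factor, so everything cancels. *)
pose l : R[i] := mu x +i* (- (1 - d) * la x).
have -> : k' = - 1 - l * k.
  rewrite /k' /k /kap /l; apply: complex_eq => /=; first by ring.
  by field.
have kl : (0 +i* la x) = k - l by rewrite /k /kap /l; apply: complex_eq => /=; ring.
rewrite kl -/l.
apply/rowP => j; rewrite !mxE; move: (z x 0 j) (fvec ord0 x 0 j) => a b.
by rewrite eqxx /=; ring.
Qed.

Let sC x : (s x)%:C * ((s x)^-1)%:C = 1 :> R[i].
Proof. by rewrite -rmorphM /= mulfV // gt_eqF // fradius_gt0. Qed.

Let sC2 x : (s x ^+ 2)%:C * ((s x)^-1)%:C * ((s x)^-1)%:C = 1 :> R[i].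
Proof.
rewrite expr2 rmorphM /=; move: (sC x); move: (s x)%:C ((s x)^-1)%:C => a b h.
transitivity ((a * b) * (a * b)); first by ring.
by rewrite h mulr1.
Qed.

Let twistK c x : twist c x * expi (- (c * theta x)) = ((s x)^-1)%:C.
Proof. by rewrite /twist mulrC mulrA expiN mul1r. Qed.

Let twistN c x : twist c x * twist (- c) x = ((s x)^-1)%:C * ((s x)^-1)%:C.
Proof. by rewrite {2}/twist mulNr mulrA twistK. Qed.

Let twist_conj c x : conjc (twist c x) = twist (- c) x.
Proof.
by rewrite /twist mulNr; apply: complex_eq; rewrite /= cosN sinN; ring.
Qed.

Let ntwist_conj c x : conjc (- twist c x) = - twist (- c) x.
Proof. by rewrite -twist_conj; apply: complex_eq. Qed.

Let ckap_conj x : conjc (kap x) = ckap x. Proof. by []. Qed.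

Let kap_conj x : conjc (ckap x) = kap x.
Proof. by rewrite -ckap_conj; apply: complex_eq => //=; rewrite opprK. Qed.

Lemma leg_twistK x :
  z x + (mu x -i* (d * la x)) *: fvec ord0 x = (expi (d * theta x) * (s x)%:C) *: leg x.
Proof.
rewrite -/(eta x) /leg scalerA.
have h : twist (- d) x * expi (d * theta x) = ((s x)^-1)%:C.
  by rewrite -(twistK (- d)) mulNr opprK.
rewrite (_ : _ * twist (- d) x = 1) ?scale1r // mulrC mulrA h mulrC; exact: sC.
Qed.

Let herm_eta x q : herm (eta x) q = herm (z x) q + ckap x * herm (fvec ord0 x) q.
Proof. by rewrite hermDl hermZl. Qed.

Let herm_zeta x q : herm (zeta x) q = kap x * herm (z x) q - herm (fvec ord0 x) q.
Proof. by rewrite hermBl hermZl. Qed.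

Lemma leg_pole_orthonormal x : U x ->
  [/\ herm (leg x) (leg x) = 1, herm (pole x) (pole x) = 1, herm (leg x) (pole x) = 0,
      forall a, herm (leg x) (fvec (S a) x) = 0 & forall a, herm (fvec (S a) x) (pole x) = 0].
Proof.
move=> Ux; rewrite /leg /pole.
have w0a a : herm (fvec ord0 x) (fvec (S a) x) = 0 by rewrite ww // eq_sym (negbTE (neq_lift _ _)).
have wa0 a : herm (fvec (S a) x) (fvec ord0 x) = 0 by rewrite ww // eq_sym (negbTE (neq_lift _ _)).
have w00 : herm (fvec ord0 x) (fvec ord0 x) = 1 by rewrite ww.
split=> [||| a| a].
- rewrite hermZl hermZr twist_conj mulrA twistN herm_eta !(hermDr, hermZr) kap_conj.
  rewrite zz // zw // wz // w00 mulr0 add0r mulr1 addr0 kapK addrCA subrr addr0.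
  by rewrite mulrC mulrA sC2.
- rewrite hermZl hermZr ntwist_conj mulrA mulrNN twistN.
  rewrite herm_zeta !(hermBr, hermZr) ckap_conj.
  rewrite zz // zw // wz // w00 mulr0 !subr0 sub0r mulr1 opprK [kap x * _]mulrC kapK addrNK.
  by rewrite mulrC mulrA sC2.
- rewrite hermZl hermZr herm_eta !(hermBr, hermZr) ckap_conj.
  by rewrite zz // zw // wz // w00 mulr0 sub0r mulr1 subr0 mulrN1 subrr !mulr0.
- by rewrite hermZl herm_eta zw // w0a mulr0 addr0 mulr0.
- by rewrite hermZr hermBr hermZr wz // wa0 mulr0 subr0 mulr0.
Qed.

(** This is [s^2 z = eta + conj(kappa) zeta] after undoing the integrating factors. The sign in the
    definition of [pole] turns conj(kappa) into the factor i d lambda - mu. *)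
Lemma leg_pole_decomp x : z x = (expi (d * theta x) / (s x)%:C) *: leg x +
  (expi ((1 - d) * theta x) * (- mu x +i* (d * la x)) / (s x)%:C) *: pole x.
Proof.
have sV : ((s x)%:C)^-1 = ((s x)^-1)%:C :> R[i] by rewrite fmorphV.
rewrite /leg /pole !scalerA sV.
have E1 c : expi (c * theta x) * ((s x)^-1)%:C = twist c x by [].
have -> : expi (d * theta x) * ((s x)^-1)%:C * twist (- d) x = ((s x)^-1)%:C * ((s x)^-1)%:C.
  by rewrite E1 twistN.
have -> : expi ((1 - d) * theta x) * (- mu x +i* (d * la x)) * ((s x)^-1)%:C * - twist (- (1 - d)) x =
    ckap x * (((s x)^-1)%:C * ((s x)^-1)%:C).
  rewrite -(twistN (1 - d)) -(E1 (1 - d)) (_ : - mu x +i* (d * la x) = - ckap x); first by ring.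
  by apply: complex_eq => //=; rewrite opprK.
have h := sC2 x; have hk := kapK x; rewrite /eta /zeta.
apply/rowP => j; rewrite !mxE.
move: (z x 0 j) (fvec ord0 x 0 j) => a b.
transitivity ((s x ^+ 2)%:C * ((s x)^-1)%:C * ((s x)^-1)%:C * a); first by rewrite h mul1r.
have -> : (s x ^+ 2)%:C = 1 + ckap x * kap x by rewrite hk addrCA subrr addr0.
by move: ((s x)^-1)%:C => t; ring.
Qed.

End Splitting.

(** * First and second derivatives of the factor phi *)

Section LegendrianFactor.
Context {R : realType} (n : nat) (x0 : 'rV[R]_n.+1) (r : R).
Local Notation U := (ball x0 r).
Context (z : 'rV[R]_n.+1 -> 'rV[R[i]]_n.+2) (E : 'I_n.+1 -> 'rV[R]_n.+1 -> 'rV[R]_n.+1).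
Variables (d : R) (la theta : 'rV[R]_n.+1 -> R).
Local Notation S := (lift (@ord0 n)).
Local Notation fvec := (fvec z E).
Local Notation fcov := (fcov z E).
Local Notation conn := (conn z E).
Local Notation cubic := (cubic z E).
Local Notation mu := (fmu d la (E ord0)).
Local Notation s := (fradius E d la).
Local Notation beta := (coframe0 z E).
Local Notation leg := (leg z E d la theta).
Local Notation pole := (pole z E d la theta).

Hypotheses (r0 : 0 < r) (n2 : (1 < n)%N) (d0 : d != 0) (d2 : d != 2^-1).
Hypotheses (H : legendrian_frame U z E) (NF : normal_form U z E d la).
Hypotheses (Cth : smooth_on U theta)
  (Dth : forall (x v : 'rV[R]_n.+1), U x -> 'D_v theta x = la x * beta x v).

Let oU : open U. Proof. by case: H. Qed.
Let ww a b x : U x -> herm (fvec a x) (fvec b x) = (a == b)%:R.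
Proof. by case: H => _ _ _ h /h[]. Qed.
Let Cleg : csmooth_on U leg := csmooth_leg d2 H NF Cth.

Definition lvec a (x : 'rV[R]_n.+1) : 'rV[R[i]]_n.+2 := cderive leg x (E (S a) x).

Let k (x : 'rV[R]_n.+1) : R[i] := expi (- (d * theta x)) * (s x)%:C.

Let lvecE a x : U x -> lvec a x = k x *: fvec (S a) x.
Proof. exact: (cderive_legS n2 d0 d2 H NF Cth Dth). Qed.

Let Cdth : smooth_on U (fun x => - (d * theta x)).
Proof. exact: (smoothN oU (smoothM oU (smooth_cst U d) Cth)). Qed.

Let Cs : smooth_on U s. Proof. exact: (smooth_fradius d2 H NF). Qed.

Let Ck : csm U k.
Proof. exact: (csmM oU (csm_expi oU Cdth) (csm_real Cs)). Qed.

Let kk x : k x * conjc (k x) = (s x ^+ 2)%:C.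
Proof.
have hc : conjc (k x) = expi (d * theta x) * (s x)%:C.
  by rewrite /k; apply: complex_eq; rewrite /= ?cosN ?sinN; ring.
rewrite hc /k expr2 rmorphM /= mulrACA expiN mul1r.
by [].
Qed.

Lemma csmooth_lvec a : csmooth_on U (lvec a).
Proof.
apply: (csmooth_ext oU) (csmoothZ oU Ck (csmooth_fvec H (S a))) => x Ux.
by rewrite lvecE.
Qed.

Lemma herm_lvec a b x : U x -> herm (lvec a x) (lvec b x) = (a == b)%:R * (s x ^+ 2)%:C.
Proof.
move=> Ux; rewrite !lvecE // hermZl hermZr ww // mulrA kk (inj_eq lift_inj).
exact: mulrC.
Qed.

Lemma lvec_leg a x : U x -> herm (lvec a x) (leg x) = 0.
Proof.
move=> Ux; have [_ _ _ h _] := leg_pole_orthonormal d la H theta Ux.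
by rewrite lvecE // hermZl -herm_conj h conjc0 mulr0.
Qed.

Lemma lvec_pole a x : U x -> herm (lvec a x) (pole x) = 0.
Proof.
move=> Ux; have [_ _ _ _ h] := leg_pole_orthonormal d la H theta Ux.
by rewrite lvecE // hermZl h mulr0.
Qed.

Lemma cderive_leg x v : U x ->
  cderive leg x v = \sum_c (complex.Re (herm (cderive z x v) (fvec (S c) x)))%:C *: lvec c x.
Proof.
move=> Ux; rewrite (cderive_of_frame H v Ux Cleg) big_ord_recl.
by rewrite (cderive_leg0 n2 d0 d2 H NF Cth Dth Ux) scaler0 add0r.
Qed.

(** [lvec] is [fvec] scaled by [k], and [k] is constant along [E (S a)] because [s] and [theta] vary
    only with [beta]. So [fcovSS] carries over, with real connection coefficients and the cubic form
    as imaginary part. *)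
Lemma cderive_lvec a b x : U x -> cderive (lvec b) x (E (S a) x) =
  (- ((a == b)%:R * s x ^+ 2))%:C *: leg x +
  \sum_e (conn (S a) (S b) (S e) x +i* cubic (S a) (S b) (S e) x) *: lvec e x.
Proof.
move=> Ux; have b0 : beta x (E (S a) x) = 0.
  by rewrite (coframe0_frame H _ Ux) eq_sym (negbTE (neq_lift _ _)).
have -> : cderive (lvec b) x (E (S a) x) = cderive (fun y => k y *: fvec (S b) y) x (E (S a) x).
  by apply: (cderive_ext oU _ Ux) => y Uy; rewrite lvecE.
rewrite (cderiveZ oU _ Ck (csmooth_fvec H (S b)) Ux) -fcovE.
have -> : cdr k x (E (S a) x) = 0.
  have -> : cdr k x (E (S a) x) = _ := cdrM (E (S a) x) (csm_expi oU Cdth) (csm_real Cs) Ux.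
  rewrite (cdr_expi _ Cdth Ux) cdr_real (derive_fradius n2 d0 d2 H NF _ Ux) b0 mulr0.
  have -> : 'D_(E (S a) x) (fun y => - (d * theta y)) x = 0.
    have Cd := smoothM oU (smooth_cst U d) Cth.
    apply: etrans (deriveN (smooth_derivable Cd Ux)) _.
    rewrite (_ : 'D_ _ _ x = 0) ?oppr0 //.
    apply: etrans (deriveZ _ (smooth_derivable Cth Ux)) _.
    by rewrite Dth // b0 mulr0 scaler0.
  by rewrite -[0 +i* 0]/(0 : R[i]) !mul0r mulr0 addr0.
rewrite scale0r add0r (fcovSS n2 d0 d2 H NF _ _ Ux) (leg_twistK z E d la theta x).
move: (leg x) => L; rewrite scalerDr scalerN; congr (_ + _); last first.
  by rewrite scaler_sumr; apply: eq_bigr => e _; rewrite lvecE // !scalerA [k x * _]mulrC.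
rewrite !scalerA -scaleNr; congr (_ *: _).
have -> : k x * ((a == b)%:R * (expi (d * theta x) * (s x)%:C)) =
    (a == b)%:R * ((s x)%:C * (s x)%:C) * (expi (- (d * theta x)) * expi (d * theta x)).
  by rewrite /k; ring.
rewrite expiN mulr1 expr2; case: (a == b); apply: complex_eq => /=; ring.
Qed.

End LegendrianFactor.

(** * Minimality *)

Section NormalPart.
Context {R : realType} (m k : nat).
Implicit Types (X Y : 'rV[R[i]]_m).
Local Notation ii := (0 +i* 1 : R[i]).

Lemma redotDl X Y Z : redot (X + Y) Z = redot X Z + redot Y Z.
Proof. by rewrite !redot_herm hermDl cReD. Qed.

Lemma redotZl (r : R) X Y : redot (r%:C *: X) Y = r * redot X Y.
Proof. by rewrite !redot_herm hermZl cReM /= mul0r subr0. Qed.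

Lemma redotC X Y : redot X Y = redot Y X.
Proof. by rewrite !redot_herm -herm_conj cReJ. Qed.

Lemma redot_suml (I : Type) (s : seq I) (X : I -> 'rV[R[i]]_m) Y :
  redot (\sum_(i <- s) X i) Y = \sum_(i <- s) redot (X i) Y.
Proof. by rewrite redot_herm herm_suml cRe_sum; apply: eq_bigr => j _; rewrite redot_herm. Qed.

Lemma redot_sumr (I : Type) (s : seq I) (X : I -> 'rV[R[i]]_m) Y :
  redot Y (\sum_(i <- s) X i) = \sum_(i <- s) redot Y (X i).
Proof. by rewrite redotC redot_suml; apply: eq_bigr => j _; rewrite redotC. Qed.

Lemma normal_part_split (v : 'I_k -> 'rV[R[i]]_m) (c : 'I_k -> R) Y :
  gram v \in unitmx -> (forall b, redot Y (v b) = 0) ->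
  normal_part v (\sum_a (c a)%:C *: v a + Y) = Y.
Proof.
move=> gu Y0; rewrite /normal_part.
have h b : redot (\sum_a (c a)%:C *: v a + Y) (v b) = ((\row_a c a) *m gram v) 0 b.
  rewrite redotDl Y0 addr0 redot_suml mxE; apply: eq_bigr => a _.
  by rewrite redotZl !mxE.
rewrite [X in _ - X](eq_bigr (fun a => (c a)%:C *: v a)) => [|a _]; first by rewrite addrC addKr.
rewrite -scaler_suml; congr (_ *: _).
rewrite -(rmorph_sum (real_complex R)) /=; congr (_%:C).
transitivity (((\row_a c a) *m gram v *m invmx (gram v)) 0 a); last by rewrite mulmxK // mxE.
by rewrite mxE; apply: eq_bigr => b _; rewrite h.
Qed.

End NormalPart.

Section MeanCurvature.
Context {R : realType} (m k : nat) (F : 'rV[R]_k -> 'rV[R[i]]_m) (u : 'rV[R]_k).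
Variables (y : 'I_k -> 'rV[R[i]]_m) (s2 : R) (A : 'M[R]_k) (r : 'I_k -> 'I_k -> R).
Variables (p C : 'I_k -> 'I_k -> 'I_k -> R).
Local Notation ii := (0 +i* 1 : R[i]).
Local Notation dF a := (cderive F u (delta_mx 0 a)).
Hypotheses (s0 : s2 != 0) (Au : A \in unitmx).
Hypothesis dFE : forall a, dF a = \sum_c (A a c)%:C *: y c.
Hypothesis yy : forall a b, redot (y a) (y b) = (a == b)%:R * s2.
Hypothesis iyy : forall a b, redot (ii *: y a) (y b) = 0.
Hypotheses (yF : forall a, redot (y a) (F u) = 0) (iyF : forall a, redot (ii *: y a) (F u) = 0).
Hypothesis FF : redot (F u) (F u) = 1.
Hypothesis ddF : forall a b,
  cderive (fun v => cderive F v (delta_mx 0 b)) u (delta_mx 0 a) =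
  (r a b)%:C *: F u + \sum_e (p a b e)%:C *: y e +
  \sum_e (\sum_c \sum_f A a c * A b f * C c f e)%:C *: (ii *: y e).
Hypothesis trC : forall e, \sum_c C c c e = 0.

Let yE c : y c = \sum_a (invmx A c a)%:C *: dF a.
Proof.
under eq_bigr => a _ do rewrite dFE scaler_sumr.
rewrite exchange_big /= -[LHS]scale1r.
transitivity (\sum_j ((invmx A *m A) c j)%:C *: y j).
  rewrite mulVmx // (bigD1 c) //= big1 ?addr0 => [|j jc]; first by rewrite mxE eqxx.
  by rewrite mxE eq_sym (negbTE jc) scale0r.
apply: eq_bigr => j _; rewrite mxE (rmorph_sum (real_complex R)) /= scaler_suml.
by apply: eq_bigr => a _; rewrite scalerA rmorphM.
Qed.

Let gramE : gram (fun c => dF c) = s2 *: (A *m A^T).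
Proof.
apply/matrixP => a b; rewrite !mxE !dFE redot_suml mulr_sumr; apply: eq_bigr => c _.
rewrite redotZl redot_sumr (bigD1 c) //= big1 ?addr0 => [|e ec].
  by rewrite redotC redotZl yy eqxx mxE mul1r; ring.
by rewrite redotC redotZl yy (negbTE ec) mul0r mulr0.
Qed.

Let gram_unit : gram (fun c => dF c) \in unitmx.
Proof. by rewrite gramE unitmxZ ?unitfE // unitmx_mul Au unitmx_tr. Qed.

(** In the basis [y] the induced metric is [s2] times the identity, so contracting the inverse Gram
    matrix with [A] on both sides gives [s2^-1] times the identity. The part of the second
    derivatives normal to the immersion in the sphere consists of the terms in i y_e, and its metric
    trace is therefore the trace of [C] over [s2]. *)
Lemma mean_curvature_tracefree : sphere_mean_curvature F u = 0.
Proof.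
have h : A^T *m invmx (gram (fun c => dF c)) *m A = s2^-1%:M.
  have : A *m (s2 *: (A^T *m invmx (gram (fun c => dF c)))) = 1%:M.
    by rewrite -(mulmxV gram_unit) {2}gramE -scalemxAr -scalemxAl mulmxA.
  move/mulmx1C; rewrite -scalemxAl => /(congr1 ( *:%R s2^-1)).
  by rewrite scalerA mulVf // scale1r scalemx1.
rewrite /sphere_mean_curvature.
pose H a b e := \sum_c \sum_f A a c * A b f * C c f e.
transitivity (\sum_a \sum_b (invmx (gram (fun c => dF c)) a b)%:C *: (\sum_e (H a b e)%:C *: (ii *: y e))).
  apply: eq_bigr => a _; apply: eq_bigr => b _; congr (_ *: _).
  rewrite ddF; set N := \sum_e (H a b e)%:C *: _; set T := \sum_e (p a b e)%:C *: y e.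
  have NF : redot N (F u) = 0.
    by rewrite redot_suml big1 // => e _; rewrite redotZl iyF mulr0.
  have TF : redot T (F u) = 0.
    by rewrite redot_suml big1 // => e _; rewrite redotZl yF mulr0.
  rewrite !redotDl NF TF redotZl FF mulr1 !addr0 addrC !addrA addNr add0r.
  have -> : T = \sum_a0 (\sum_e p a b e * invmx A e a0)%:C *: dF a0.
    rewrite /T; under eq_bigr => e _ do rewrite yE scaler_sumr.
    rewrite exchange_big; apply: eq_bigr => j _ /=.
    rewrite (rmorph_sum (real_complex R)) /= scaler_suml.
    by apply: eq_bigr => e _; rewrite scalerA rmorphM.
  apply: normal_part_split => // b'; rewrite dFE redot_sumr big1 // => c _.
  rewrite redotC redotZl redotC redot_suml big1 ?mulr0 // => e _.
  by rewrite redotZl iyy mulr0.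
under eq_bigr => a _.
  under eq_bigr => b _ do rewrite scaler_sumr.
  rewrite exchange_big /=; over.
rewrite exchange_big /= big1 // => e _.
under eq_bigr => a _ do (under eq_bigr => b _ do rewrite scalerA -rmorphM; rewrite -scaler_suml -(rmorph_sum (real_complex R))).
rewrite -scaler_suml -(rmorph_sum (real_complex R)) /=.
rewrite (_ : \sum_a _ = 0) ?scale0r //.
transitivity (\sum_c \sum_f C c f e * (A^T *m invmx (gram (fun c => dF c)) *m A) c f).
  rewrite /H; under eq_bigr => a _ do under eq_bigr => b _ do rewrite mulr_sumr.
  under eq_bigr => a _ do rewrite exchange_big /=.
  rewrite exchange_big; apply: eq_bigr => c _ /=.
  under eq_bigr => a _ do under eq_bigr => b _ do rewrite mulr_sumr.
  under eq_bigr => a _ do rewrite exchange_big /=.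
  rewrite exchange_big; apply: eq_bigr => f _ /=.
  rewrite mxE mulr_sumr exchange_big; apply: eq_bigr => b _ /=.
  rewrite !mxE mulr_suml mulr_sumr; apply: eq_bigr => a _; rewrite mxE; ring.
rewrite h; transitivity (\sum_c C c c e * s2^-1).
  apply: eq_bigr => c _; rewrite (bigD1 c) //= big1 ?addr0 => [|f fc].
    by rewrite mxE eqxx.
  by rewrite mxE eq_sym (negbTE fc) mulr0.
by rewrite -mulr_suml trC mul0r.
Qed.

End MeanCurvature.

(** Regroups what the product rule yields into the form required by [ddF]: position vector, real
    combination of the tangent vectors, and real combination of their multiples by i. *)
Lemma collect_second_derivative {R : realType} (m k : nat) (P : 'rV[R[i]]_m)
    (y : 'I_k -> 'rV[R[i]]_m) (D a b : 'I_k -> R) (q : 'I_k -> 'I_k -> R)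
    (G C : 'I_k -> 'I_k -> 'I_k -> R) :
  \sum_f ((D f)%:C *: y f + (b f)%:C *: \sum_c (a c)%:C *:
    ((q c f)%:C *: P + \sum_e (G c f e +i* C c f e) *: y e)) =
  (\sum_c \sum_f a c * b f * q c f)%:C *: P +
  \sum_e (D e + \sum_c \sum_f a c * b f * G c f e)%:C *: y e +
  \sum_e (\sum_c \sum_f a c * b f * C c f e)%:C *: ((0 +i* 1) *: y e).
Proof.
pose w c f := (q c f)%:C *: P + \sum_e (G c f e +i* C c f e) *: y e.
have -> : \sum_f ((D f)%:C *: y f + (b f)%:C *: \sum_c (a c)%:C *: w c f) =
    \sum_f (D f)%:C *: y f + \sum_c \sum_f (a c * b f)%:C *: w c f.
  rewrite big_split /= [in RHS]exchange_big /=; congr (_ + _); apply: eq_bigr => f _.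
  by rewrite scaler_sumr; apply: eq_bigr => c _; rewrite scalerA rmorphM mulrC.
have -> : \sum_c \sum_f (a c * b f)%:C *: w c f =
    (\sum_c \sum_f a c * b f * q c f)%:C *: P +
    \sum_e (\sum_c \sum_f (a c * b f)%:C * (G c f e +i* C c f e)) *: y e.
  rewrite (rmorph_sum (real_complex R)) /= scaler_suml.
  under [X in _ = _ + X]eq_bigr => e _ do rewrite scaler_suml.
  rewrite [X in _ = _ + X]exchange_big -big_split /=; apply: eq_bigr => c _.
  rewrite (rmorph_sum (real_complex R)) /= scaler_suml.
  under [X in _ = _ + X]eq_bigr => e _ do rewrite scaler_suml.
  rewrite [X in _ = _ + X]exchange_big -big_split /=; apply: eq_bigr => f _.
  rewrite /w scalerDr scalerA -rmorphM; congr (_ + _).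
  by rewrite scaler_sumr; apply: eq_bigr => e _; rewrite scalerA.
rewrite addrCA -[RHS]addrA; congr (_ + _); rewrite -!big_split /=; apply: eq_bigr => e _.
rewrite scalerA -!scalerDl; congr (_ *: _).
have GC : \sum_c \sum_f (a c * b f)%:C * (G c f e +i* C c f e) =
    (\sum_c \sum_f a c * b f * G c f e) +i* (\sum_c \sum_f a c * b f * C c f e).
  apply: complex_eq; rewrite ?cRe_sum ?cIm_sum; apply: eq_bigr => c _;
    by rewrite ?cRe_sum ?cIm_sum; apply: eq_bigr => f _ /=; ring.
by rewrite GC; apply: complex_eq => /=; ring.
Qed.

(** * Adapted coordinates *)

Section Composition.
Context {R : realType} (k l : nat) (U : set 'rV[R]_k) (V : set 'rV[R]_l) (K : 'rV[R]_k -> 'rV[R]_l).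
Hypotheses (oU : open U) (CK : smooth_on U K) (UV : forall x, U x -> V (K x)).

Lemma smooth_comp (f : 'rV[R]_l -> R) : smooth_on V f -> smooth_on U (f \o K).
Proof. by move=> Cf r; exact: Ck_comp oU UV (CK r) (Cf r). Qed.

Lemma csmooth_comp p q (F : 'rV[R]_l -> 'M[R[i]]_(p, q)) : csmooth_on V F -> csmooth_on U (F \o K).
Proof.
by move=> CF i j; have [C1 C2] := CF i j; split; [exact: (smooth_comp C1)|exact: (smooth_comp C2)].
Qed.

Lemma cderive_comp p q (F : 'rV[R]_l -> 'M[R[i]]_(p, q)) x v : csmooth_on V F -> U x ->
  cderive (F \o K) x v = cderive F (K x) ('D_v K x).
Proof.
move=> CF Ux; apply/matrixP => i j; have [C1 C2] := CF i j; rewrite !mxE.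
have dK := smooth_diff CK Ux; have VK := UV Ux.
have e1 := derive_comp_row v dK (smooth_diff C1 VK).
have e2 := derive_comp_row v dK (smooth_diff C2 VK).
by congr (_ +i* _).
Qed.

End Composition.

Section ConstantRight.
Context {R : realType} (k : nat) (U : set 'rV[R]_k).
Hypothesis oU : open U.

Lemma csmoothMr p q r (F : 'rV[R]_k -> 'M[R[i]]_(p, q)) (Q : 'M[R[i]]_(q, r)) :
  csmooth_on U F -> csmooth_on U (fun x => F x *m Q).
Proof. by move=> CF; exact: (csmoothM oU CF (csmooth_cst U Q)). Qed.

Lemma cderiveMr p q r (F : 'rV[R]_k -> 'M[R[i]]_(p, q)) (Q : 'M[R[i]]_(q, r)) x v :
  csmooth_on U F -> U x -> cderive (fun y => F y *m Q) x v = cderive F x v *m Q.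
Proof.
move=> CF Ux; have := cderiveM oU v CF (csmooth_cst U Q) Ux.
by rewrite cderive_cst mulmx0 addr0.
Qed.

Lemma csmooth_bigsum p q (I : Type) (t : seq I) (F : I -> 'rV[R]_k -> 'M[R[i]]_(p, q)) :
  (forall i, csmooth_on U (F i)) -> csmooth_on U (fun x => \sum_(i <- t) F i x).
Proof.
move=> CF; elim: t => [|a t IH].
  by apply: (csmooth_ext oU) (csmooth_cst U 0) => x _; rewrite big_nil.
by apply: (csmooth_ext oU) (csmoothD oU (CF a) IH) => x _; rewrite big_cons.
Qed.

Lemma cderive_bigsum p q (I : Type) (t : seq I) (F : I -> 'rV[R]_k -> 'M[R[i]]_(p, q)) x v :
  (forall i, csmooth_on U (F i)) -> U x ->
  cderive (fun y => \sum_(i <- t) F i y) x v = \sum_(i <- t) cderive (F i) x v.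
Proof.
move=> CF Ux; elim: t => [|a t IH].
  rewrite big_nil -[RHS](cderive_cst 0 x v).
  by apply: (cderive_ext oU v Ux) => y _; rewrite big_nil.
rewrite big_cons -IH -(cderiveD oU v (CF a) (csmooth_bigsum t CF) Ux).
by apply: (cderive_ext oU v Ux) => y _; rewrite big_cons.
Qed.

Lemma constant_segment (f : 'rV[R]_k -> R) (x y : 'rV[R]_k) :
  (forall s : R, 0 <= s <= 1 -> U (x + s *: (y - x))) -> smooth_on U f ->
  (forall w, U w -> 'D_(y - x) f w = 0) -> f y = f x.
Proof.
move=> seg Cf f0.
have [s /andP[/ltW s0 /ltW s1]] : exists2 s : R, 0 < s < 1 & f (x + (y - x)) - f x = 'D_(y - x) f (x + s *: (y - x)).
  by apply: MVT_line => s /seg Us; exact: smooth_diff Cf Us.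
rewrite f0; last by apply: seg; rewrite s0.
by rewrite addrCA subrr addr0 => /eqP; rewrite subr_eq0 => /eqP.
Qed.

Lemma cconstant_segment p q (F : 'rV[R]_k -> 'M[R[i]]_(p, q)) (x y : 'rV[R]_k) :
  (forall s : R, 0 <= s <= 1 -> U (x + s *: (y - x))) -> csmooth_on U F ->
  (forall w, U w -> cderive F w (y - x) = 0) -> F y = F x.
Proof.
move=> seg CF F0; apply/matrixP => i j; have [C1 C2] := CF i j.
have F1 w : U w -> cderive F w (y - x) i j = 0 by move=> Uw; rewrite F0 // mxE.
apply: complex_eq.
  by apply: (constant_segment seg C1) => w /F1 /(congr1 (@complex.Re R)); rewrite mxE.
by apply: (constant_segment seg C2) => w /F1 /(congr1 (@complex.Im R)); rewrite mxE.
Qed.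

End ConstantRight.

Lemma ball_segment {R : realType} (k : nat) (c : 'rV[R]_k) (r : R) x y (s : R) :
  ball c r x -> ball c r y -> 0 <= s <= 1 -> ball c r (x + s *: (y - x)).
Proof.
rewrite -!ball_normE /= => hx hy /andP[s0 s1].
have -> : c - (x + s *: (y - x)) = (1 - s) *: (c - x) + s *: (c - y).
  by apply/rowP => j; rewrite !mxE; ring.
apply: le_lt_trans (ler_normD _ _) _; rewrite !normrZ (ger0_norm s0) ger0_norm ?subr_ge0 //.
move: hx hy; move: `|c - x| `|c - y| => a b ha hb.
have [->|s0'] := eqVneq s 0; first by lra.
have sp : 0 < s by rewrite lt0r s0' s0.
by nra.
Qed.

Lemma ball_rowE {R : realType} (k : nat) (c : 'rV[R]_k) (r : R) (y : 'rV[R]_k) : 0 < r ->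
  ball c r y <-> forall j, `|c 0 j - y 0 j| < r.
Proof.
move=> r0; split=> [[_ h] j|h]; first by have := h 0 j; rewrite /ball /=.
by split=> // i j; rewrite ord1; exact: h.
Qed.

Section Coordinates.
Context {R : realType} (n : nat) (x0 : 'rV[R]_n.+1) (r : R).
Local Notation U := (ball x0 r).
Context (z : 'rV[R]_n.+1 -> 'rV[R[i]]_n.+2) (E : 'I_n.+1 -> 'rV[R]_n.+1 -> 'rV[R]_n.+1).
Variables (d : R) (la theta tau : 'rV[R]_n.+1 -> R).
Local Notation S := (lift (@ord0 n)).
Local Notation fvec := (fvec z E).
Local Notation mu := (fmu d la (E ord0)).
Local Notation s := (fradius E d la).
Local Notation beta := (coframe0 z E).
Local Notation leg := (leg z E d la theta).
Local Notation lvec := (lvec z E d la theta).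

Hypotheses (r0 : 0 < r) (n2 : (1 < n)%N) (d0 : d != 0) (d2 : d != 2^-1).
Hypotheses (H : legendrian_frame U z E) (NF : normal_form U z E d la).
Hypotheses (Cth : smooth_on U theta)
  (Dth : forall (x v : 'rV[R]_n.+1), U x -> 'D_v theta x = la x * beta x v).
Hypotheses (Ctau : smooth_on U tau)
  (Dtau : forall (x v : 'rV[R]_n.+1), U x -> 'D_v tau x = beta x v).

Let oU : open U. Proof. by case: H. Qed.
Let Ux0 : U x0. Proof. exact: ballxx. Qed.
Let Cleg : csmooth_on U leg := csmooth_leg d2 H NF Cth.

Let g a (x : 'rV[R]_n.+1) : R := complex.Re (herm (leg x) (lvec a x0)).

Let Cg a : smooth_on U (g a).
Proof. exact: (csm_herm oU Cleg (csmooth_cst U (lvec a x0))).1. Qed.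

Let Dg a x v : U x -> 'D_v (g a) x = complex.Re (herm (cderive leg x v) (lvec a x0)).
Proof.
move=> Ux; rewrite -[RHS]addr0 -[X in _ + X](_ : complex.Re (herm (leg x) 0) = 0); last first.
  by rewrite herm0r.
rewrite -(cderive_cst (lvec a x0) x v) -cReD.
by rewrite -(cdr_herm oU _ Cleg (csmooth_cst U (lvec a x0)) Ux).
Qed.

(** Besides [tau], the coordinates are the real components of [leg] along its own frame derivatives
    at [x0]. Along [E ord0] only the first one varies; at [x0] the differential is injective because
    the [lvec a x0] are orthogonal and nonzero. *)
Definition split_coord (x : 'rV[R]_n.+1) : 'rV[R]_n.+1 := \row_j adjoin (tau x) (g^~ x) j.
Local Notation G := split_coord.

Let G0 x : G x 0 ord0 = tau x. Proof. by rewrite mxE adjoin0. Qed.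
Let GS x a : G x 0 (S a) = g a x. Proof. by rewrite mxE adjoinS. Qed.

Lemma smooth_coord : smooth_on U split_coord.
Proof.
move=> q; apply/Ck_rowP => // j; case: (unliftP ord0 j) => [a ->|->].
  by apply: Ck_ext (Cg a q) => // x _; rewrite GS.
by apply: Ck_ext (Ctau q) => // x _; rewrite G0.
Qed.

Lemma derive_coord_ord0 x v : U x -> 'D_v G x 0 ord0 = beta x v.
Proof.
move=> Ux; rewrite (derive_row_coord _ _ (smooth_diff smooth_coord Ux)) -Dtau //.
by congr (derive _ x v); apply/funext => y; rewrite G0.
Qed.

Let DGS x v a : U x -> 'D_v G x 0 (S a) = complex.Re (herm (cderive leg x v) (lvec a x0)).
Proof.
move=> Ux; rewrite (derive_row_coord _ _ (smooth_diff smooth_coord Ux)) -Dg //.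
by congr (derive _ x v); apply/funext => y; rewrite GS.
Qed.

Lemma derive_coord0 x : U x -> 'D_(E ord0 x) G x = delta_mx 0 ord0.
Proof.
move=> Ux; apply/rowP => j; rewrite [RHS]mxE eqxx /=; case: (unliftP ord0 j) => [a ->|->].
  rewrite DGS // (cderive_leg0 n2 d0 d2 H NF Cth Dth Ux) herm0l.
  by rewrite eq_sym (negbTE (neq_lift _ _)).
by rewrite derive_coord_ord0 // (coframe0_frame H _ Ux).
Qed.

Let injG v : 'D_v G x0 = 0 -> v = 0.
Proof.
move=> v0; have b0 : beta x0 v = 0 by rewrite -derive_coord_ord0 // v0 mxE.
have bS a : complex.Re (herm (cderive z x0 v) (fvec (S a) x0)) = 0.
  have : 'D_v G x0 0 (S a) = 0 by rewrite v0 mxE.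
  rewrite DGS // (cderive_leg n2 d0 d2 H NF Cth Dth v Ux0) herm_suml.
  rewrite (bigD1 a) //= big1 ?addr0 => [|c ca].
    rewrite hermZl (herm_lvec n2 d0 d2 H NF Cth Dth _ _ Ux0) eqxx mul1r.
    rewrite -rmorphM /= => /eqP; rewrite mulf_eq0 sqrf_eq0 => /orP[/eqP //|].
    by rewrite gt_eqF // fradius_gt0.
  by rewrite hermZl (herm_lvec n2 d0 d2 H NF Cth Dth _ _ Ux0) (negbTE ca) mul0r mulr0.
rewrite (frame_decomp H v Ux0) big_ord_recl big1 => [|a _]; last by rewrite bS scale0r.
by rewrite -/(beta x0 v) b0 scale0r addr0.
Qed.

Lemma coord_chart : exists (V : set 'rV[R]_n.+1) (K : 'rV[R]_n.+1 -> 'rV[R]_n.+1) (rho : R),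
  let B := ball (G x0) rho in
  [/\ 0 < rho, open V /\ V `<=` U, V x0, smooth_on B K &
    (forall x, V x -> [/\ B (G x), K (G x) = x & forall v : 'rV[R]_n.+1, 'D_v G x = 0 -> v = 0]) /\
    (forall y, B y -> V (K y) /\ G (K y) = y)].
Proof.
have [V [B [K [[oV oB] Vx0 [VU CK] VP BP]]]] := inverse_function oU Ux0 smooth_coord injG.
have [BG _ _] := VP _ Vx0.
have /nbhs_ballP[rho /= rho0 rB] := open_nbhs_nbhs (conj oB BG).
(* The image is shrunk to a ball of the maximum norm, which is a box: an interval for [t] times a
   ball for [u]. *)
pose V' : set 'rV[R]_n.+1 := fun x => V x /\ ball (G x0) rho (G x).
exists V', K, rho; split; [exact: rho0| | | |].
- split=> [|x [/VU //]].
  rewrite openE => x [Vx Bx]; have Ux := VU _ Vx.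
  have cG := differentiable_continuous (smooth_diff smooth_coord Ux).
  have oball : open (ball (G x0) rho) by exact: ball_open.
  have N1 := near_preimage cG oball Bx.
  have N2 := open_nbhs_nbhs (conj oV Vx).
  by apply: filterS2 N2 N1 => y h1 h2; split.
- by split; [exact: Vx0|exact: ballxx].
- by move=> q; apply: Ck_sub (CK q).
- split=> [x [/VP[h1 h2 h3] Bx]|y By]; first by split; [exact: Bx|exact: h2|exact: h3].
  by have [Vy GK] := BP _ (rB _ By); split; [split; [exact: Vy|rewrite GK]|exact: GK].
Qed.

End Coordinates.

(** * Coordinates in a unitary basis and the hyperplane of its first vectors *)

Section SplitBasis.
Context {R : realType} (m : nat) (b : 'I_m.+1 -> 'rV[R[i]]_m.+1).
Hypothesis bb : forall i j, herm (b i) (b j) = (i == j)%:R.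

(** Right multiplication by these matrices takes coordinates in the basis [b], here without the last
    one; the entries are conjugated because [herm] is antilinear in its second argument. *)
Definition horizontal_mx : 'M[R[i]]_(m.+1, m) := \matrix_(j, a) conjc (b (lift ord_max a) 0 j).
Definition frame_mx : 'M[R[i]]_m.+1 := \matrix_(j, a) conjc (b a 0 j).

Lemma mul_horizontal_mx p a : (p *m horizontal_mx) 0 a = herm p (b (lift ord_max a)).
Proof. by rewrite hermE mxE; apply: eq_bigr => j _; rewrite !mxE. Qed.

Lemma mul_frame_mx p a : (p *m frame_mx) 0 a = herm p (b a).
Proof. by rewrite hermE mxE; apply: eq_bigr => j _; rewrite !mxE. Qed.

Lemma frame_mx_unitary : frame_mx *m frame_mx^t* = 1%:M.
Proof.
have [_ <-] := rows_mx_unitary bb; congr (_ *m _).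
  by apply/matrixP => i j; rewrite !mxE.
by apply/matrixP => i j; rewrite !mxE conjCK.
Qed.

Lemma herm_frame_mx p q : herm (p *m frame_mx) (q *m frame_mx) = herm p q.
Proof.
rewrite [RHS](orthonormal_parseval bb) hermE; apply: eq_bigr => j _.
by rewrite !mul_frame_mx.
Qed.

Lemma herm_horizontal_mx p q : herm p (b ord_max) = 0 ->
  herm (p *m horizontal_mx) (q *m horizontal_mx) = herm p q.
Proof.
move=> p0; rewrite [RHS](orthonormal_parseval bb) hermE big_ord_recr /= p0 mul0r addr0.
apply: eq_bigr => j _; rewrite !mul_horizontal_mx.
rewrite (_ : widen_ord _ j = lift ord_max j) //.
by apply: val_inj; rewrite /= /bump leqNgt ltn_ord.
Qed.

Lemma mul_frame_mx_split p q a c : herm p (b ord_max) = 0 -> q = b ord_max ->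
  (a *: p + c *: q) *m frame_mx = row_rcons (a *: (p *m horizontal_mx)) c.
Proof.
move=> p0 qE; apply/rowP => j; rewrite mul_frame_mx hermDl !hermZl [RHS]mxE.
case: (unliftP ord_max j) => [i ->|->].
  rewrite ?liftK mxE mul_horizontal_mx qE bb (negbTE (neq_lift _ _)) mulr0 addr0.
  by [].
by rewrite ?unlift_none p0 mulr0 add0r qE bb eqxx mulr1.
Qed.

End SplitBasis.

Section Box.
Context {R : realType} (n : nat) (y0 : 'rV[R]_(1 + n)) (rho : R).
Hypothesis rho0 : 0 < rho.
Local Notation us := (rsubmx y0).
Local Notation e0 := (delta_mx 0 ord0 : 'rV[R]_n.+1).

Lemma row_mx00 (a : 'rV[R]_1) (u : 'rV[R]_n) : (row_mx a u : 'rV[R]_n.+1) 0 ord0 = a 0 0.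
Proof.
rewrite -(row_mxEl a u 0 (0 : 'I_1)); congr (row_mx a u _ _).
by apply: val_inj.
Qed.

Lemma row_mxS (a : 'rV[R]_1) (u : 'rV[R]_n) i : (row_mx a u : 'rV[R]_n.+1) 0 (lift ord0 i) = u 0 i.
Proof.
rewrite -(row_mxEr a u 0 i); congr (row_mx a u _ _).
by apply: val_inj; rewrite /= /bump.
Qed.

Lemma rsubmx_lift (y : 'rV[R]_(1 + n)) i : rsubmx y 0 i = y 0 (lift ord0 i).
Proof. by rewrite mxE; congr (y _ _); apply: val_inj; rewrite /= /bump. Qed.

Lemma ball_box (y : 'rV[R]_(1 + n)) : ball y0 rho y <->
  (y0 0 ord0 - rho < y 0 ord0 < y0 0 ord0 + rho) /\ ball us rho (rsubmx y).
Proof.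
rewrite !ball_rowE //; split=> [h|[h1 h2] j].
  split; first by have := h ord0; rewrite ltr_norml ltrBDr ltrBlDr => /andP[? ?]; apply/andP; split; lra.
  by move=> i; rewrite !rsubmx_lift; exact: h.
case: (unliftP ord0 j) => [i ->|->]; first by have := h2 i; rewrite !rsubmx_lift.
by move/andP: h1 => [? ?]; rewrite ltr_norml; apply/andP; split; lra.
Qed.

(** Functions of [t] alone are read off on the line [tline] through the centre of the box, functions
    of [u] alone on the hyperplane [slice] through it. *)
Definition tline (t : R) : 'rV[R]_n.+1 := (row_mx 0 us : 'rV[R]_(1 + n)) + t *: e0.
Definition slice (u : 'rV[R]_n) : 'rV[R]_n.+1 := row_mx (y0 0 ord0)%:M u : 'rV[R]_(1 + n).

Lemma tline0 t : tline t 0 ord0 = t.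
Proof. by rewrite /tline mxE row_mx00 !mxE eqxx mulr1 add0r. Qed.

Lemma tlineS t i : tline t 0 (lift ord0 i) = y0 0 (lift ord0 i).
Proof. by rewrite /tline mxE row_mxS rsubmx_lift !mxE eq_sym (negbTE (neq_lift _ _)) andbF mulr0 addr0. Qed.

Lemma slice0 u : slice u 0 ord0 = y0 0 ord0.
Proof. by rewrite /slice row_mx00 mxE eqxx. Qed.

Lemma sliceS u i : slice u 0 (lift ord0 i) = u 0 i.
Proof. by rewrite /slice row_mxS. Qed.

Lemma tline_box t : y0 0 ord0 - rho < t < y0 0 ord0 + rho -> ball y0 rho (tline t).
Proof.
move=> /andP[h1 h2]; apply/(ball_rowE _ _ rho0) => j; case: (unliftP ord0 j) => [i ->|->].
  by rewrite tlineS subrr normr0.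
by rewrite tline0 ltr_norml; apply/andP; split; lra.
Qed.

Lemma slice_box u : ball us rho u -> ball y0 rho (slice u).
Proof.
move=> /(ball_rowE _ _ rho0) h; apply/(ball_rowE _ _ rho0) => j; case: (unliftP ord0 j) => [i ->|->].
  by rewrite sliceS -rsubmx_lift.
by rewrite slice0 subrr normr0.
Qed.

Lemma slice_rsubmx (y : 'rV[R]_n.+1) :
  y - slice (rsubmx (y : 'rV[R]_(1 + n))) = (y 0 ord0 - y0 0 ord0) *: e0.
Proof.
apply/rowP => j; rewrite [LHS]mxE [X in _ + X]mxE [RHS]mxE [in RHS]mxE.
case: (unliftP ord0 j) => [i ->|->].
  by rewrite sliceS rsubmx_lift subrr eq_sym (negbTE (neq_lift _ _)) andbF mulr0.
by rewrite slice0 !eqxx mulr1.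
Qed.

End Box.

(** * The lift in the coordinate box *)

Section LocalForm.
Context {R : realType} (n : nat) (x0 : 'rV[R]_n.+1) (r : R).
Local Notation U := (ball x0 r).
Context (z : 'rV[R]_n.+1 -> 'rV[R[i]]_n.+2) (E : 'I_n.+1 -> 'rV[R]_n.+1 -> 'rV[R]_n.+1).
Variables (d : R) (la theta tau : 'rV[R]_n.+1 -> R).
Local Notation S := (lift (@ord0 n)).
Local Notation fvec := (fvec z E).
Local Notation conn := (conn z E).
Local Notation cubic := (cubic z E).
Local Notation mu := (fmu d la (E ord0)).
Local Notation s := (fradius E d la).
Local Notation beta := (coframe0 z E).
Local Notation leg := (leg z E d la theta).
Local Notation pole := (pole z E d la theta).
Local Notation lvec := (lvec z E d la theta).
Local Notation G := (split_coord x0 z E d la theta tau).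
Local Notation e0 := (delta_mx 0 ord0 : 'rV[R]_n.+1).

Hypotheses (r0 : 0 < r) (n2 : (1 < n)%N) (d0 : d != 0) (d2 : d != 2^-1).
Hypotheses (H : legendrian_frame U z E) (NF : normal_form U z E d la).
Hypotheses (Cth : smooth_on U theta)
  (Dth : forall (x v : 'rV[R]_n.+1), U x -> 'D_v theta x = la x * beta x v).
Hypotheses (Ctau : smooth_on U tau)
  (Dtau : forall (x v : 'rV[R]_n.+1), U x -> 'D_v tau x = beta x v).

Variables (V : set 'rV[R]_n.+1) (K : 'rV[R]_n.+1 -> 'rV[R]_n.+1) (rho : R).
Local Notation y0 := (G x0).
Local Notation B := (ball y0 rho).
Hypotheses (rho0 : 0 < rho) (oV : open V) (VU : V `<=` U) (Vx0 : V x0) (CK : smooth_on B K).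
Hypothesis VB : forall x, V x -> [/\ B (G x), K (G x) = x & forall v : 'rV[R]_n.+1, 'D_v G x = 0 -> v = 0].
Hypothesis BV : forall y, B y -> V (K y) /\ G (K y) = y.

Let oU : open U. Proof. by case: H. Qed.
Let oB : open B. Proof. exact: ball_open. Qed.
Let Cz : csmooth_on U z. Proof. by case: H. Qed.
Let Ux0 : U x0. Proof. exact: ballxx. Qed.
Let Cleg : csmooth_on U leg := csmooth_leg d2 H NF Cth.
Let CG : smooth_on U G := smooth_coord d2 H NF Cth Ctau.
Let KU y : B y -> U (K y). Proof. by move=> /BV[/VU]. Qed.

Let DGK y w : B y -> 'D_('D_w K y) G (K y) = w.
Proof.
move=> By; rewrite -(derive_comp_row w (smooth_diff CK By) (smooth_diff CG (KU By))).
transitivity ('D_w (id : 'rV[R]_n.+1 -> 'rV[R]_n.+1) y); last exact: derive_id.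
apply: near_eq_derive; have := open_nbhs_nbhs (conj oB By); apply: filterS => y' By' /=.
by have [_] := BV By'.
Qed.

Let betaK y w : B y -> beta (K y) ('D_w K y) = w 0 ord0.
Proof.
move=> By; rewrite -(derive_coord_ord0 d2 H NF Cth Ctau Dtau _ (KU By)).
by rewrite DGK.
Qed.

Let DKinj y w : B y -> 'D_w K y = 0 -> w = 0.
Proof.
move=> By w0; rewrite -(DGK w By) w0 deriveE; last exact: smooth_diff CG (KU By).
by rewrite linear0.
Qed.

Let DK0 y : B y -> 'D_e0 K y = E ord0 (K y).
Proof.
move=> By; have [VK _] := BV By; have [_ _ inj] := VB VK; have UK := VU VK.
apply/eqP; rewrite -subr_eq0; apply/eqP/inj.
rewrite (derive_sub _ _ (smooth_diff CG UK)) DGK //.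
by rewrite (derive_coord0 n2 d0 d2 H NF Cth Dth Ctau Dtau UK) subrr.
Qed.

Let DcompK (h : 'rV[R]_n.+1 -> R) y w : smooth_on U h ->
  (forall x a, U x -> 'D_(E (S a) x) h x = 0) -> B y ->
  'D_w (h \o K) y = w 0 ord0 * 'D_(E ord0 (K y)) h (K y).
Proof.
move=> Ch h0 By; have UK := KU By.
rewrite (derive_comp_row w (smooth_diff CK By) (smooth_diff Ch UK)).
rewrite (derive_of_frame H _ UK (smooth_diff Ch UK) (fun a => h0 _ a UK)).
by rewrite betaK.
Qed.

Let CcompK (h : 'rV[R]_n.+1 -> R) : smooth_on U h -> smooth_on B (h \o K).
Proof. exact: (smooth_comp oB CK KU). Qed.

(** The segment between two points with equal first coordinate stays in the convex box, and its
    direction has no component along [E ord0] after applying the differential of [K]. *)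
Let constK (h : 'rV[R]_n.+1 -> R) y y' : smooth_on U h ->
  (forall x a, U x -> 'D_(E (S a) x) h x = 0) -> B y -> B y' -> y 0 ord0 = y' 0 ord0 ->
  h (K y) = h (K y').
Proof.
move=> Ch h0 By By' yy.
apply: (constant_segment (U := B) (f := h \o K) (x := y') (y := y)) => [s' hs||w Bw].
- exact: ball_segment.
- exact: CcompK.
by rewrite DcompK // !mxE yy subrr mul0r.
Qed.

Let odeK (h : 'rV[R]_n.+1 -> R) t : smooth_on U h ->
  (forall x a, U x -> 'D_(E (S a) x) h x = 0) ->
  y0 0 ord0 - rho < t < y0 0 ord0 + rho ->
  is_derive t 1 (fun t => h (K (tline y0 t))) ('D_(E ord0 (K (tline y0 t))) h (K (tline y0 t))).
Proof.
move=> Ch h0 ht; have Bt := tline_box rho0 ht.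
apply: (is_derive_along (f := h \o K)); split.
  exact: smooth_derivable (CcompK Ch) Bt.
by rewrite (DcompK _ Ch h0 Bt) mxE eqxx mul1r.
Qed.

Let Cla : smooth_on U la := smooth_la H NF.
Let Cmu : smooth_on U mu := smooth_mu d2 H NF.
Let la0 x a : U x -> 'D_(E (S a) x) la x = 0. Proof. exact: (derive_laS n2 d0 d2 H NF). Qed.
Let mu0 x a : U x -> 'D_(E (S a) x) mu x = 0. Proof. exact: (derive_muS n2 d0 d2 H NF). Qed.
Let th0 x a : U x -> 'D_(E (S a) x) theta x = 0.
Proof. by move=> Ux; rewrite Dth // (coframe0_frame H _ Ux) eq_sym (negbTE (neq_lift _ _)) mulr0. Qed.

Definition profile_lambda t := la (K (tline y0 t)).
Definition profile_mu t := mu (K (tline y0 t)).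
Definition profile_angle t := theta (K (tline y0 t)).

Lemma ode_lam t : y0 0 ord0 - rho < t < y0 0 ord0 + rho ->
  is_derive t 1 profile_lambda ((1 - 2 * d) / d * profile_lambda t * profile_mu t).
Proof.
move=> ht; have Ut := KU (tline_box rho0 ht).
by rewrite /profile_lambda /profile_mu -(derive_la0 d0 d2 NF Ut); exact: odeK.
Qed.

Lemma ode_mmu t : y0 0 ord0 - rho < t < y0 0 ord0 + rho ->
  is_derive t 1 profile_mu (- 1 - profile_mu t ^+ 2 - d * (1 - d) * profile_lambda t ^+ 2).
Proof.
move=> ht; have Ut := KU (tline_box rho0 ht).
by rewrite /profile_lambda /profile_mu -(derive_mu0 n2 d0 d2 H NF Ut); exact: odeK.
Qed.

Lemma ode_ang t : y0 0 ord0 - rho < t < y0 0 ord0 + rho -> is_derive t 1 profile_angle (profile_lambda t).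
Proof.
move=> ht; have Ut := KU (tline_box rho0 ht).
rewrite /profile_lambda (_ : la _ = 'D_(E ord0 (K (tline y0 t))) theta (K (tline y0 t))); first exact: odeK.
by rewrite Dth // (coframe0_frame H _ Ut) eqxx mulr1.
Qed.

Let onK (h : 'rV[R]_n.+1 -> R) y : smooth_on U h ->
  (forall x a, U x -> 'D_(E (S a) x) h x = 0) -> B y -> h (K y) = h (K (tline y0 (y 0 ord0))).
Proof.
move=> Ch h0 By; apply: constK => //; last by rewrite tline0.
by apply: tline_box => //; have [] := (ball_box _ rho0 _).1 By.
Qed.

Lemma laK y : B y -> la (K y) = profile_lambda (y 0 ord0). Proof. exact: onK. Qed.
Lemma muK y : B y -> mu (K y) = profile_mu (y 0 ord0). Proof. exact: onK. Qed.
Lemma thetaK y : B y -> theta (K y) = profile_angle (y 0 ord0). Proof. exact: onK. Qed.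

Let poleK x : U x -> pole x = pole x0.
Proof.
move=> Ux; apply: (cconstant_segment (U := U) (x := x0) (y := x)) => [t ht||w Uw].
- exact: ball_segment.
- exact: (csmooth_pole d2 H NF Cth).
exact: (cderive_pole n2 d0 d2 H NF Cth Dth).
Qed.

(** The values at [x0] of [leg], of the [fvec (S a)] and, in last position, of the constant vector
    [pole]. Coordinates in this unitary basis give the splitting of the ambient space in which
    [pole] is the last basis vector. *)
Definition base_frame (j : 'I_n.+2) : 'rV[R[i]]_n.+2 :=
  if unlift ord_max j is Some a then adjoin (leg x0) (fun a => fvec (S a) x0) a else pole x0.
Local Notation b := base_frame.
Local Notation Hm := (horizontal_mx b).
Local Notation Q := (frame_mx b).

Let b_max : b ord_max = pole x0. Proof. by rewrite /b unlift_none. Qed.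

Let bb i j : herm (b i) (b j) = (i == j)%:R.
Proof.
have [h1 h2 h3 h4 h5] := leg_pole_orthonormal d la H theta Ux0.
have ww a c : herm (fvec a x0) (fvec c x0) = (a == c)%:R by case: H => _ _ _ /(_ _ Ux0)[].
have h3' : herm (pole x0) (leg x0) = 0 by rewrite -herm_conj h3 conjc0.
have h4' a : herm (fvec (S a) x0) (leg x0) = 0 by rewrite -herm_conj h4 conjc0.
have h5' a : herm (pole x0) (fvec (S a) x0) = 0 by rewrite -herm_conj h5 conjc0.
rewrite /b; case: (unliftP ord_max i) => [i' ->|->]; case: (unliftP ord_max j) => [j' ->|->].
- rewrite (inj_eq lift_inj) /adjoin.
  case: (unliftP ord0 i') => [a ->|->]; case: (unliftP ord0 j') => [c ->|->] //.
  + by rewrite ww !(inj_eq lift_inj).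
  + by rewrite h4' eq_sym (negbTE (neq_lift _ _)).
  + by rewrite h4 (negbTE (neq_lift _ _)).
- rewrite eq_sym (negbTE (neq_lift _ _)) /adjoin.
  by case: (unlift _ _) => [a|] /=; rewrite ?h5 ?h3.
- rewrite (negbTE (neq_lift _ _)) /adjoin.
  by case: (unlift _ _) => [a|] /=; rewrite ?h5' ?h3'.
- by rewrite h2 eqxx.
Qed.

Lemma frame_mx_base_unitary : Q *m Q^t* = 1%:M.
Proof. exact: (frame_mx_unitary bb). Qed.

Let leg_max x : U x -> herm (leg x) (b ord_max) = 0.
Proof.
by move=> Ux; have [_ _ h _ _] := leg_pole_orthonormal d la H theta Ux; rewrite b_max -(poleK Ux).
Qed.

Let lvec_max a x : U x -> herm (lvec a x) (b ord_max) = 0.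
Proof.
move=> Ux; rewrite b_max -(poleK Ux).
exact: (lvec_pole n2 d0 d2 H NF Cth Dth).
Qed.

Local Notation D := (ball (rsubmx (y0 : 'rV[R]_(1 + n))) rho).
Let oD : open D. Proof. exact: ball_open. Qed.

Let Csl : smooth_on D (slice y0).
Proof.
move=> q; apply/Ck_rowP => // j; case: (unliftP ord0 j) => [a ->|->].
  by apply: (Ck_ext oD) (Ck_coord q a oD) => u _; rewrite sliceS.
by apply: (Ck_ext oD) (Ck_cst q D (y0 0 ord0)) => u _; rewrite slice0.
Qed.

Let Dsl0 v u : D u -> 'D_v (slice y0) u 0 ord0 = 0.
Proof.
move=> Du; rewrite (derive_row_coord _ _ (smooth_diff Csl Du)) -[RHS](derive_cst (y0 0 ord0) u v).
by congr (derive _ u v); apply/funext => w; rewrite slice0.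
Qed.

Let DslS v u a : D u -> 'D_v (slice y0) u 0 (S a) = v 0 a.
Proof.
move=> Du; rewrite (derive_row_coord _ _ (smooth_diff Csl Du)).
have Cid : smooth_on D (id : 'rV[R]_n -> 'rV[R]_n) by move=> q; exact: Ck_id.
have := derive_row_coord v a (smooth_diff Cid Du); rewrite derive_id => ->.
by congr (derive _ u v); apply/funext => w; rewrite sliceS.
Qed.

Let KS u := K (slice y0 u).

Let slB u : D u -> B (slice y0 u). Proof. exact: slice_box. Qed.
Let KSU u : D u -> U (KS u). Proof. by move/slB/KU. Qed.

Let CKS : smooth_on D KS.
Proof.
move=> q; apply/Ck_rowP => // j.
exact: (smooth_comp oD Csl slB (smooth_row oB j CK)) q.
Qed.

Let DKS v u : D u -> 'D_v KS u = 'D_('D_v (slice y0) u) K (slice y0 u).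
Proof. by move=> Du; exact: (derive_comp_row v (smooth_diff Csl Du) (smooth_diff CK (slB Du))). Qed.

Let betaKS v u : D u -> beta (KS u) ('D_v KS u) = 0.
Proof. by move=> Du; rewrite DKS // betaK ?Dsl0 //; exact: slB. Qed.

Let DKSinj v u : D u -> 'D_v KS u = 0 -> v = 0.
Proof.
move=> Du; rewrite DKS // => /(DKinj (slB Du)) h; apply/rowP => a.
by rewrite -(DslS v a Du) h !mxE.
Qed.

(** [leg] remains orthogonal to the last basis vector, so dropping that coordinate preserves its
    Hermitian products, and likewise those of its derivatives. *)
Definition local_phi (u : 'rV[R]_n) : 'rV[R[i]]_n.+1 := leg (KS u) *m Hm.
Local Notation phi := local_phi.

Let coef c v u : R := complex.Re (herm (cderive z (KS u) ('D_v KS u)) (fvec (S c) (KS u))).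

Let Ccoef c v : smooth_on D (coef c v).
Proof.
have Cd : csmooth_on D (fun u => cderive (z \o KS) u v).
  exact: (csmooth_cderive oD (csmooth_comp oD CKS KSU Cz) (smooth_cst D v)).
apply: (smooth_ext oD) (csm_herm oD Cd (csmooth_comp oD CKS KSU (csmooth_fvec H (S c)))).1 => u Du.
by rewrite (cderive_comp CKS KSU v Cz Du).
Qed.

Let DKS_frame v u : D u -> 'D_v KS u = \sum_c coef c v u *: E (S c) (KS u).
Proof.
move=> Du; rewrite [LHS](frame_decomp H _ (KSU Du)) big_ord_recl.
by rewrite -/(beta (KS u) ('D_v KS u)) betaKS // scale0r add0r.
Qed.

Let Y c u := lvec c (KS u) *m Hm.

Let Cphi : csmooth_on D phi.
Proof. exact: (csmoothMr oD _ (csmooth_comp oD CKS KSU Cleg)). Qed.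

Let Dphi v u : D u -> cderive phi u v = \sum_c (coef c v u)%:C *: Y c u.
Proof.
move=> Du; have -> : cderive phi u v = _ := cderiveMr oD Hm v (csmooth_comp oD CKS KSU Cleg) Du.
rewrite (cderive_comp CKS KSU v Cleg Du) (cderive_leg n2 d0 d2 H NF Cth Dth _ (KSU Du)).
by rewrite mulmx_suml; apply: eq_bigr => c _; rewrite -scalemxAl.
Qed.

Let hYY a c u : D u -> herm (Y a u) (Y c u) = (a == c)%:R * (s (KS u) ^+ 2)%:C.
Proof.
move=> Du; have UK := KSU Du; rewrite (herm_horizontal_mx bb) ?lvec_max //.
exact: (herm_lvec n2 d0 d2 H NF Cth Dth).
Qed.

Let hYphi a u : D u -> herm (Y a u) (phi u) = 0.
Proof.
move=> Du; have UK := KSU Du; rewrite (herm_horizontal_mx bb) ?lvec_max //.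
exact: (lvec_leg n2 d0 d2 H NF Cth Dth).
Qed.

Let hphi u : D u -> herm (phi u) (phi u) = 1.
Proof.
move=> Du; have UK := KSU Du; rewrite (herm_horizontal_mx bb) ?leg_max //.
by have [] := leg_pole_orthonormal d la H theta UK.
Qed.

Let phi_inj u v : D u -> cderive phi u v = 0 -> v = 0.
Proof.
move=> Du; rewrite Dphi // => Y0; apply: (DKSinj Du); rewrite DKS_frame // big1 // => c _.
suff -> : coef c v u = 0 by rewrite scale0r.
have : herm (\sum_c (coef c v u)%:C *: Y c u) (Y c u) = 0 by rewrite Y0 herm0l.
rewrite herm_suml (bigD1 c) //= big1 ?addr0 => [|a ac]; last first.
  by rewrite hermZl hYY // (negbTE ac) mul0r mulr0.
rewrite hermZl hYY // eqxx mul1r -rmorphM /= => /(congr1 (@complex.Re R)) /= /eqP.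
by rewrite mulf_eq0 sqrf_eq0 => /orP[/eqP //|]; rewrite gt_eqF // fradius_gt0.
Qed.

Lemma legendrian_phi : legendrian_immersion D phi.
Proof.
split=> [//|u Du|u v Du|u v Du]; first by rewrite redot_herm hphi.
  exact: phi_inj.
rewrite redot_herm hermZr Dphi // herm_suml big1 ?mulr0 // => c _.
by rewrite hermZl hYphi // mulr0.
Qed.

Let CY c : csmooth_on D (Y c).
Proof.
have Cl : csmooth_on U (lvec c) := csmooth_lvec n2 d0 d2 H NF Cth Dth c.
exact: (csmoothMr oD _ (csmooth_comp oD CKS KSU Cl)).
Qed.

Let DY f v u : D u -> cderive (Y f) u v = \sum_c (coef c v u)%:C *:
  ((- ((c == f)%:R * s (KS u) ^+ 2))%:C *: phi u +
   \sum_e (conn (S c) (S f) (S e) (KS u) +i* cubic (S c) (S f) (S e) (KS u)) *: Y e u).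
Proof.
have Cl : csmooth_on U (lvec f) := csmooth_lvec n2 d0 d2 H NF Cth Dth f.
move=> Du; have UK := KSU Du.
have -> : cderive (Y f) u v = _ := cderiveMr oD Hm v (csmooth_comp oD CKS KSU Cl) Du.
rewrite (cderive_comp CKS KSU v Cl Du) DKS_frame // (cderive_sum Cl) // mulmx_suml.
apply: eq_bigr => c _; rewrite -scalemxAl (cderive_lvec n2 d0 d2 H NF Cth Dth c f UK).
rewrite mulmxDl -scalemxAl mulmx_suml; congr (_ *: (_ + _)).
by apply: eq_bigr => e _; rewrite -scalemxAl.
Qed.

Let DDphi v w u : D u -> cderive (fun u => cderive phi u w) u v =
  \sum_f (('D_v (coef f w) u)%:C *: Y f u + (coef f w u)%:C *: cderive (Y f) u v).
Proof.
move=> Du.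
have Cc f : csm D (fun u => (coef f w u)%:C) := csm_real (Ccoef f w).
have -> : cderive (fun u => cderive phi u w) u v = cderive (fun u => \sum_f (coef f w u)%:C *: Y f u) u v.
  by apply: (cderive_ext oD v Du) => y Dy; rewrite Dphi.
rewrite (cderive_bigsum oD _ v (fun f => csmoothZ oD (Cc f) (CY f)) Du).
by apply: eq_bigr => f _; rewrite (cderiveZ oD v (Cc f) (CY f) Du) cdr_real.
Qed.

Lemma minimal_phi : minimal_legendrian D phi.
Proof.
split=> [|u Du]; first exact: legendrian_phi.
have UK := KSU Du; have [_ _ _ _ trc] := NF UK.
(* Row [a] expresses the coordinate direction [u_a] on the slice in the frame; by [betaKS] it has no
   component along [E ord0]. *)
pose A : 'M[R]_n := \matrix_(a, c) coef c (delta_mx 0 a) u.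
have dphiA a : cderive phi u (delta_mx 0 a) = \sum_c (A a c)%:C *: Y c u.
  by rewrite Dphi //; apply: eq_bigr => c _; rewrite mxE.
have Au : A \in unitmx.
  rewrite -row_free_unit -kermx_eq0; apply/eqP/row_matrixP => i; rewrite row0.
  set w := row i _; have wA : w *m A = 0 by rewrite -row_mul mulmx_ker row0.
  apply: (phi_inj Du); rewrite (row_sum_delta w) (cderive_sum Cphi) //.
  under eq_bigr => a _ do rewrite dphiA scaler_sumr.
  rewrite exchange_big big1 // => c _ /=.
  transitivity (((w *m A) 0 c)%:C *: Y c u); last by rewrite wA mxE scale0r.
  rewrite mxE (rmorph_sum (real_complex R)) /= scaler_suml.
  by apply: eq_bigr => a _; rewrite scalerA rmorphM.
have s0 : s (KS u) ^+ 2 != 0 by rewrite sqrf_eq0 gt_eqF // fradius_gt0.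
have ReJ (w : R) : complex.Re ((0 +i* 1) * w%:C) = 0 by rewrite /= mul0r mulr0 subr0.
apply: (mean_curvature_tracefree (y := Y^~ u) (s2 := s (KS u) ^+ 2) (A := A)
  (r := fun a b => \sum_c \sum_f A a c * A b f * - ((c == f)%:R * s (KS u) ^+ 2))
  (p := fun a b e => 'D_(delta_mx 0 a) (coef e (delta_mx 0 b)) u +
     \sum_c \sum_f A a c * A b f * conn (S c) (S f) (S e) (KS u))
  (C := fun c f e => cubic (S c) (S f) (S e) (KS u))) => //.
- by move=> a c; rewrite redot_herm hYY //; case: (a == c); rewrite /= ?mul0r ?mul1r ?subr0 ?mulr0.
- move=> a c; rewrite redot_herm hermZl hYY //.
  by case: (a == c); rewrite ?mul1r ?ReJ // mul0r mulr0.
- by move=> a; rewrite redot_herm hYphi.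
- by move=> a; rewrite redot_herm hermZl hYphi // mulr0.
- by rewrite redot_herm hphi.
move=> a c; rewrite DDphi //.
rewrite -(collect_second_derivative (phi u) (Y^~ u) (fun f => 'D_(delta_mx 0 a) (coef f (delta_mx 0 c)) u)
  (fun e => A a e) (fun e => A c e) (fun c f => - ((c == f)%:R * s (KS u) ^+ 2))
  (fun c f e => conn (S c) (S f) (S e) (KS u)) (fun c f e => cubic (S c) (S f) (S e) (KS u))).
have AE a' c' : coef c' (delta_mx 0 a') u = A a' c' by rewrite mxE.
apply: eq_bigr => f _; rewrite (DY f _ Du) AE.
by congr (_ + _ *: _); apply: eq_bigr => e _; rewrite AE.
Qed.

Lemma local_lift y : B y ->
  row_rcons ((expi (d * profile_angle (y 0 ord0)) /
      (Num.sqrt (1 + profile_mu (y 0 ord0) ^+ 2 + d ^+ 2 * profile_lambda (y 0 ord0) ^+ 2))%:C) *: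
      phi (rsubmx (y : 'rV[R]_(1 + n))))
    (expi ((1 - d) * profile_angle (y 0 ord0)) * (- profile_mu (y 0 ord0) +i* (d * profile_lambda (y 0 ord0))) /
      (Num.sqrt (1 + profile_mu (y 0 ord0) ^+ 2 + d ^+ 2 * profile_lambda (y 0 ord0) ^+ 2))%:C) =
  z (K y) *m Q.
Proof.
move=> By; have UK := KU By.
have Du : D (rsubmx (y : 'rV[R]_(1 + n))) by have [] := (ball_box _ rho0 _).1 By.
(* In these coordinates d/dt is [E ord0], which annihilates [leg]; so [leg] may be evaluated on the
   slice. *)
have legE : leg (K y) = leg (KS (rsubmx (y : 'rV[R]_(1 + n)))).
  have Cl := csmooth_comp oB CK KU Cleg.
  apply: (cconstant_segment (U := B) (F := leg \o K) _ Cl) => [t ht|w Bw].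
    by apply: ball_segment => //; exact: slB.
  rewrite slice_rsubmx -[_ *: e0]addr0 (cderive_lin _ _ _ Cl Bw) cderive0 addr0.
  rewrite (cderive_comp CK KU _ Cleg Bw) DK0 //.
  by rewrite (cderive_leg0 n2 d0 d2 H NF Cth Dth (KU Bw)) scaler0.
have h := mul_frame_mx_split bb (expi (d * theta (K y)) / (s (K y))%:C)
  (expi ((1 - d) * theta (K y)) * (- mu (K y) +i* (d * la (K y))) / (s (K y))%:C)
  (leg_max UK) (etrans (poleK UK) (esym b_max)).
rewrite (leg_pole_decomp z E d la theta (K y)) h legE /fradius.
by rewrite (laK By) (muK By) (thetaK By).
Qed.

Lemma legendrian_local_lift (F : 'rV[R]_n.+1 -> 'rV[R[i]]_n.+2) :
  (forall y, B y -> F y = z (K y) *m Q) -> legendrian_immersion B F.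
Proof.
move=> FE; have CzK : csmooth_on B (z \o K) := csmooth_comp oB CK KU Cz.
have CF : csmooth_on B (fun y => z (K y) *m Q) := csmoothMr oB Q CzK.
have DF y v : B y -> cderive F y v = cderive z (K y) ('D_v K y) *m Q.
  move=> By; rewrite (cderive_ext oB v By FE) -(cderive_comp CK KU v Cz By).
  exact: (cderiveMr oB Q v CzK By).
have QQ := herm_frame_mx bb.
have [_ _ _ HF] := H.
have dz x v : U x -> herm (cderive z x v) (z x) = 0.
  move=> Ux; have [_ wz _] := HF _ Ux.
  rewrite (cderive_of_frame H v Ux Cz) herm_suml big1 // => a _.
  by rewrite hermZl -fvecE wz mulr0.
split=> [|y By|y v By|y v By].
- exact: (csmooth_ext oB (fun y By => esym (FE y By))) CF.
- have [zz _ _] := HF _ (KU By).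
  by rewrite redot_herm FE // QQ zz.
- rewrite DF // => h; apply: (DKinj By); rewrite (frame_decomp H ('D_v K y) (KU By)).
  have -> : cderive z (K y) ('D_v K y) = 0.
    by rewrite -[LHS]mulmx1 -frame_mx_base_unitary mulmxA h mul0mx.
  by rewrite big1 // => a _; rewrite herm0l scale0r.
- by rewrite redot_herm hermZr DF // FE // QQ dz ?mulr0 //; exact: KU.
Qed.

End LocalForm.

Definition splitting_lift {R : realType} (n : nat) (d : R) (lam m theta : R -> R)
    (phi : 'rV[R]_n -> 'rV[R[i]]_n.+1) (y : 'rV[R]_(1 + n)) : 'rV[R[i]]_n.+2 :=
  let t := y 0 0 in
  let u := rsubmx y in
  let s := Num.sqrt (1 + m t ^+ 2 + d ^+ 2 * lam t ^+ 2) in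
  row_rcons ((expi (d * theta t) / s%:C) *: phi u)
    (expi ((1 - d) * theta t) * (- m t +i* (d * lam t)) / s%:C).

(** The theorem for a horizontal lift on an open subset of a Euclidean space. It remains to
    construct the lift and its frame from [f], and to express the result in charts of the
    manifold. *)
Theorem legendrian_splitting {R : realType} (n : nat) (U : set 'rV[R]_n.+1)
    (z : 'rV[R]_n.+1 -> 'rV[R[i]]_n.+2) (E : 'I_n.+1 -> 'rV[R]_n.+1 -> 'rV[R]_n.+1)
    (d : R) (la : 'rV[R]_n.+1 -> R) (x0 : 'rV[R]_n.+1) :
  (1 < n)%N -> d != 0 -> d != 2^-1 ->
  legendrian_frame U z E -> normal_form U z E d la -> U x0 ->
  exists (V : set 'rV[R]_n.+1) (G K : 'rV[R]_n.+1 -> 'rV[R]_n.+1) (t0 t1 : R) (D : set 'rV[R]_n)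
    (lam m theta : R -> R) (phi : 'rV[R]_n -> 'rV[R[i]]_n.+1) (Q : 'M[R[i]]_n.+2),
  let B := [set y : 'rV[R]_(1 + n) | t0 < y 0 0 < t1 /\ D (rsubmx y)] in
  let L := splitting_lift d lam m theta phi in
  [/\ Q *m Q^t* = 1%:M,
      [/\ open V, V x0, V `<=` U & open D],
      [/\ smooth_on V G, smooth_on B K /\ open B,
          forall x, V x -> [/\ B (G x), K (G x) = x & 'D_(E ord0 x) G x = delta_mx 0 ord0] &
          forall y, B y -> V (K y) /\ G (K y) = y],
      (forall x, V x -> la x = lam (G x 0 0) /\ fmu d la (E ord0) x = m (G x 0 0)) /\
      [/\ forall t, t0 < t < t1 -> is_derive t 1 lam ((1 - 2 * d) / d * lam t * m t),
          forall t, t0 < t < t1 -> is_derive t 1 m (- 1 - m t ^+ 2 - d * (1 - d) * lam t ^+ 2) &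
          forall t, t0 < t < t1 -> is_derive t 1 theta (lam t)] &
      [/\ minimal_legendrian D phi, legendrian_immersion B L &
          forall x, V x -> L (G x) = z x *m Q]].
Proof.
move=> n2 d0 d2 [oU Cz CE HU] NFU Ux0.
have /nbhs_ballP[r /= r0 rU] := open_nbhs_nbhs (conj oU Ux0).
have H : legendrian_frame (ball x0 r) z E.
  split; first exact: ball_open.
  - by move=> i j; have [C1 C2] := Cz i j; split=> q; [exact: Ck_sub rU (C1 q)|exact: Ck_sub rU (C2 q)].
  - by move=> a q; exact: Ck_sub rU (CE a q).
  - by move=> x /rU; exact: HU.
have NF : normal_form (ball x0 r) z E d la by move=> x /rU; exact: NFU.
have [tau [Ctau Dtau]] := arclength r0 n2 d0 d2 H NF.
have [theta [Cth Dth]] := angle r0 n2 d0 d2 H NF.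
have [V [K [rho [rho0 [oV VU] Vx0 CK [VB BV]]]]] := coord_chart r0 n2 d0 d2 H NF Cth Dth Ctau Dtau.
pose y0 := split_coord x0 z E d la theta tau x0.
pose B := [set y : 'rV[R]_(1 + n) | y0 0 ord0 - rho < y 0 0 < y0 0 ord0 + rho /\
  ball (rsubmx (y0 : 'rV[R]_(1 + n))) rho (rsubmx y)].
have BE : ball y0 rho = B by apply/seteqP; split=> y h; [exact: (ball_box _ rho0 y).1 h|exact: (ball_box _ rho0 y).2 h].
pose pl := profile_lambda x0 z E d la theta tau K.
pose pm := profile_mu x0 z E d la theta tau K.
pose pt := profile_angle x0 z E d la theta tau K.
pose phi := local_phi x0 z E d la theta tau K.
pose Q := frame_mx (base_frame x0 z E d la theta).
exists V, (split_coord x0 z E d la theta tau), K, (y0 0 ord0 - rho), (y0 0 ord0 + rho),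
  (ball (rsubmx (y0 : 'rV[R]_(1 + n))) rho), pl, pm, pt, phi, Q.
have laE y : B y -> la (K y) = pl (y 0 0).
  by rewrite -BE => By; apply: (laK n2 d0 d2 H NF Cth Ctau Dtau rho0 VU CK BV).
have muE y : B y -> fmu d la (E ord0) (K y) = pm (y 0 0).
  by rewrite -BE => By; apply: (muK n2 d0 d2 H NF Cth Ctau Dtau rho0 VU CK BV).
have LE y : B y -> splitting_lift d pl pm pt phi y = z (K y) *m Q.
  rewrite -BE => By.
  exact: (local_lift r0 n2 d0 d2 H NF Cth Dth Ctau Dtau rho0 VU CK VB BV By).
split.
- exact: (frame_mx_base_unitary d la theta r0 H).
- split; [exact: oV|exact: Vx0|by move=> x /VU /rU|exact: ball_open].
- split.
  + by move=> q; exact: Ck_sub VU (smooth_coord d2 H NF Cth Ctau q).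
  + by rewrite -/B -BE; split; [exact: CK|exact: ball_open].
  + move=> x Vx; have [h1 h2 _] := VB _ Vx; split; [by rewrite BE in h1; exact: h1|exact: h2|].
    exact: (derive_coord0 n2 d0 d2 H NF Cth Dth Ctau Dtau (VU x Vx)).
  + move=> y hy; have By : ball y0 rho y by rewrite BE.
    exact: BV By.
- split.
    move=> x Vx; have [h1 h2 _] := VB _ Vx; rewrite BE in h1.
    by rewrite -(laE _ h1) -(muE _ h1) h2.
  split=> t ht.
  + exact: (ode_lam n2 d0 d2 H NF Cth Ctau Dtau rho0 VU CK BV ht).
  + exact: (ode_mmu n2 d0 d2 H NF Cth Ctau Dtau rho0 VU CK BV ht).
  + exact: (ode_ang d2 H NF Cth Dth Ctau Dtau rho0 VU CK BV ht).
- split.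
  + exact: (minimal_phi r0 n2 d0 d2 H NF Cth Dth Ctau Dtau rho0 VU CK BV).
  + rewrite -/B -BE.
    apply: (legendrian_local_lift r0 d2 H NF Cth Ctau VU CK BV) => y By.
    by apply: LE; rewrite -BE.
  + move=> x Vx; have [h1 h2 _] := VB _ Vx; rewrite BE in h1.
    by rewrite LE // h2.
Qed.

(** * Horizontal lifts of Lagrangian immersions *)

Section Outer.
Context {R : realType} (m : nat).
Implicit Types (a b p q w z : 'rV[R[i]]_m.+1) (A B : 'M[R[i]]_m.+1).

Lemma redot_mxDl A B C : redot (A + B) C = redot A C + redot B C.
Proof. by rewrite /redot mulmxDl raddfD /= cReD. Qed.

Lemma redot_mxDr A B C : redot C (A + B) = redot C A + redot C B.
Proof. by rewrite /redot Defs.adjD mulmxDr raddfD /= cReD. Qed.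

Lemma redot_outer a b (c q : 'rV[R[i]]_m.+1) : redot (a^t* *m b) (c^t* *m q) = complex.Re (herm b q * herm c a).
Proof.
rewrite /redot Defs.adjM Defs.adjK mulmxA mxtrace_mulC mulmxA.
rewrite (_ : c *m (a^t* *m b) *m q^t* = (c *m a^t*) *m (b *m q^t*)); last by rewrite !mulmxA.
by rewrite herm.unlock mulrC /mxtrace big_ord1 mxE big_ord1.
Qed.

(** The differential of [hopf] at [z], applied to [w]. *)
Definition hdiff z w : 'M[R[i]]_m.+1 := w^t* *m z + z^t* *m w.

Lemma herm_mul0 p q : herm p q = 0 -> p *m q^t* = 0.
Proof. by rewrite herm.unlock => h; apply/matrixP => i j; rewrite !ord1 h mxE. Qed.

Lemma herm_mul1 z : herm z z = 1 -> z *m z^t* = 1%:M.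
Proof. by rewrite herm.unlock => h; apply/matrixP => i j; rewrite !ord1 h mxE. Qed.

Lemma redot_hdiff z p q : herm z z = 1 -> herm q z = 0 ->
  redot (hdiff z p) (hdiff z q) = 2 * complex.Re (herm p q).
Proof.
move=> zz qz; have zq : herm z q = 0 by rewrite -herm_conj qz conjc0.
rewrite /hdiff !redot_mxDl !redot_mxDr !redot_outer zz zq qz !mul0r !mulr0 !mul1r !mulr1.
by rewrite -(herm_conj q p) cReJ add0r addr0 mulr_natl mulr2n.
Qed.

Lemma redot_outer_hdiff z a b q : herm a z = 0 -> herm b z = 0 ->
  redot (a^t* *m b) (hdiff z q) = 0.
Proof.
move=> az bz; have za : herm z a = 0 by rewrite -herm_conj az conjc0.
by rewrite /hdiff redot_mxDr !redot_outer bz za mul0r mulr0 addr0.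
Qed.

Lemma hdiff_tangent z w : herm z z = 1 -> herm w z = 0 -> CP_tangent (hopf z) (hdiff z w).
Proof.
move=> zz wz; have z1 := herm_mul1 zz; have wz0 := herm_mul0 wz.
have zw : z *m w^t* = 0 by rewrite -[z]Defs.adjK -Defs.adjM wz0 trmx0 map_mx0.
split; first by rewrite /hdiff Defs.adjD !Defs.adjM !Defs.adjK addrC.
rewrite /hdiff /hopf mulmxDl mulmxDr !mulmxA.
rewrite -[w^t* *m z *m z^t*]mulmxA z1 mulmx1 -[z^t* *m w *m z^t*]mulmxA wz0 mulmx0 mul0mx addr0.
rewrite -[z^t* *m z *m w^t*]mulmxA zw mulmx0 mul0mx add0r.
by rewrite -[z^t* *m z *m z^t*]mulmxA z1 mulmx1.
Qed.

Lemma trace_adj_eq0 A : \tr (A *m A^t*) = 0 -> A = 0.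
Proof.
move=> A0; have pos i j : 0 <= A i j * (A i j)^* :> R[i] by exact: mul_conjC_ge0.
apply/matrixP => i j; rewrite mxE.
have trE : \tr (A *m A^t*) = \sum_i \sum_j A i j * (A i j)^*.
  by rewrite /mxtrace; apply: eq_bigr => k _; rewrite mxE; apply: eq_bigr => l _; rewrite !mxE.
rewrite trE in A0.
have h1 : forall i, true -> \sum_j A i j * (A i j)^* = 0.
  by apply: psumr_eq0P A0 => k _; apply: sumr_ge0.
have h2 : forall j, true -> A i j * (A i j)^* = 0 by apply: psumr_eq0P (h1 i isT).
by have /eqP := h2 j isT; rewrite mul_conjC_eq0 => /eqP.
Qed.

Lemma adjZ (c : R[i]) w : (c *: w)^t* = conjc c *: w^t*.
Proof. by apply/matrixP => i j; rewrite !mxE rmorphM. Qed.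

Lemma hopfZ (c : R[i]) z : hopf (c *: z) = (conjc c * c) *: hopf z.
Proof. by rewrite /hopf adjZ -scalemxAl -scalemxAr scalerA. Qed.

(** Let p be row i of [P] and a its diagonal entry, so that a is the squared norm of p. Then p^* p /
    a is a projector absorbed by [P] with the same trace, so their difference [B] is a projector of
    trace 0 and vanishes. The normalized row is thus an explicit unit vector over [P]. *)
Lemma rank_one P i : CP R m P -> P i i != 0 ->
  let z := (Num.sqrt (complex.Re (P i i)))^-1%:C *: row i P in
  [/\ 0 < complex.Re (P i i), herm z z = 1 & P = hopf z].
Proof.
case=> Pa PP tP Pi; pose p := row i P; set a := P i i.
have PJ k l : (P k l)^* = P l k by rewrite -{2}Pa !mxE.
have Im0 : complex.Im a = 0.
  by have := congr1 (@complex.Im R) (PJ i i); rewrite -/a cImJ; lra.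
have aC : a^* = a by exact: PJ.
have pp : p *m p^t* = a%:M.
  have -> : a = (P *m P) i i by rewrite PP.
  apply/matrixP => k l; rewrite !ord1 [RHS]mxE eqxx mulr1n !mxE.
  by apply: eq_bigr => j _; rewrite !mxE; congr (_ * _); exact: PJ.
have pP : p *m P = p by rewrite /p -row_mul PP.
have Pp : P *m p^t* = p^t* by rewrite -{1}Pa -Defs.adjM pP.
pose S := p^t* *m p.
have SS : S *m S = a *: S by rewrite /S mulmxA -[_ *m p *m p^t*]mulmxA pp mul_mx_scalar -scalemxAl.
have PS : P *m S = S by rewrite /S mulmxA Pp.
have SP : S *m P = S by rewrite /S -mulmxA pP.
have Sa : S^t* = S by rewrite /S Defs.adjM Defs.adjK.
have tS : \tr S = a by rewrite /S mxtrace_mulC pp mxtrace_scalar.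
pose B := P - a^-1 *: S.
have aC' : Num.conj a^-1 = a^-1 by rewrite fmorphV /=; congr (_^-1); exact: aC.
have Ba : B^t* = B by rewrite /B Defs.adjB Pa linearZ /= map_mxZ Sa; congr (_ - _ *: _); exact: aC'.
have BB : B *m B = B.
  rewrite /B mulmxBl !mulmxBr PP -!scalemxAl -!scalemxAr PS SP SS.
  by rewrite [a^-1 *: (a *: S)]scalerA mulVf // scale1r subrr subr0.
have B0 : B = 0.
  apply: trace_adj_eq0; rewrite Ba BB /B raddfB /= mxtraceZ tP tS mulVf //.
  exact: subrr.
have ha : a = herm p p by rewrite herm.unlock pp mxE.
have Re_gt0 : 0 < complex.Re a.
  have : 0 <= complex.Re a by rewrite ha; exact: herm_Re_ge0.
  rewrite le0r => /orP[/eqP Re0|//]; move: Pi; rewrite -/a (_ : a = 0) ?eqxx //.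
  by apply: complex_eq.
have aRe : a = (complex.Re a)%:C by apply: complex_eq.
set t := (Num.sqrt _)^-1.
have tt : t%:C * t%:C * a = 1.
  rewrite aRe -!rmorphM /= /t -invfM -expr2 sqr_sqrtr ?ltW // mulVf //.
  by rewrite gt_eqF.
have tJ : Num.conj (t%:C) = t%:C :> R[i] by apply: complex_eq => //=; rewrite oppr0.
move=> z; split=> //.
  rewrite /z hermZl hermZr -/p -ha mulrA.
  by rewrite (_ : conjc t%:C = t%:C) //; exact: tJ.
rewrite /z hopfZ /hopf -/p -/S (_ : conjc t%:C * t%:C = a^-1).
  by apply/eqP; rewrite -subr_eq0; apply/eqP; exact: B0.
by apply: (mulIf Pi); rewrite mulVf // -[RHS]tt; congr (_ * _ * _); exact: tJ.
Qed.

End Outer.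

Lemma form_primitive_cst {R : realType} (k m : nat) (x0 : 'rV[R]_k) (r : R)
    (z A : 'rV[R]_k -> 'rV[R[i]]_m) : 0 < r ->
  let U := ball x0 r in
  csmooth_on U z -> csmooth_on U A ->
  (forall x u v, U x -> complex.Re (herm (cderive z x v) (cderive A x u)) =
                        complex.Re (herm (cderive z x u) (cderive A x v))) ->
  exists g : 'rV[R]_k -> R, smooth_on U g /\
    forall x v, U x -> 'D_v g x = complex.Re (herm (cderive z x v) (A x)).
Proof.
move=> r0 U Cz CA sym.
have [|g [Cg Dg]] := form_primitive r0 Cz CA (smooth_cst U (1 : R)).
  by move=> x u v Ux; rewrite !derive_cst !mul0r !mul1r !add0r; exact: sym.
by exists g; split=> // x v Ux; rewrite Dg // mul1r.
Qed.

Section HorizontalLift.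
Context {R : realType} (k n : nat) (U : set 'rV[R]_k) (F : 'rV[R]_k -> 'M[R[i]]_n.+1).
Variable x0 : 'rV[R]_k.
Hypotheses (oU : open U) (Ux0 : U x0) (CF : csmooth_on U F).
Hypothesis FCP : forall x, U x -> CP R n (F x).
Hypothesis lagr : forall x u v, U x ->
  CP_metric (cderive F x u) (CP_J (F x) (cderive F x v)) = 0.

Lemma cderive_hopf (W : set 'rV[R]_k) (z : 'rV[R]_k -> 'rV[R[i]]_n.+1) x v : open W ->
  csmooth_on W z -> W x -> cderive (fun y => hopf (z y)) x v = hdiff (z x) (cderive z x v).
Proof.
move=> oW Cz Wx; rewrite /hopf (cderiveM oW v (csmooth_adj oW Cz) Cz Wx).
by rewrite (cderive_adj oW v Cz Wx).
Qed.

(** The trace of [F x0] is 1, so some diagonal entry is nonzero, and near [x0] the corresponding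
    normalized row is a smooth section of the Hopf fibration. *)
Let unitary_lift : exists (r : R) (z : 'rV[R]_k -> 'rV[R[i]]_n.+1),
  [/\ 0 < r, ball x0 r `<=` U, csmooth_on (ball x0 r) z &
      forall x, ball x0 r x -> herm (z x) (z x) = 1 /\ F x = hopf (z x)].
Proof.
have [i Fi] : exists i, F x0 i i != 0.
  apply: contrapT => /forallNP h; have [_ _ tF] := FCP Ux0.
  have : \tr (F x0) = 0.
    by apply: big1 => i _; apply/eqP/negbNE/negP; exact: h.
  by rewrite tF => /eqP; rewrite oner_eq0.
pose rho x := complex.Re (F x i i).
have Crho : smooth_on U rho := (CF i i).1.
have [rho0 _ _] := rank_one (FCP Ux0) Fi.
have crho : {for x0, continuous rho} := differentiable_continuous (smooth_diff Crho Ux0).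
have N1 := near_preimage crho (@open_gt R 0) rho0.
have /nbhs_ballP[r /= r0 rU] : nbhs x0 [set x : 'rV[R]_k | U x /\ 0 < rho x].
  by have := open_nbhs_nbhs (conj oU Ux0); apply: filterS2 N1 => x h1 h2; split.
exists r, (fun x => (Num.sqrt (rho x))^-1%:C *: row i (F x)); split=> //.
- by move=> x /rU[].
- have oB : open (ball x0 r) by exact: ball_open.
  have CF' : csmooth_on (ball x0 r) F.
    move=> a b; have [C1 C2] := CF a b.
    by split=> q; [apply: Ck_sub (C1 q)|apply: Ck_sub (C2 q)] => x /rU[].
  apply: csmoothZ => //.
    apply: csm_real; apply: (smoothV oB) => [x /rU[_ h]|]; first by rewrite sqrtr_eq0 -ltNge.
    by move=> q; apply: Ck_sqrt => //; [move=> x /rU[]|exact: (CF' i i).1].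
  by move=> a b; have [C1 C2] := CF' i b; split; [apply: (smooth_ext oB) C1|apply: (smooth_ext oB) C2] => x _; rewrite mxE.
move=> x /rU[Ux rx].
have Fx : F x i i != 0 by apply: contraTneq rx => h; rewrite /rho h ltxx.
by have [_ h1 h2] := rank_one (FCP Ux) Fx.
Qed.

Let imaginary_herm x0' r (z : 'rV[R]_k -> 'rV[R[i]]_n.+1) x v : csmooth_on (ball x0' r) z ->
  (forall x, ball x0' r x -> herm (z x) (z x) = 1) -> ball x0' r x ->
  complex.Re (herm (cderive z x v) (z x)) = 0.
Proof.
move=> Cz zz Bx; have oB : open (ball x0' r) by exact: ball_open.
have := cdr_herm oB v Cz Cz Bx; rewrite (cdr_ext oB v Bx zz) cdr_cst.
rewrite -(herm_conj (cderive z x v)) => /(congr1 (@complex.Re R)).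
by rewrite cReD cReJ /=; lra.
Qed.

(** Multiplying a unit lift by exp(i al) makes it horizontal when i d(al) + herm(dz, z) = 0. The
    product herm(dz, z) is imaginary, and the real form required as d(al) is closed because its
    exterior derivative is a multiple of the pulled-back Kaehler form, which the Lagrangian
    condition annihilates. With [ii] equal to -i, the real part of herm(dz, ii z) is that form. *)
Theorem horizontal_lift : exists (r : R) (z : 'rV[R]_k -> 'rV[R[i]]_n.+1),
  [/\ 0 < r, ball x0 r `<=` U, csmooth_on (ball x0 r) z &
      forall x, ball x0 r x -> [/\ herm (z x) (z x) = 1, F x = hopf (z x) &
        forall v, herm (cderive z x v) (z x) = 0]].
Proof.
have [r [z [r0 rU Cz zF]]] := unitary_lift.
have oB : open (ball x0 r) by exact: ball_open.
pose ii : R[i] := 0 -i* 1.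
have Ciz : csmooth_on (ball x0 r) (fun x => ii *: z x) := csmoothZ oB (csm_cst _ ii) Cz.
have Diz x v : ball x0 r x -> cderive (fun x => ii *: z x) x v = ii *: cderive z x v.
  by move=> Bx; rewrite (cderiveZ oB v (csm_cst _ ii) Cz Bx) cdr_cst scale0r add0r.
have Rez x v : ball x0 r x -> complex.Re (herm (cderive z x v) (z x)) = 0.
  by move=> Bx; apply: (imaginary_herm v Cz _ Bx) => y /zF[].
have Imz x u v : ball x0 r x -> complex.Im (herm (cderive z x u) (cderive z x v)) = 0.
  move=> Bx; have [zz Fx] := zF _ Bx; have Ux := rU _ Bx.
  (* The Hopf map sees only the horizontal part of [dz], to which [hopf_metric] and [hopf_J]
     apply. *)
  have hE w : cderive F x w = hdiff (z x) (cderive z x w - herm (cderive z x w) (z x) *: z x).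
    have -> : cderive F x w = cderive (fun y => hopf (z y)) x w.
      by apply: (cderive_ext oB w Bx) => y /zF[].
    rewrite (cderive_hopf w oB Cz Bx) /hdiff.
    set h := herm _ _; rewrite Defs.adjB mulmxBl mulmxBr adjZ -scalemxAl -scalemxAr.
    have -> : conjc h = - h.
      have : complex.Re h = 0 by exact: Rez.
      case: h => h1 h2 /= ->; by apply: complex_eq; rewrite /= ?oppr0.
    by rewrite scaleNr opprK addrACA subrr addr0.
  pose hz w := cderive z x w - herm (cderive z x w) (z x) *: z x.
  have hz0 w : herm (hz w) (z x) = 0 by rewrite hermBl hermZl zz mulr1 subrr.
  have := lagr v u Ux; rewrite !hE -!/(hz _) Fx.
  have z1 := herm_mul1 zz.
  have iz0 : herm ((0 +i* 1) *: hz u) (z x) = 0 by rewrite hermZl hz0 mulr0.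
  rewrite /hdiff (hopf_J z1 (herm_mul0 (hz0 u))) (hopf_metric z1 (herm_mul0 (hz0 v)) (herm_mul0 iz0)).
  rewrite redot_herm hermZr -(herm_conj (hz v)) => Re0.
  have Im1 : complex.Im (herm (hz u) (hz v)) = 0.
    by move: Re0; case: (herm _ _) => a b /=; lra.
  move: Im1; rewrite /hz hermBl hermZl !hermBr !hermZr zz.
  move: (Rez x u Bx) (Rez x v Bx); rewrite -(herm_conj (z x)).
  case: (herm (cderive z x u) (z x)) => a1 a2; case: (herm (cderive z x v) (z x)) => b1 b2.
  case: (herm _ _) => c1 c2 /= -> ->; lra.
have [|al [Cal Dal]] := form_primitive_cst r0 Cz Ciz.
  move=> x u v Bx; rewrite (Diz x u Bx) (Diz x v Bx) !hermZr.
  move: (Imz x u v Bx) (Imz x v u Bx).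
  by case: (herm (cderive z x u) _) => a1 a2; case: (herm _ _) => b1 b2 /= -> ->; lra.
have Ce := csm_expi oB Cal.
have ee x : expi (al x) * conjc (expi (al x)) = 1 by rewrite expi_conj mulrC expiN.
exists r, (fun x => expi (al x) *: z x); split=> //; first exact: csmoothZ.
move=> x Bx; have [zz Fx] := zF _ Bx; split=> [||v].
- by rewrite hermZl hermZr zz mulr1 ee.
- by rewrite Fx hopfZ mulrC ee scale1r.
rewrite (cderiveZ oB v Ce Cz Bx) (cdr_expi v Cal Bx) hermZr hermDl !hermZl zz mulr1.
have hD : (0 +i* 'D_v al x) + herm (cderive z x v) (z x) = 0.
  have := Dal x v Bx; rewrite hermZr => ->; have := Rez x v Bx.
  by case: (herm _ _) => p q /= ->; apply: complex_eq => /=; ring.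
transitivity (expi (al x) * conjc (expi (al x)) * ((0 +i* 'D_v al x) + herm (cderive z x v) (z x))).
  by set e := expi _; set t := (0 +i* _); set h := herm _ _; set p := conjc _; ring.
by rewrite hD mulr0.
Qed.

End HorizontalLift.

(** * The second fundamental form of f read on its horizontal lift *)

Section LiftedGeometry.
Context {R : realType} (n : nat) (W : set 'rV[R]_n.+1) (F : 'rV[R]_n.+1 -> 'M[R[i]]_n.+2).
Context (z : 'rV[R]_n.+1 -> 'rV[R[i]]_n.+2) (E : 'I_n.+1 -> 'rV[R]_n.+1 -> 'rV[R]_n.+1).
Local Notation fvec := (fvec z E).
Hypotheses (oW : open W) (Cz : csmooth_on W z) (CE : forall a, smooth_on W (E a)).
Hypothesis zF : forall x, W x -> [/\ herm (z x) (z x) = 1, F x = hopf (z x) &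
  forall v, herm (cderive z x v) (z x) = 0].
Hypothesis lagr : forall x u v, W x ->
  CP_metric (cderive F x u) (CP_J (F x) (cderive F x v)) = 0.
Hypothesis ortho : forall x a b, W x ->
  CP_metric (cderive F x (E a x)) (cderive F x (E b x)) = (a == b)%:R.

Lemma cderive_lift x v : W x -> cderive F x v = hdiff (z x) (cderive z x v).
Proof.
move=> Wx; rewrite -(cderive_hopf v oW Cz Wx).
by apply: (cderive_ext oW v Wx) => y /zF[].
Qed.

Lemma CP_J_lift x v : W x ->
  CP_J (F x) (cderive F x v) = hdiff (z x) ((0 +i* 1) *: cderive z x v).
Proof.
move=> Wx; have [zz Fx hz] := zF Wx.
by rewrite cderive_lift // Fx /hdiff (hopf_J (herm_mul1 zz) (herm_mul0 (hz v))).
Qed.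

Lemma CP_metric_lift x p q : W x -> herm q (z x) = 0 ->
  CP_metric (hdiff (z x) p) (hdiff (z x) q) = complex.Re (herm p q).
Proof.
move=> Wx qz; have [zz _ _] := zF Wx.
rewrite /CP_metric (redot_hdiff p zz qz) mulrC; apply: mulKf.
by rewrite pnatr_eq0.
Qed.

Let iz x v : W x -> herm ((0 +i* 1) *: cderive z x v) (z x) = 0.
Proof. by move=> Wx; have [_ _ hz] := zF Wx; rewrite hermZl hz mulr0. Qed.

Lemma CP_metric_JJ x a b : W x ->
  CP_metric (CP_J (F x) (cderive F x (E a x))) (CP_J (F x) (cderive F x (E b x))) = (a == b)%:R.
Proof.
move=> Wx; rewrite !CP_J_lift // CP_metric_lift ?iz // -(ortho a b Wx) !cderive_lift //.
have [_ _ hz] := zF Wx; rewrite CP_metric_lift // hermZl hermZr.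
by case: (herm _ _) => p q /=; ring.
Qed.

(** The real part of the product of two frame vectors is their metric product on the image of [F];
    the imaginary part is the metric product of one with J of the other, which is 0 by the
    Lagrangian condition. *)
Lemma lift_frame : legendrian_frame W z E.
Proof.
split=> // x Wx; have [zz Fx hz] := zF Wx; split=> // [a|a b]; first by rewrite fvecE.
rewrite !fvecE; apply: complex_eq.
  by rewrite cRe_nat -(ortho a b Wx) !cderive_lift // CP_metric_lift.
have := lagr (E a x) (E b x) Wx; rewrite CP_J_lift // cderive_lift // CP_metric_lift ?iz //.
by rewrite hermZr cIm_nat; case: (herm _ _) => p q /=; lra.
Qed.

Lemma redot_mxZl (m : nat) (c : R) (A B : 'M[R[i]]_m) : redot (c%:C *: A) B = c * redot A B.
Proof. by rewrite /redot -scalemxAl mxtraceZ cReM /= mul0r subr0. Qed.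

Lemma redot_mxBl (m : nat) (A B C : 'M[R[i]]_m) : redot (A - B) C = redot A C - redot B C.
Proof. by rewrite /redot mulmxBl raddfB /= cReD cReN. Qed.

Lemma redot_mx_suml (m : nat) (I : Type) (s : seq I) (A : I -> 'M[R[i]]_m.+1) B :
  redot (\sum_(i <- s) A i) B = \sum_(i <- s) redot (A i) B.
Proof.
elim: s => [|i s IH]; last by rewrite !big_cons redot_mxDl IH.
by rewrite !big_nil /redot mul0mx mxtrace0.
Qed.

(** J dF(e_k) is tangent to the projective space and normal to the immersion, so neither projection
    affects the pairing. The derivative of dF(e_j) along e_i is [hdiff] of [fcov] plus outer
    products of horizontal vectors, and these are orthogonal to every [hdiff]. There remains the
    real part of the product of [fcov] with i [fvec k], which is the cubic form. *)
Lemma lift_cubic (l : nat) (u : 'I_l -> 'rV[R]_n.+1) x i j k : W x ->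
  CP_metric (normal_part (fun a => cderive F x (u a))
      (CP_proj (F x) (cderive (fun y => cderive F y (E j y)) x (E i x))))
    (CP_J (F x) (cderive F x (E k x))) = cubic z E i j k x.
Proof.
move=> Wx; have [zz Fx hz] := zF Wx.
set A := cderive (fun _ => _) _ _.
have Cw := csmooth_fvec lift_frame.
have AE : A = hdiff (z x) (fcov z E i j x) + ((fvec j x)^t* *m fvec i x + (fvec i x)^t* *m fvec j x).
  have -> : A = cderive (fun y => (fvec j y)^t* *m z y + (z y)^t* *m fvec j y) x (E i x).
    by apply: (cderive_ext oW _ Wx) => y Wy; rewrite cderive_lift // fvecE.
  have C1 := csmoothM oW (csmooth_adj oW (Cw j)) Cz.
  have C2 := csmoothM oW (csmooth_adj oW Cz) (Cw j).
  rewrite (cderiveD oW _ C1 C2 Wx) (cderiveM oW _ (csmooth_adj oW (Cw j)) Cz Wx).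
  rewrite (cderiveM oW _ (csmooth_adj oW Cz) (Cw j) Wx) !(cderive_adj oW _ _ Wx) //.
  rewrite -fcovE -fvecE /hdiff [X in _ + X]addrC addrACA.
  by congr (_ + _); exact: addrC.
clearbody A.
set J := CP_J _ _.
have lagr0 v : redot (cderive F x v) J = 0.
  have /eqP := lagr v (E k x) Wx; rewrite -/J.
  by rewrite /CP_metric mulf_eq0 invr_eq0 pnatr_eq0 orbF => /eqP.
have hJ : J = hdiff (z x) ((0 +i* 1) *: fvec k x) by rewrite fvecE; exact: CP_J_lift.
clearbody J.
have JT : CP_tangent (F x) J by rewrite hJ Fx fvecE; apply: hdiff_tangent => //; exact: iz.
have FCP : CP R n.+1 (F x) by rewrite Fx; apply: hopf_CP; exact: herm_mul1.
have proj : redot (CP_proj (F x) A) J = redot A J.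
  by have /eqP := CP_proj_orthogonal A FCP JT; rewrite redot_mxBl subr_eq0 => /eqP.
have -> : CP_metric (normal_part (fun a => cderive F x (u a)) (CP_proj (F x) A)) J = redot A J / 2.
  rewrite /CP_metric /normal_part redot_mxBl redot_mx_suml big1 => [|a _].
    by rewrite subr0 proj.
  by rewrite redot_mx_suml big1 // => b _; rewrite redot_mxZl lagr0 mulr0.
have hk : herm ((0 +i* 1) *: fvec k x) (z x) = 0 by rewrite fvecE; exact: iz.
have hf a : herm (fvec a x) (z x) = 0 by rewrite fvecE.
rewrite AE hJ redot_mxDl (redot_hdiff _ zz hk) redot_mxDl !redot_outer_hdiff // !addr0.
by rewrite hermZr herm_fcov /=; field.
Qed.

End LiftedGeometry.

(** * Isometries of the projective space induced by unitary matrices *)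

Section UnitaryIsometry.
Context {R : realType} (m : nat) (Q : 'M[R[i]]_m.+1).
Hypothesis QQ : Q *m Q^t* = 1%:M.
Let Psi (P : 'M[R[i]]_m.+1) := Q^t* *m P *m Q.
Let QQ' : Q^t* *m Q = 1%:M. Proof. exact: mulmx1C. Qed.

Let PsiK P : Q *m Psi P *m Q^t* = P.
Proof. by rewrite /Psi !mulmxA QQ mul1mx -mulmxA QQ mulmx1. Qed.

Let Psi_CP P : CP R m P -> CP R m (Psi P).
Proof.
case=> Pa PP tP; split; first by rewrite /Psi !Defs.adjM Defs.adjK Pa mulmxA.
  by rewrite /Psi !mulmxA -[_ *m Q *m Q^t*]mulmxA QQ mulmx1 -[Q^t* *m P *m P]mulmxA PP.
by rewrite /Psi mxtrace_mulC mulmxA QQ mul1mx.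
Qed.

Lemma CP_isometry_unitary : CP_isometry Psi.
Proof.
split.
  split=> [P|P1 P2 _ _ h|P CPP]; first exact: Psi_CP.
    by rewrite -(PsiK P1) -(PsiK P2) h.
  exists (Q *m P *m Q^t*); last by rewrite /Psi !mulmxA QQ' mul1mx -mulmxA QQ' mulmx1.
  case: CPP => Pa PP tP; split; first by rewrite !Defs.adjM Defs.adjK Pa mulmxA.
    by rewrite !mulmxA -[_ *m Q^t* *m Q]mulmxA QQ' mulmx1 -[Q *m P *m P]mulmxA PP.
  by rewrite mxtrace_mulC mulmxA QQ' mul1mx.
move=> k U c oU Cc cCP.
have C1 := csmoothM oU (csmooth_cst U (Q^t*)) Cc.
split=> [|x v w Ux]; first exact: (csmoothMr oU Q C1).
have D v' : cderive (Psi \o c) x v' = Psi (cderive c x v').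
  have -> : cderive (Psi \o c) x v' = _ := cderiveMr oU Q v' C1 Ux.
  by rewrite (cderiveM oU v' (csmooth_cst U (Q^t*)) Cc Ux) cderive_cst mul0mx add0r.
rewrite !D /CP_metric /redot /Psi !Defs.adjM Defs.adjK !mulmxA.
rewrite -[_ *m Q *m Q^t*]mulmxA QQ mulmx1.
by rewrite mxtrace_mulC !mulmxA QQ mul1mx.
Qed.

Lemma hopf_unitary (z : 'rV[R[i]]_m.+1) : hopf (z *m Q) = Psi (hopf z).
Proof. by rewrite /hopf /Psi Defs.adjM !mulmxA. Qed.

End UnitaryIsometry.

(** * Charts *)

Lemma open_chart_region {R : realType} (k : nat) (M : topologicalType) (c : chart R k M) (V : set M) :
  open V -> open [set x | chart_cod c x /\ V (chart_from c x)].
Proof.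
move=> oV; rewrite openE => x [cx Vx].
have N1 := near_preimage (chart_from_continuous cx) oV Vx.
have := open_nbhs_nbhs (conj (@chart_cod_open _ _ _ c) cx).
by apply: filterS2 N1 => y h1 h2; split.
Qed.

Lemma smooth_comp_row {R : realType} (k l m : nat) (U : set 'rV[R]_k) (V : set 'rV[R]_l)
    (K : 'rV[R]_k -> 'rV[R]_l) (f : 'rV[R]_l -> 'rV[R]_m) :
  open U -> open V -> smooth_on U K -> (forall x, U x -> V (K x)) -> smooth_on V f ->
  smooth_on U (f \o K).
Proof.
move=> oU oV CK UV Cf q; apply/Ck_rowP => // j.
exact: (smooth_comp oU CK UV (smooth_row oV j Cf)) q.
Qed.

Section ChartCalculus.
Context {R : realType} (k : nat) (M : manifold R k) (c : chart R k M) (V : set M).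
Hypotheses (ac : atlas c) (oV : open V) (Vc : V `<=` chart_dom c).

Definition chart_region : set 'rV[R]_k := [set x | chart_cod c x /\ V (chart_from c x)].
Local Notation U := chart_region.

Lemma open_region : open U. Proof. exact: open_chart_region. Qed.

Lemma region_to p : V p -> U (chart_to c p).
Proof. by move=> Vp; have [h1 h2] := chart_toP (Vc Vp); split=> //; rewrite h2. Qed.

(** Tangent vectors at [p] are written in the chart preferred at [p], which varies with [p]. This
    transports them to the fixed chart [c], where the calculus on open sets applies. *)
Definition tangent_coord (p : M) (v : 'rV[R]_k) : 'rV[R]_k :=
  'D_v (chart_to c \o chart_from (chart_at p)) (chart_to (chart_at p) p).

Section AtPoint.
Variables (p : M) (Vp : V p).
Let cp := chart_at p.
Let Up : set 'rV[R]_k := [set x | chart_cod cp x /\ V (chart_from cp x)].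
Let K := chart_to c \o chart_from cp.
Let yp := chart_to cp p.

Let oUp : open Up. Proof. exact: open_chart_region. Qed.

Let Uyp : Up yp.
Proof. by have [h1 h2] := chart_toP (dom_chart_at p); split=> //; rewrite h2. Qed.

Let CK : smooth_on Up K.
Proof.
by move=> q; apply: Ck_sub (atlas_smooth (atlas_chart_at p) ac q) => x [h1 h2]; split=> //; exact: Vc.
Qed.

Let KU x : Up x -> U (K x).
Proof. by case=> _ /region_to. Qed.

Let Kyp : K yp = chart_to c p.
Proof. by have [h1 h2] := chart_toP (dom_chart_at p); rewrite /K /= h2. Qed.

Lemma mderive_chart (T : normedModType R) (g : M -> T) (G : 'rV[R]_k -> T) v :
  smooth_on U G -> (forall q, V q -> g q = G (chart_to c q)) ->
  mderive g p v = 'D_(tangent_coord p v) G (chart_to c p).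
Proof.
move=> CG gG; have UK : U (K yp) by exact: KU.
have h := derive_comp_row v (smooth_diff CK Uyp) (smooth_diff CG UK).
rewrite -Kyp; apply: etrans h; apply: near_eq_derive.
by have := open_nbhs_nbhs (conj oUp Uyp); apply: filterS => y [_ Vy] /=; rewrite gG.
Qed.

Lemma mcderive_chart (a b : nat) (g : M -> 'M[R[i]]_(a, b)) (G : 'rV[R]_k -> 'M[R[i]]_(a, b)) v :
  csmooth_on U G -> (forall q, V q -> g q = G (chart_to c q)) ->
  mcderive g p v = cderive G (chart_to c p) (tangent_coord p v).
Proof.
move=> CG gG; apply/matrixP => i j; rewrite !mxE; have [C1 C2] := CG i j.
congr (_ +i* _).
  by apply: (mderive_chart (g := fun q => complex.Re (g q i j)) v C1) => q /gG ->.
by apply: (mderive_chart (g := fun q => complex.Im (g q i j)) v C2) => q /gG ->.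
Qed.

Lemma tangent_coord_surj w : exists v, tangent_coord p v = w.
Proof.
pose Ki := chart_to cp \o chart_from c.
pose V' : set M := V `&` chart_dom cp.
have oV' : open V' by apply: openI => //; exact: chart_dom_open.
pose Uc : set 'rV[R]_k := [set x | chart_cod c x /\ V' (chart_from c x)].
have oUc : open Uc by exact: open_chart_region.
have [hc1 hc2] := chart_toP (Vc Vp).
have Ucp : Uc (chart_to c p) by split=> //; rewrite hc2; split=> //; exact: dom_chart_at.
have CKi : smooth_on Uc Ki.
  by move=> q; apply: Ck_sub (atlas_smooth ac (atlas_chart_at p) q) => x [h1 [h2 h3]]; split.
have Kip : Ki (chart_to c p) = yp by rewrite /Ki /= hc2.
exists ('D_w Ki (chart_to c p)).
have dK : differentiable K (Ki (chart_to c p)) by rewrite Kip; exact: smooth_diff CK Uyp.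
have := derive_comp_row w (smooth_diff CKi Ucp) dK; rewrite Kip => h.
apply: etrans (esym h) _.
transitivity ('D_w (id : 'rV[R]_k -> 'rV[R]_k) (chart_to c p)); last exact: derive_id.
apply: near_eq_derive; have := open_nbhs_nbhs (conj oUc Ucp).
apply: filterS => y [cy [Vy dy]] /=.
have [_ h2] := chart_toP dy; rewrite /K /Ki /= h2.
by have [] := chart_fromP cy.
Qed.

Lemma tangent_coordE v j : tangent_coord p v 0 j = mderive (fun q => chart_to c q 0 j) p v.
Proof. exact: (derive_row_coord v j (smooth_diff CK Uyp)). Qed.

End AtPoint.

(** Smoothness of a vector field is defined by its action on functions; applied to the coordinate
    functions of [c] it gives the smoothness of the components. *)
Lemma smooth_frame_coord (W : set M) (X : M -> 'rV[R]_k) : smooth_vector_field W X -> V `<=` W ->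
  smooth_on U (fun x => tangent_coord (chart_from c x) (X (chart_from c x))).
Proof.
move=> SX VW q; apply/Ck_rowP => [|j]; first exact: open_region.
have mk : msmooth V (fun p => chart_to c p 0 j).
  move=> c' ac'.
  have C : smooth_on [set x | chart_cod c' x /\ V (chart_from c' x)] (chart_to c \o chart_from c').
    by move=> q'; apply: Ck_sub (atlas_smooth ac' ac q') => x [h1 h2]; split=> //; exact: Vc.
  exact: (smooth_row (open_chart_region oV) j C).
have := SX V _ oV VW mk c ac q; apply: Ck_ext; first exact: open_region.
by move=> x [_ Vx] /=; rewrite tangent_coordE.
Qed.

End ChartCalculus.

Lemma open_chart_preimage {R : realType} (k : nat) (M : topologicalType) (c : chart R k M)
    (B : set 'rV[R]_k) : open B -> open [set p | chart_dom c p /\ B (chart_to c p)].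
Proof.
move=> oB; rewrite openE => p [dp Bp].
have N1 := near_preimage (chart_to_continuous dp) oB Bp.
have := open_nbhs_nbhs (conj (@chart_dom_open _ _ _ c) dp).
by apply: filterS2 N1 => q h1 h2; split.
Qed.

Lemma change_of_coordinates {R : realType} (k : nat) (M : manifold R k) (c : chart R k M)
    (V B : set 'rV[R]_k) (G K : 'rV[R]_k -> 'rV[R]_k) : atlas c ->
  open V -> open B -> V `<=` chart_cod c -> smooth_on V G -> smooth_on B K ->
  (forall x, V x -> B (G x) /\ K (G x) = x) -> (forall y, B y -> V (K y) /\ G (K y) = y) ->
  exists x : chart R k M,
    [/\ chart_dom x = [set p | chart_dom c p /\ V (chart_to c p)], chart_cod x = B,
        chart_to x = G \o chart_to c, chart_from x = chart_from c \o K & smooth_chart x].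
Proof.
move=> ac oV oB Vc CG CK VB BV.
pose dom : set M := [set p | chart_dom c p /\ V (chart_to c p)].
have odom : open dom by exact: open_chart_preimage.
have toP p : dom p -> B (G (chart_to c p)) /\ chart_from c (K (G (chart_to c p))) = p.
  by case=> dp /VB[h1 ->]; split=> //; have [] := chart_toP dp.
have fromP y : B y -> dom (chart_from c (K y)) /\ G (chart_to c (chart_from c (K y))) = y.
  move=> /BV[/[dup] VK /Vc /chart_fromP[h1 h2] h3].
  by split; [split=> //; rewrite h2|rewrite h2].
have to_cont p : dom p -> {for p, continuous (G \o chart_to c)}.
  case=> dp Vp; apply: continuous_comp; first exact: chart_to_continuous.
  exact: differentiable_continuous (smooth_diff CG Vp).
have from_cont y : B y -> {for y, continuous (chart_from c \o K)}.
  move=> By; have [VK _] := BV _ By.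
  apply: continuous_comp; first exact: differentiable_continuous (smooth_diff CK By).
  by apply: chart_from_continuous; exact: Vc.
exists (@Chart R k M dom B (G \o chart_to c) (chart_from c \o K) odom oB toP fromP to_cont from_cont).
split=> // c' ac'; split; rewrite /smooth_transition /=.
- have oV' : open [set x | chart_cod c x /\ chart_dom c' (chart_from c x)].
    by apply: open_chart_region; exact: chart_dom_open.
  have oU : open [set y | B y /\ chart_dom c' (chart_from c (K y))].
    rewrite openE => y [By dy].
    have N1 := near_preimage (from_cont _ By) (@chart_dom_open _ _ _ c') dy.
    have := open_nbhs_nbhs (conj oB By).
    by apply: filterS2 N1 => q h1 h2; split.
  apply: (smooth_comp_row (f := chart_to c' \o chart_from c) (K := K) oU oV').
  + by move=> q; apply: Ck_sub (CK q) => y [].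
  + by move=> y [/BV[/Vc h1 _] h2]; split.
  + exact: atlas_smooth.
- have oU : open [set y | chart_cod c' y /\ dom (chart_from c' y)] by exact: open_chart_region.
  apply: (smooth_comp_row (f := G) (K := chart_to c \o chart_from c') oU oV) => //.
  + by move=> q; apply: Ck_sub (atlas_smooth ac' ac q) => y [h1 [h2 _]]; split.
  + by move=> y [_ []].
Qed.

Section CPMetric.
Context {R : realType} (m : nat).
Implicit Types (A B C : 'M[R[i]]_m.+1).

Lemma CP_metricC A B : CP_metric A B = CP_metric B A.
Proof. by rewrite /CP_metric Defs.redot_sym. Qed.

Lemma CP_metricDl A B C : CP_metric (A + B) C = CP_metric A C + CP_metric B C.
Proof. by rewrite /CP_metric redot_mxDl mulrDl. Qed.

Lemma CP_metricZl (r : R) A B : CP_metric (r%:C *: A) B = r * CP_metric A B.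
Proof. by rewrite /CP_metric redot_mxZl mulrA. Qed.

Lemma CP_metric_suml (I : Type) (s : seq I) (A : I -> 'M[R[i]]_m.+1) B :
  CP_metric (\sum_(i <- s) A i) B = \sum_(i <- s) CP_metric (A i) B.
Proof. by rewrite /CP_metric redot_mx_suml mulr_suml. Qed.

End CPMetric.

(* The dimension of M is n.+1; the index 1 of the frame is ord0 and the
   indices 2, ..., n.+1 are lift ord0 a for a : 'I_n. *)
Theorem theorem3p2 (R : realType) (n : nat) (M : riemannian_manifold R n.+1)
    (f : M -> 'M[R[i]]_n.+2) (d : R) (W : set M)
    (e : 'I_n.+1 -> M -> 'rV[R]_n.+1) (lambda : M -> R)
    (hc : 'I_n -> 'I_n -> 'I_n -> M -> R) :
  (3 <= n.+1)%N ->
  lagrangian f ->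
  d != 0 -> d != 2^-1 ->
  orthonormal_frame W e ->
  (forall p, W p -> lambda p != 0) ->
  (let h i j p := second_fundamental_form f (e i) (e j) p in
   let Je i p := CP_J (f p) (mcderive f p (e i p)) in
   forall p, W p ->
   [/\ h ord0 ord0 p = (lambda p)%:C *: Je ord0 p,
       forall a : 'I_n,
         h ord0 (lift ord0 a) p = (d * lambda p)%:C *: Je (lift ord0 a) p,
       forall a b : 'I_n,
         h (lift ord0 a) (lift ord0 b) p =
           ((a == b)%:R * (d * lambda p))%:C *: Je ord0 p +
           \sum_(c < n) (hc a b c p)%:C *: Je (lift ord0 c) p &
       forall c : 'I_n, \sum_(a < n) hc a a c p = 0]) ->
  let mu p := d / ((1 - 2 * d) * lambda p) * mderive lambda p (e ord0 p) in
  forall p0, W p0 ->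
  exists (Psi : 'M[R[i]]_n.+2 -> 'M[R[i]]_n.+2)
         (x : chart R n.+1 M) (t0 t1 : R) (D : set 'rV[R]_n)
         (lam m theta : R -> R) (phi : 'rV[R]_n -> 'rV[R[i]]_n.+1),
    let L (y : 'rV[R]_(1 + n)) : 'rV[R[i]]_n.+2 :=
      let t := y 0 0 in
      let u := rsubmx y in
      let s := Num.sqrt (1 + m t ^+ 2 + d ^+ 2 * lam t ^+ 2) in
      row_rcons ((expi (d * theta t) / s%:C) *: phi u)
        (expi ((1 - d) * theta t) * (- m t +i* (d * lam t)) / s%:C) in
    [/\ CP_isometry Psi,
        smooth_chart x /\
        [/\ chart_dom x p0, chart_dom x `<=` W, open D,
            chart_cod x = [set y : 'rV[R]_(1 + n) |
                             t0 < y 0 0 < t1 /\ D (rsubmx y)] &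
            forall p, chart_dom x p ->
              mderive (chart_to x) p (e ord0 p) = delta_mx 0 ord0],
        forall p, chart_dom x p ->
          lambda p = lam (chart_to x p 0 0) /\ mu p = m (chart_to x p 0 0),
        [/\ forall t, t0 < t < t1 ->
              is_derive t 1 lam ((1 - 2 * d) / d * lam t * m t),
            forall t, t0 < t < t1 ->
              is_derive t 1 m (- 1 - m t ^+ 2 - d * (1 - d) * lam t ^+ 2) &
            forall t, t0 < t < t1 -> is_derive t 1 theta (lam t)] &
        [/\ minimal_legendrian D phi,
            legendrian_immersion (chart_cod x) L &
            forall p, chart_dom x p ->
              hopf (L (chart_to x p)) = Psi (f p)]].

Proof.
move=> n3 [[Cf fCP fisom] fJ] d0 d2 [oW SE Eon] la_n0 hh mu p0 Wp0.
have n2 : (1 < n)%N by [].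
pose c := chart_at p0; have ac : atlas c := atlas_chart_at p0.
pose V : set M := W `&` chart_dom c.
have oV : open V by apply: openI => //; exact: chart_dom_open.
have Vc : V `<=` chart_dom c by move=> p [].
have VW : V `<=` W by move=> p [].
have Vp0 : V p0 by split=> //; exact: dom_chart_at.
pose U := chart_region c V; have oU : open U by exact: open_region.
pose F := f \o chart_from c; pose x0 := chart_to c p0.
have Ux0 : U x0 by exact: region_to.
have CF : csmooth_on U F.
  by move=> i j; have [C1 C2] := Cf c ac i j; split=> q; [apply: Ck_sub (C1 q)|apply: Ck_sub (C2 q)] => x [].
have fF q : V q -> f q = F (chart_to c q) by move=> /Vc/chart_toP[_ h]; rewrite /F /= h.
have mf p v : V p -> mcderive f p v = cderive F (chart_to c p) (tangent_coord c p v).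
  by move=> Vp; exact: (mcderive_chart ac oV Vc Vp v CF fF).
pose Eh a x := tangent_coord c (chart_from c x) (e a (chart_from c x)).
have CEh a : smooth_on U (Eh a) by exact: (smooth_frame_coord ac oV Vc (SE a) VW).
have EhE a p : V p -> tangent_coord c p (e a p) = Eh a (chart_to c p).
  by move=> /Vc/chart_toP[_ h]; rewrite /Eh h.
have DfE a p : V p -> mcderive f p (e a p) = cderive F (chart_to c p) (Eh a (chart_to c p)).
  by move=> Vp; rewrite -(EhE a p Vp); exact: (mf p (e a p) Vp).
have FCP x : U x -> CP R n.+1 (F x) by move=> _; exact: fCP.
have UV x : U x -> V (chart_from c x) /\ chart_to c (chart_from c x) = x.
  by case=> cx Vx; split=> //; have [] := chart_fromP cx.
(* Every vector in the chart is the transport of a tangent vector of the manifold, so the normality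
   of J df(v) passes to [F]. *)
have lagrU x u v : U x -> CP_metric (cderive F x u) (CP_J (F x) (cderive F x v)) = 0.
  case/UV; set p := chart_from c x => Vp <-.
  have [u' <-] := tangent_coord_surj ac oV Vc Vp u.
  have [v' <-] := tangent_coord_surj ac oV Vc Vp v.
  rewrite -!mf // -fF // CP_metricC.
  have : [set CP_J (f p) (mcderive f p v) | v in setT] (CP_J (f p) (mcderive f p v')) by exists v'.
  by rewrite fJ => -[_]; exact.
have ortho x a b : U x -> CP_metric (cderive F x (Eh a x)) (cderive F x (Eh b x)) = (a == b)%:R.
  case/UV => Vp {1 2 3 4}<-; rewrite -(DfE a _ Vp) -(DfE b _ Vp) fisom.
  by apply: Eon; exact: VW.
have [r [z [r0 rU Cz zF]]] := horizontal_lift oU Ux0 CF FCP lagrU.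
pose B0 := ball x0 r.
have oB0 : open B0 by exact: ball_open.
have CEB a : smooth_on B0 (Eh a) by move=> q; exact: Ck_sub rU (CEh a q).
have lagrB x u v : B0 x -> CP_metric (cderive F x u) (CP_J (F x) (cderive F x v)) = 0.
  by move/rU; exact: lagrU.
have orthoB x a b : B0 x -> CP_metric (cderive F x (Eh a x)) (cderive F x (Eh b x)) = (a == b)%:R.
  by move/rU; exact: ortho.
have H : legendrian_frame B0 z Eh := lift_frame oB0 Cz CEB zF lagrB orthoB.
have sffE p i j k : V p -> B0 (chart_to c p) ->
  CP_metric (second_fundamental_form f (e i) (e j) p) (CP_J (f p) (mcderive f p (e k p))) =
  cubic z Eh i j k (chart_to c p).
  move=> Vp Bp; have fx := fF _ Vp.
  have h1 := DfE k p Vp.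
  have h2 : (fun a : 'I_n.+1 => mcderive f p (delta_mx 0 a)) =
      (fun a => cderive F (chart_to c p) (tangent_coord c p (delta_mx 0 a))).
    by apply/funext => a; exact: mf.
  have C2 := csmooth_cderive oU CF (CEh j).
  have h3 : mcderive (fun q => mcderive f q (e j q)) p (e i p) =
      cderive (fun y => cderive F y (Eh j y)) (chart_to c p) (Eh i (chart_to c p)).
    rewrite -(EhE i p Vp); apply: (mcderive_chart ac oV Vc Vp _ C2) => q Vq.
    exact: DfE.
  rewrite /second_fundamental_form h1 h2 h3 fx.
  exact: (lift_cubic oB0 Cz CEB zF lagrB orthoB _ i j k Bp).
pose la x := lambda (chart_from c x).
(* The vectors J df(e_k) are orthonormal, so pairing the assumed expressions for the second
   fundamental form with them reads off the entries of the cubic form by [sffE]. *)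
have NF : normal_form B0 z Eh d la.
  move=> x Bx; have Ux := rU _ Bx; have [Vp xE] := UV _ Ux.
  set p := chart_from c x in Vp xE.
  have Bp : B0 (chart_to c p) by rewrite xE.
  have JJ a b : CP_metric (CP_J (f p) (mcderive f p (e a p))) (CP_J (f p) (mcderive f p (e b p))) = (a == b)%:R.
    rewrite (DfE a _ Vp) (DfE b _ Vp) (fF _ Vp).
    exact: (CP_metric_JJ oB0 Cz zF orthoB).
  have Sne (a : 'I_n) : (lift ord0 a == ord0 :> 'I_n.+1) = false.
    by rewrite eq_sym (negbTE (neq_lift _ _)).
  have [h00 h0S hSS htr] := hh p (VW _ Vp).
  have cE i j k : cubic z Eh i j k x = _ := etrans (congr1 _ (esym xE)) (esym (sffE p i j k Vp Bp)).
  split.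
  - by apply: la_n0; exact: VW.
  - by rewrite cE h00 CP_metricZl JJ eqxx mulr1.
  - by move=> a; rewrite cE h00 CP_metricZl JJ eq_sym Sne mulr0.
  - move=> a b; rewrite cE h0S CP_metricZl JJ (inj_eq lift_inj) mulrC.
    by [].
  - move=> a; rewrite -[RHS](htr a); apply: eq_bigr => b _.
    rewrite cE hSS CP_metricDl CP_metricZl JJ eq_sym Sne mulr0 add0r CP_metric_suml.
    rewrite (bigD1 a) //= big1 ?addr0 => [|g ga]; first by rewrite CP_metricZl JJ eqxx mulr1.
    by rewrite CP_metricZl JJ (inj_eq lift_inj) (negbTE ga) mulr0.
have Cla : smooth_on B0 la := smooth_la H NF.
(* The region over which the lift exists; there [lambda] is smooth, being a component of the cubic
   form. *)
pose V1 : set M := [set p | chart_dom c p /\ B0 (chart_to c p)].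
have oV1 : open V1 by exact: open_chart_preimage.
have V1c : V1 `<=` chart_dom c by move=> p [].
have V1V : V1 `<=` V by move=> p [/chart_toP[_ h] /rU[_]]; rewrite h.
have V1B : chart_region c V1 `<=` B0.
  by move=> x [cx [_]]; have [_ ->] := chart_fromP cx.
have muE p : V1 p -> mu p = fmu d la (Eh ord0) (chart_to c p).
  move=> V1p; have Vp := V1V _ V1p; have [_ h] := chart_toP (Vc _ Vp).
  rewrite /mu /fmu /la h -EhE //; congr (_ * _).
  have CU : smooth_on (chart_region c V1) la by move=> q; exact: Ck_sub V1B (Cla q).
  apply: (mderive_chart ac oV1 V1c V1p (e ord0 p) CU) => q V1q.
  by have [_ hq] := chart_toP (V1c _ V1q); rewrite /la hq.
have [V0 [G [K [t0 [t1 [D [lam [m [theta [phi [Q]]]]]]]]]]] :=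
  legendrian_splitting n2 d0 d2 H NF (ballxx x0 r0).
move=> [QQ [oV0 V0x0 V0B oD] [CG [CK oB] V0P BP] [laE odes] [minphi legL LE]].
have V0cod : V0 `<=` chart_cod c by move=> x /V0B/rU[].
have V0P' x : V0 x -> _ /\ _ := fun h => let: And3 a b _ := V0P x h in conj a b.
have [x [xdom xcod xto xfrom xsm]] := change_of_coordinates ac oV0 oB V0cod CG CK V0P' BP.
have V0V1 p : chart_dom x p -> V1 p /\ V0 (chart_to c p).
  by rewrite xdom => -[dp V0p]; split=> //; split=> //; exact: V0B.
(* Right multiplication of the lift by [Q] conjugates its projector, so the unitary change of basis
   descends to this isometry. *)
exists (fun P => Q^t* *m P *m Q), x, t0, t1, D, lam, m, theta, phi => L; split.
- exact: CP_isometry_unitary.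
- split=> //; split=> //.
  + by rewrite xdom; split; [exact: dom_chart_at|exact: V0x0].
  + by move=> p /V0V1[/V1V/VW].
  + move=> p /V0V1[V1p V0p]; rewrite xto.
    have [_ _ DG] := V0P _ V0p; rewrite -DG -EhE; last exact: V1V.
    pose V2 : set M := [set p | chart_dom c p /\ V0 (chart_to c p)].
    have oV2 : open V2 by exact: open_chart_preimage.
    have V2c : V2 `<=` chart_dom c by move=> q [].
    have V2p : V2 p by split=> //; case: V1p.
    have CU : smooth_on (chart_region c V2) G.
      by move=> q; apply: Ck_sub (CG q) => y [cy [_]]; have [_ ->] := chart_fromP cy.
    exact: (mderive_chart ac oV2 V2c V2p (e ord0 p) CU).
- move=> p /V0V1[V1p V0p]; rewrite xto /= muE //.
  have [l1 l2] := laE _ V0p; rewrite -l1 -l2; split=> //.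
  by have [_ h] := chart_toP (V1c _ V1p); rewrite /la h.
- exact: odes.
- split=> //; first by rewrite xcod.
  move=> p /V0V1[V1p V0p]; rewrite xto /= (LE _ V0p : L (G (chart_to c p)) = _) hopf_unitary.
  by have [_ zE _] := zF _ (V0B _ V0p); rewrite -zE -fF //; exact: V1V.
Qed.
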